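(* Let $T>0$, $m\ge 2$, $\alpha\in(0,1)$, and let $\phi$ be given initial data. For $\varepsilon\in(0,1]$ set $T_\varepsilon=T/\varepsilon^2$ and let $w=w(x,t)$ be the exact solution of the cubic nonlinear Schrödinger equation $$i\partial_t w=-\partial_x^2 w+\varepsilon^2|w|^2w,\quad x\in\mathbb{T},\ t>0,\qquad w(x,0)=\phi(x).$$ Assume that $\|w\|_{L^\infty([0,T_\varepsilon];H^m)}$ is bounded by a constant independent of $\varepsilon$, and set $M:=\|w\|_{L^\infty([0,T_\varepsilon];H^1)}$. Let $w^0=\phi$ and let $w^n$ be computed by the non-resonant first-order low-regularity integrator $$w^{n+1}=e^{i\tau\partial_x^2}\left[w^n-i\tau\varepsilon^2(w^n)^2\left(\varphi_1(-2i\tau\partial_x^2)\overline{w^n}\right)\right]-2i\varepsilon^2\tau\,(\widehat{g(w^n)})_0\,e^{i\tau\partial_x^2}w^n+i\varepsilon^2\tau\,e^{i\tau\partial_x^2}h(w^n),$$ where $$g(u)=u\,\big(1-\varphi_1(-2i\tau\partial_x^2)\big)\overline{u},\qquad (\widehat{h(u)})_l=\big(1-\varphi_1(2il^2\tau)\big)\,\overline{\hat u_l}\,\hat u_l\,\hat u_l .$$ Then there exist $\tau_*\in(0,1]$ and $C>0$, independent of $\varepsilon$, such that for every $\tau_0\in(0,\tau_*]$ and every $\tau$ with $0<\tau\le\frac{\alpha\pi\tau_0^2}{(1+\tau_0)^2}<1$ (with $C$ independent also of $\tau$ and $\tau_0$), $$\|w(t_n)-w^n\|_1\le C\left(\varepsilon^2\tau+\tau_0^{m-1}\right),\qquad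 \|w^n\|_1\le 1+M,\qquad 0\le n\le\frac{T/\varepsilon^2}{\tau}.$$
   Context: $\mathbb{T}=(-\pi,\pi)$ is the one-dimensional torus, $H^s=H^s(\mathbb{T})$ is the standard periodic Sobolev space of complex-valued functions (written $H^s_{\rm per}$ in the source), and $\|\cdot\|_s$ its norm. Time grid: $t_n=n\tau$. For $f\in L^2(\mathbb{T})$ write $f(x)=\sum_{l\in\mathbb{Z}}\hat f_le^{ilx}$, and $(\hat f)_0=\hat f_0$. $e^{it\partial_x^2}$ is the Fourier multiplier with symbol $e^{-itl^2}$. $\varphi_1(z)=\frac{e^z-1}{z}$ with $\varphi_1(0)=1$, and $\varphi_1(-2i\tau\partial_x^2)$ is the Fourier multiplier with symbol $\varphi_1(2i\tau l^2)$. Solutions are understood in the mild (Duhamel) sense. *)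

(* Defs.v *)
From HB Require Import structures.
From mathcomp Require Import all_boot all_order all_algebra.
From mathcomp Require Import complex.
From mathcomp Require Import all_classical all_reals all_analysis ess_sup_inf.
Import Order.TTheory GRing.Theory Num.Theory.
Import numFieldNormedType.Exports.

Set Implicit Arguments.
Unset Strict Implicit.
Unset Printing Implicit Defensive.

Local Open Scope classical_set_scope.
Local Open Scope ring_scope.
Local Open Scope complex_scope.

(* The torus is ]-pi, pi[ up to null sets: a function on it is represented by
   a function R -> R[i] of which only the values on [torus] matter. *)
Definition torus (R : realType) : set R := `](- pi)%R, pi[.
Arguments torus : clear implicits.

Definition cintegral (R : realType) (D : set R) (f : R -> R[i]) : R[i] :=
  Rintegral lebesgue_measure D (fun x => complex.Re (f x))
  +i* Rintegral lebesgue_measure D (fun x => complex.Im (f x)).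

Definition cexp (R : realType) (z : R[i]) : R[i] :=
  (expR (complex.Re z))%:C * (cos (complex.Im z) +i* sin (complex.Im z)).

Definition phi1 (R : realType) (z : R[i]) : R[i] :=
  if z == 0 then 1 else (cexp z - 1) / z.

Definition square_integrable (R : realType) (f : R -> R[i]) : Prop :=
  [/\ measurable_fun (torus R) (fun x => complex.Re (f x)),
      measurable_fun (torus R) (fun x => complex.Im (f x)) &
      lebesgue_measure.-integrable (torus R)
        (fun x => (complex.Re (f x) ^+ 2 + complex.Im (f x) ^+ 2)%:E)].

Definition fcoef (R : realType) (f : R -> R[i]) (l : int) : R[i] :=
  ((2 * pi)^-1)%:C *
  cintegral (torus R) (fun x => f x * cexp ((- (l%:~R * x)) *i)).

(* The H^s norm (\sum_l (1 + l^2)^s |f_l|^2)^(1/2); for s >= 0 it is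
   finite exactly when f belongs to H^s, and it is +oo when f is not in L^2. *)
Definition sobolev_norm (R : realType) (s : R) (f : R -> R[i]) : \bar R :=
  if `[< square_integrable f >] then
    ((\esum_(l in [set: int])
        ((1 + l%:~R ^+ 2) `^ s *
         (complex.Re (fcoef f l) ^+ 2 + complex.Im (fcoef f l) ^+ 2))%:E)
      `^ 2^-1)%E
  else +oo%E.

(* The function \sum_l c_l e^(ilx), as the pointwise limit of the sums over
   |l| <= N.  It is used only for absolutely summable c, such as the
   coefficients of an element of H^s, s > 1/2; the limit then exists at every
   x and is the continuous representative. *)
Definition fpartial (R : realType) (c : int -> R[i]) (x : R) (N : nat) : R[i] :=
  \sum_(0 <= k < (N.*2).+1)
     c (k%:Z - N%:Z) * cexp (((k%:Z - N%:Z)%:~R * x) *i).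

Definition fseries (R : realType) (c : int -> R[i]) (x : R) : R[i] :=
  limn (fun N : nat => complex.Re (fpartial c x N))
  +i* limn (fun N : nat => complex.Im (fpartial c x N)).

Definition multiplier (R : realType) (sigma : int -> R[i]) (f : R -> R[i]) :
    R -> R[i] :=
  fseries (fun l => sigma l * fcoef f l).

(* e^(i t d_x^2), with symbol e^(-i t l^2) *)
Definition schrodinger (R : realType) (t : R) : (R -> R[i]) -> R -> R[i] :=
  multiplier (fun l => cexp ((- (t * l%:~R ^+ 2)) *i)).

(* phi1(- 2 i tau d_x^2), with symbol phi1(2 i tau l^2) *)
Definition phi1_op (R : realType) (tau : R) : (R -> R[i]) -> R -> R[i] :=
  multiplier (fun l => phi1 ((2 * tau * l%:~R ^+ 2) *i)).

Definition conj_fun (R : realType) (u : R -> R[i]) : R -> R[i] :=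
  fun x => conjc (u x).

(* |z|^2 z, with |z|^2 = z * conj z *)
Definition cubic (R : realType) (z : R[i]) : R[i] := z * conjc z * z.

(* Mild solutions on [0, S] of i w_t = - w_xx + eps^2 |w|^2 w, w(., 0) = phi:
   w is in C([0, S]; H^1) and satisfies the Duhamel formula in H^1.  The
   H^1-valued time integral is evaluated at (almost) every x, evaluation at x
   being continuous on H^1. *)
Definition mild_nls (R : realType) (eps S : R) (phi : R -> R[i])
    (w : R -> R -> R[i]) : Prop :=
  [/\ forall t : R, 0 <= t <= S -> (sobolev_norm 1 (w t) < +oo)%E,
      forall t : R, 0 <= t <= S ->
        sobolev_norm 1 (fun x => w s x - w t x)
          @[s --> within `[0, S]%classic (nbhs t)] --> 0%E,
      forall x : R, torus R x -> w 0 x = phi x &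
      forall t : R, 0 <= t <= S ->
        {ae lebesgue_measure, forall x : R, torus R x ->
          w t x = schrodinger t phi x
            - 'i%C * (eps ^+ 2)%:C *
              cintegral `[0, t]%classic
                (fun s => schrodinger (t - s) (fun y => cubic (w s y)) x)}].

Definition Linfty_sobolev (R : realType) (S s : R) (w : R -> R -> R[i]) :
    \bar R :=
  ess_sup lebesgue_measure
    (fun t : R => if t \in `[0, S] then sobolev_norm s (w t) else 0%E).

Definition nlri_g (R : realType) (tau : R) (u : R -> R[i]) : R -> R[i] :=
  fun x => u x * (conj_fun u x - phi1_op tau (conj_fun u) x).

Definition nlri_h (R : realType) (tau : R) (u : R -> R[i]) : R -> R[i] :=
  fseries (fun l => (1 - phi1 ((2 * l%:~R ^+ 2 * tau) *i)) *
                    conjc (fcoef u l) * fcoef u l * fcoef u l).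

Definition nlri_step (R : realType) (eps tau : R) (u : R -> R[i]) :
    R -> R[i] :=
  fun x =>
    schrodinger tau
      (fun y => u y - 'i%C * (tau * eps ^+ 2)%:C *
                      (u y ^+ 2 * phi1_op tau (conj_fun u) y)) x
    - 2 * 'i%C * (eps ^+ 2 * tau)%:C * fcoef (nlri_g tau u) 0 *
      schrodinger tau u x
    + 'i%C * (eps ^+ 2 * tau)%:C * schrodinger tau (nlri_h tau u) x.

Definition nlri (R : realType) (eps tau : R) (phi : R -> R[i]) (n : nat) :
    R -> R[i] :=
  iter n (nlri_step eps tau) phi.

(* Main.v *)
Require Import Defs.
From HB Require Import structures.
From mathcomp Require Import all_boot all_order all_algebra.
From mathcomp Require Import complex.
From mathcomp Require Import all_classical all_reals all_analysis ess_sup_inf.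
From mathcomp Require Import measurable_realfun.
From mathcomp Require Import ring lra zify.
Import Order.TTheory GRing.Theory Num.Theory.
Import numFieldNormedType.Exports.

Set Implicit Arguments.
Unset Strict Implicit.
Unset Printing Implicit Defensive.

Local Open Scope classical_set_scope.
Local Open Scope ring_scope.
Local Open Scope complex_scope.

(** The proof works on Fourier coefficients with the free flow removed.  For
the twisted coefficients v_l(t) = e^(itl^2) w_l(t) the equation reads

  v_l' = - i eps^2 sum_(l1 - l2 + l3 = l) e^(it Omega) v_l1 conj(v_l2) v_l3,

  Omega = 2 (l1 - l2) (l3 - l2),

so v moves with speed O(eps^2) only.  Over one step the integrator has the
same structure: the integral of e^(is Omega) is kept exactly on the resonant
triples Omega = 0, which is the purpose of the corrections g and h
([tri_nr_ker]), and on the others Omega is replaced by its part 2 l2^2.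

Three errors are committed in a step.  Freezing v costs
O(eps^4 tau^2), since v is slow ([twisted_increment], [local_expansion]); over
the O(1 / (eps^2 tau)) steps this adds up to O(eps^2 tau).  Discarding the
frequencies above 1 / (8 tau0) costs eps^2 tau tau0^(m-1), by H^m regularity
([cutoff_tail]), which adds up to tau0^(m-1).  The replacement of Omega by
2 l2^2 is of size eps^2 tau^2 only, which would add up to O(tau).  Here the
phases help: for a fixed triple the errors of successive steps carry the
factors e^(in tau Omega), and for low frequencies the restriction on tau keeps
tau Omega away from the nonzero multiples of 2 pi, so that the geometric sums
of these factors are O(1 / tau) ([acc_ker_le]).  Abel summation ([abel_tri])
then trades the number of steps for one increment of v per step, each
O(eps^2 tau), and leaves O(eps^2 tau) ([oscillation_bound]).  Stability in H^1
and a discrete Gronwall argument conclude ([scheme_error]); the bound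
1 + M on the numerical solution is propagated in the same induction, as the
error stays at most 1 for small tau0.

All the estimates reduce to one: the cubic convolution with a bounded kernel is
bounded on H^1 ([tri_H1]).  A kernel that grows with the frequencies is absorbed
into the factors, at the price of the second derivative that m >= 2 provides
([tri_H1_weighted]).

To reach coefficients from the functions of the statement one needs that an
H^1 function is the sum of its Fourier series, which follows from uniqueness of
Fourier coefficients ([fourier_unique]).  Dominated convergence then gives the
coefficients of products ([product_coef_cvg]) and of the Duhamel integral
([duhamel_term]), and the coefficients of a numerical step
([nlri_step_spec]). *)

(** * Complex modulus and unimodular exponentials *)

Section Modulus.
Context {R : realType}.
Implicit Types (z w : R[i]) (x y t : R).

(** The modulus with values in R, as the norm of R[i] takes its values in R[i]. *)
Definition cmod z : R := Num.sqrt (complex.Re z ^+ 2 + complex.Im z ^+ 2).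

Lemma cmodE z : (cmod z)%:C = `|z|.
Proof. by rewrite normc_def. Qed.

Lemma cmod_ge0 z : 0 <= cmod z.
Proof. exact: sqrtr_ge0. Qed.

Lemma sqr_cmod z : cmod z ^+ 2 = complex.Re z ^+ 2 + complex.Im z ^+ 2.
Proof. by rewrite sqr_sqrtr// addr_ge0 ?sqr_ge0. Qed.

Lemma cmodM z w : cmod (z * w) = cmod z * cmod w.
Proof. by apply: complexI; rewrite rmorphM/= !cmodE normrM. Qed.

Lemma cmodD z w : cmod (z + w) <= cmod z + cmod w.
Proof. by rewrite -lecR rmorphD/= !cmodE ler_normD. Qed.

Lemma cmodN z : cmod (- z) = cmod z.
Proof. by apply: complexI; rewrite !cmodE normrN. Qed.

Lemma cmodB z w : cmod (z - w) <= cmod z + cmod w.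
Proof. by rewrite -(cmodN w) cmodD. Qed.

Lemma cmod_distC z w : cmod (z - w) = cmod (w - z).
Proof. by rewrite -cmodN opprB. Qed.

Lemma cmodJ z : cmod (conjc z) = cmod z.
Proof. by apply: complexI; rewrite !cmodE normcJ. Qed.

Lemma cmod0 : cmod 0 = 0.
Proof. by apply: complexI; rewrite !cmodE normr0. Qed.

Lemma cmod1 : cmod 1 = 1.
Proof. by apply: complexI; rewrite !cmodE normr1. Qed.

Lemma cmodi : cmod ('i%C : R[i]) = 1.
Proof. by rewrite /cmod/= expr0n/= add0r expr1n sqrtr1. Qed.

Lemma cmodR x : cmod x%:C = `|x|.
Proof. by rewrite /cmod/= expr0n/= addr0 sqrtr_sqr. Qed.

Lemma cmodV z : cmod z^-1 = (cmod z)^-1.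
Proof. by apply: complexI; rewrite fmorphV/= !cmodE normfV. Qed.

Lemma cmod_sum (I : Type) (s : seq I) (P : pred I) (F : I -> R[i]) :
  cmod (\sum_(i <- s | P i) F i) <= \sum_(i <- s | P i) cmod (F i).
Proof.
elim/big_rec2: _ => [|i y z _ h]; first by rewrite cmod0.
by rewrite (le_trans (cmodD _ _))// lerD2l.
Qed.

Lemma Re_le_cmod z : `|complex.Re z| <= cmod z.
Proof.
rewrite -(@ler_pXn2r _ 2)// ?nnegrE ?cmod_ge0// sqr_cmod.
by rewrite real_normK ?num_real// lerDl sqr_ge0.
Qed.

Lemma Im_le_cmod z : `|complex.Im z| <= cmod z.
Proof.
rewrite -(@ler_pXn2r _ 2)// ?nnegrE ?cmod_ge0// sqr_cmod.
by rewrite real_normK ?num_real// lerDr sqr_ge0.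
Qed.

Lemma cmod_le_ReIm z : cmod z <= `|complex.Re z| + `|complex.Im z|.
Proof.
rewrite -(@ler_pXn2r _ 2)// ?nnegrE ?cmod_ge0// ?addr_ge0// sqr_cmod.
rewrite sqrrD !real_normK ?num_real//.
have := mulr_ge0 (normr_ge0 (complex.Re z)) (normr_ge0 (complex.Im z)).
by nra.
Qed.

Lemma RecD z w : complex.Re (z + w) = complex.Re z + complex.Re w.
Proof. by case: z; case: w. Qed.
Lemma ImcD z w : complex.Im (z + w) = complex.Im z + complex.Im w.
Proof. by case: z; case: w. Qed.
Lemma RecN z : complex.Re (- z) = - complex.Re z.
Proof. by case: z. Qed.
Lemma ImcN z : complex.Im (- z) = - complex.Im z.
Proof. by case: z. Qed.
Lemma RecM z w : complex.Re (z * w) =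
  complex.Re z * complex.Re w - complex.Im z * complex.Im w.
Proof. by case: z; case: w. Qed.
Lemma ImcM z w : complex.Im (z * w) =
  complex.Re z * complex.Im w + complex.Im z * complex.Re w.
Proof. by case: z => a b; case: w => c d /=; rewrite [X in _ + X]mulrC. Qed.

Lemma Rec_sum (I : Type) (s : seq I) (P : pred I) (F : I -> R[i]) :
  complex.Re (\sum_(i <- s | P i) F i) = \sum_(i <- s | P i) complex.Re (F i).
Proof. by elim/big_rec2: _ => [//|i y z _ <-]; rewrite RecD. Qed.

Lemma Imc_sum (I : Type) (s : seq I) (P : pred I) (F : I -> R[i]) :
  complex.Im (\sum_(i <- s | P i) F i) = \sum_(i <- s | P i) complex.Im (F i).
Proof. by elim/big_rec2: _ => [//|i y z _ <-]; rewrite ImcD. Qed.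

Lemma complex_ext z w :
  complex.Re z = complex.Re w -> complex.Im z = complex.Im w -> z = w.
Proof. by case: z => a b; case: w => c d /= -> ->. Qed.

Definition cis t : R[i] := cexp (t *i).

Lemma cisE t : cis t = cos t +i* sin t.
Proof. by rewrite /cis /cexp/= expR0 mul1r. Qed.

Lemma cis0 : cis 0 = 1.
Proof. by rewrite cisE cos0 sin0. Qed.

Lemma cisD x y : cis (x + y) = cis x * cis y.
Proof.
rewrite !cisE cosD sinD; apply: complex_ext => //=.
by rewrite addrC.
Qed.

Lemma cisN x : cis (- x) = conjc (cis x).
Proof. by rewrite !cisE cosN sinN. Qed.

Lemma cmod_cis t : cmod (cis t) = 1.
Proof. by rewrite /cmod cisE/= cos2Dsin2 sqrtr1. Qed.

End Modulus.

(** * Symmetric sums over the integers *)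

Section Sums.
Context {R : realType}.

(** The frequencies of the partial sums of a Fourier series, in the order of
   summation. *)
Definition zrange (N : nat) : seq int :=
  [seq k%:Z - N%:Z | k <- index_iota 0 (N.*2).+1].

Lemma mem_zrange N (l : int) : (l \in zrange N) = (`|l| <= N)%N.
Proof.
apply/mapP/idP => [[k]|h].
  by rewrite mem_index_iota => /andP[_ hk] ->; lia.
exists (absz (l + N%:Z)); last by lia.
by rewrite mem_index_iota; lia.
Qed.

Lemma zrange_uniq N : uniq (zrange N).
Proof.
rewrite map_inj_in_uniq ?iota_uniq// => x y _ _.
by move=> /addIr [].
Qed.

Lemma sum_sub_seq (I : eqType) (s t : seq I) (F : I -> R) :
  uniq s -> {subset s <= t} -> (forall i, 0 <= F i) ->
  \sum_(i <- s) F i <= \sum_(i <- t) F i.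
Proof.
move=> us st F0.
have ut : \sum_(i <- undup t) F i <= \sum_(i <- t) F i.
  elim: t {st} => [|a t IH]; first by rewrite big_nil.
  rewrite /=; case: ifP => _; rewrite big_cons.
    by rewrite (le_trans IH)// lerDr.
  by rewrite big_cons lerD2l.
apply: (le_trans _ ut).
have st' : {subset s <= undup t} by move=> i /st; rewrite mem_undup.
have pst : perm_eq [seq i <- undup t | i \in s] s.
  apply: uniq_perm; rewrite ?filter_uniq ?undup_uniq// => i.
  by rewrite mem_filter; case: (boolP (i \in s)) => //= /st' ->.
rewrite [leRHS](bigID [pred i | i \in s])/= -[X in _ <= X + _]big_filter (perm_big _ pst)/=.
by rewrite lerDl sumr_ge0.
Qed.

Lemma zrange_sub_exists (s : seq int) : exists N, {subset s <= zrange N}.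
Proof.
exists (\max_(l <- s) `|l|%N) => l ls; rewrite mem_zrange.
elim: s ls => [//|a s IH]; rewrite inE big_cons => /orP[/eqP ->|/IH h].
  exact: leq_maxl.
by rewrite (leq_trans h)// leq_maxr.
Qed.

(** Every finite family sits in a symmetric window; translated windows are
   handled through this bound. *)
Lemma sum_uniq_le (s : seq int) (F : int -> R) (B : R) :
  uniq s -> (forall l, 0 <= F l) ->
  (forall N, \sum_(l <- zrange N) F l <= B) -> \sum_(l <- s) F l <= B.
Proof.
move=> us F0 h; have [N sN] := zrange_sub_exists s.
exact: le_trans (sum_sub_seq us sN F0) (h N).
Qed.

Lemma sum_zrangeS (V : nmodType) N (F : int -> V) :
  \sum_(l <- zrange N.+1) F l =
  F (- (N.+1)%:Z) + \sum_(l <- zrange N) F l + F (N.+1)%:Z.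
Proof.
rewrite /zrange !big_map doubleS big_nat_recr//= big_nat_recl//=.
rewrite sub0r; congr (F _ + _ + F _); last by lia.
by apply: eq_bigr => i _; congr F; lia.
Qed.

Lemma sum_if_le (s : seq int) (P : pred int) (F : int -> R) (x0 : int) :
  uniq s -> (forall x, P x -> x = x0) -> (forall l, 0 <= F l) ->
  \sum_(x <- s) (if P x then F x else 0) <= F x0.
Proof.
move=> us h F0; apply: (@le_trans _ _ (\sum_(x <- s) (if x == x0 then F x else 0))).
  apply: ler_sum => x _; case: ifP => [/h ->|_]; first by rewrite eqxx.
  by case: ifP.
case: (boolP (x0 \in s)) => xs.
  by rewrite (bigD1_seq x0)//= eqxx big1 ?addr0// => i /negbTE ->.
rewrite big1_seq// => i /andP[_ si]; case: eqP => // e.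
by rewrite -e si in xs.
Qed.

Lemma le_of_sqr (x y : R) : 0 <= y -> x ^+ 2 <= y ^+ 2 -> x <= y.
Proof.
move=> y0 h; have [x0|x0] := leP x 0; first exact: le_trans y0.
by rewrite -(@ler_pXn2r _ 2)// nnegrE// ltW.
Qed.

Lemma cauchy_schwarz (I : Type) (s : seq I) (x y : I -> R) :
  (\sum_(i <- s) x i * y i) ^+ 2 <=
  (\sum_(i <- s) x i ^+ 2) * (\sum_(i <- s) y i ^+ 2).
Proof.
elim: s => [|a s IH]; first by rewrite !big_nil expr0n/= mul0r.
rewrite !big_cons.
have X0 : 0 <= \sum_(i <- s) x i ^+ 2 by apply: sumr_ge0 => i _; rewrite sqr_ge0.
have Y0 : 0 <= \sum_(i <- s) y i ^+ 2 by apply: sumr_ge0 => i _; rewrite sqr_ge0.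
move: IH X0 Y0.
move: (\sum_(i <- s) x i * y i) (\sum_(i <- s) x i ^+ 2) (\sum_(i <- s) y i ^+ 2).
move=> P X Y IH X0 Y0.
have : 2 * (x a * y a * P) <= x a ^+ 2 * Y + y a ^+ 2 * X.
  apply: le_of_sqr; first by rewrite addr_ge0// mulr_ge0// sqr_ge0.
  have h1 : 0 <= (x a ^+ 2 * Y - y a ^+ 2 * X) ^+ 2 by rewrite sqr_ge0.
  have h2 : 0 <= (x a * y a) ^+ 2 * (X * Y - P ^+ 2).
    by rewrite mulr_ge0 ?sqr_ge0// subr_ge0.
  nra.
nra.
Qed.

(** The Cauchy-Schwarz inequality for the measure with masses p. *)
Lemma jensen_sqr (I : Type) (s : seq I) (p g : I -> R) :
  (forall i, 0 <= p i) ->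
  (\sum_(i <- s) p i * g i) ^+ 2 <=
  (\sum_(i <- s) p i) * (\sum_(i <- s) p i * g i ^+ 2).
Proof.
move=> p0; have := cauchy_schwarz s (fun i => Num.sqrt (p i))
  (fun i => Num.sqrt (p i) * g i).
under eq_bigr do rewrite mulrA -expr2 sqr_sqrtr//.
move/le_trans; apply.
rewrite le_eqVlt; apply/orP; left; apply/eqP; congr (_ * _).
  by apply: eq_bigr => i _; rewrite sqr_sqrtr.
by apply: eq_bigr => i _; rewrite exprMn sqr_sqrtr.
Qed.

(** Norms enter only through upper bounds, as bounds on all finite sums: such
   bounds need no convergence and survive coefficientwise limits. *)
Definition l2_le (a : int -> R) (B : R) : Prop :=
  0 <= B /\ forall N, \sum_(l <- zrange N) a l ^+ 2 <= B ^+ 2.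

Definition l1_le (a : int -> R) (B : R) : Prop :=
  0 <= B /\ forall N, \sum_(l <- zrange N) a l <= B.

Lemma l2_leD a b A B : l2_le a A -> l2_le b B -> l2_le (fun l => a l + b l) (A + B).
Proof.
move=> [A0 hA] [B0 hB]; split; first exact: addr_ge0.
move=> N.
have h : \sum_(l <- zrange N) a l * b l <= A * B.
  apply: le_of_sqr; first exact: mulr_ge0.
  apply: (le_trans (cauchy_schwarz _ _ _)); rewrite exprMn.
  by rewrite ler_pM// sumr_ge0// => i _; rewrite sqr_ge0.
under eq_bigr do rewrite sqrrD.
rewrite big_split/= big_split/= sumrMnl sqrrD.
have := hA N; have := hB N; lra.
Qed.

Lemma l2_le_mono a b A B : (forall l, 0 <= a l <= b l) -> A <= B ->
  l2_le b A -> l2_le a B.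
Proof.
move=> ab AB [A0 hA]; split; first exact: le_trans AB.
move=> N; apply: (@le_trans _ _ (A ^+ 2)); last first.
  by rewrite ler_pXn2r// nnegrE// (le_trans A0).
apply: le_trans (hA N); apply: ler_sum => l _.
have /andP[a0 h] := ab l.
by rewrite ler_pXn2r// nnegrE// (le_trans a0).
Qed.

Lemma l2_leZ a A c : 0 <= c -> l2_le a A -> l2_le (fun l => c * a l) (c * A).
Proof.
move=> c0 [A0 hA]; split; first exact: mulr_ge0.
move=> N; under eq_bigr do rewrite exprMn.
by rewrite -mulr_sumr exprMn ler_wpM2l// sqr_ge0.
Qed.

Lemma l2_le_pt a A l : l2_le a A -> `|a l| <= A.
Proof.
move=> [A0 hA]; apply: le_of_sqr => //; rewrite real_normK ?num_real//.
apply: le_trans (hA `|l|%N).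
rewrite -[leLHS](big_seq1 +%R l (fun i => a i ^+ 2)).
apply: sum_sub_seq => // [i|i]; last exact: sqr_ge0.
by rewrite inE mem_zrange => /eqP ->.
Qed.

(** Young's inequality: an average of translates has at most the total mass of
   the weights times the l2 norm. *)
Lemma young (I : Type) (s : seq I) (p : I -> R) (g : I -> int -> int) c A G :
  (forall i, 0 <= p i) -> (forall i, injective (g i)) ->
  \sum_(i <- s) p i <= A -> l2_le c G ->
  l2_le (fun l => \sum_(i <- s) p i * c (g i l)) (A * G).
Proof.
move=> p0 gi hA [G0 hG].
have A0 : 0 <= A by apply: le_trans hA; apply: sumr_ge0.
split; first exact: mulr_ge0.
move=> N; apply: (@le_trans _ _
    (\sum_(l <- zrange N) A * (\sum_(i <- s) p i * c (g i l) ^+ 2))).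
  apply: ler_sum => l _; apply: (le_trans (jensen_sqr _ _ p0)).
  rewrite ler_wpM2r// sumr_ge0// => i _.
  by rewrite mulr_ge0// sqr_ge0.
rewrite -mulr_sumr exchange_big/= exprMn expr2 -mulrA ler_wpM2l//.
apply: (@le_trans _ _ (\sum_(i <- s) p i * G ^+ 2)); last first.
  by rewrite -mulr_suml ler_wpM2r// sqr_ge0.
apply: ler_sum => i _; rewrite -mulr_sumr ler_wpM2l//.
rewrite -(big_map (g i) xpredT (fun l => c l ^+ 2)).
apply: sum_uniq_le => // [|l]; last exact: sqr_ge0.
by rewrite map_inj_uniq// zrange_uniq.
Qed.

End Sums.

(** * Weighted sequence norms and the trilinear convolution *)

Section Norms.
Context {R : realType}.
Implicit Types (c d u v w : int -> R[i]).

(** The Japanese bracket: its powers are the weights of [sobolev_norm]. *)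
Definition jap (l : int) : R := Num.sqrt (1 + l%:~R ^+ 2).

Lemma sqr_jap l : jap l ^+ 2 = 1 + l%:~R ^+ 2.
Proof. by rewrite sqr_sqrtr// addr_ge0 ?sqr_ge0. Qed.

Lemma jap_ge1 l : 1 <= jap l.
Proof. by rewrite -sqrtr1 ler_wsqrtr// lerDl sqr_ge0. Qed.

Lemma jap_gt0 l : 0 < jap l.
Proof. exact: lt_le_trans (jap_ge1 l). Qed.

Lemma jap_ge0 l : 0 <= jap l.
Proof. exact: ltW (jap_gt0 l). Qed.

Lemma norm_le_jap l : `|l%:~R| <= jap l.
Proof.
by rewrite -sqrtr_sqr ler_wsqrtr// lerDr.
Qed.

Lemma jap_add (l1 l2 : int) : jap (l1 + l2) <= jap l1 + jap l2.
Proof.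
apply: le_of_sqr; first by rewrite addr_ge0 ?jap_ge0.
rewrite sqrrD !sqr_jap rmorphD/= sqrrD.
have h1 := norm_le_jap l1; have h2 := norm_le_jap l2.
have : (l1%:~R : R) * l2%:~R <= jap l1 * jap l2.
  by rewrite (le_trans (ler_norm _))// normrM ler_pM.
lra.
Qed.

Lemma japN l : jap (- l) = jap l.
Proof. by rewrite /jap rmorphN/= sqrrN. Qed.

Lemma jap_conv (l1 l2 l3 : int) : jap (l1 - l2 + l3) <= jap l1 + jap l2 + jap l3.
Proof. by rewrite (le_trans (jap_add _ _))// lerD2r -(japN l2) jap_add. Qed.

(** The Sobolev norm of integer order p is at most B. *)
Definition sob_le (p : nat) c (B : R) : Prop :=
  l2_le (fun l => jap l ^+ p * cmod (c l)) B.

Lemma sob_le_ge0 p c B : sob_le p c B -> 0 <= B.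
Proof. by case. Qed.

Lemma japX_ge0 p l : 0 <= jap l ^+ p.
Proof. by rewrite exprn_ge0// jap_ge0. Qed.

Lemma sob_le_mod p c d B : (forall l, cmod (c l) <= cmod (d l)) ->
  sob_le p d B -> sob_le p c B.
Proof.
move=> h; apply: l2_le_mono => // l.
by rewrite mulr_ge0 ?cmod_ge0 ?japX_ge0//= ler_wpM2l ?japX_ge0.
Qed.

Lemma sob_le_ext p c d B : (forall l, c l = d l) -> sob_le p d B -> sob_le p c B.
Proof. by move=> h; apply: sob_le_mod => l; rewrite h. Qed.

Lemma sob_le_le p c A B : A <= B -> sob_le p c A -> sob_le p c B.
Proof.
move=> AB; apply: l2_le_mono => // l.
by rewrite lexx mulr_ge0 ?cmod_ge0 ?japX_ge0.
Qed.

Lemma sob_leD p c d A B : sob_le p c A -> sob_le p d B ->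
  sob_le p (fun l => c l + d l) (A + B).
Proof.
move=> hA hB; have := l2_leD hA hB; apply: l2_le_mono => // l.
by rewrite mulr_ge0 ?cmod_ge0 ?japX_ge0//= -mulrDr ler_wpM2l ?japX_ge0 ?cmodD.
Qed.

Lemma sob_leN p c A : sob_le p c A -> sob_le p (fun l => - c l) A.
Proof. by apply: sob_le_mod => l; rewrite cmodN. Qed.

Lemma sob_leB p c d A B : sob_le p c A -> sob_le p d B ->
  sob_le p (fun l => c l - d l) (A + B).
Proof. by move=> hA /sob_leN; exact: sob_leD. Qed.

Lemma sob_leZ p c A (z : R[i]) : sob_le p c A -> sob_le p (fun l => z * c l) (cmod z * A).
Proof.
move=> hA; have := l2_leZ (cmod_ge0 z) hA; apply: l2_le_mono => // l.
by rewrite mulr_ge0 ?cmod_ge0 ?japX_ge0//= cmodM mulrCA.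
Qed.

Lemma sob_le0 p : sob_le p (fun=> 0) 0.
Proof.
by split => // N; rewrite big1// => l _; rewrite cmod0 mulr0 expr0n.
Qed.

Lemma sob_le_sum p (n : nat) (F : nat -> int -> R[i]) (B : nat -> R) :
  (forall k, (k < n)%N -> sob_le p (F k) (B k)) ->
  sob_le p (fun l => \sum_(k < n) F k l) (\sum_(k < n) B k).
Proof.
elim: n => [_|n IH h].
  rewrite big_ord0; apply: sob_le_ext (sob_le0 p) => l.
  by rewrite big_ord0.
have hn : forall k, (k < n)%N -> sob_le p (F k) (B k).
  by move=> k kn; apply: h; rewrite ltnS ltnW.
rewrite big_ord_recr/=; apply: sob_le_ext (sob_leD (IH hn) (h n (ltnSn n))) => l.
by rewrite big_ord_recr.
Qed.

Lemma sob_le_pt p c B l : sob_le p c B -> cmod (c l) <= B.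
Proof.
move=> /(@l2_le_pt _ _ _ l); apply: le_trans.
rewrite ger0_norm ?mulr_ge0 ?cmod_ge0 ?japX_ge0//.
by rewrite ler_peMl ?cmod_ge0// exprn_ege1// jap_ge1.
Qed.

Lemma sob_le21 c B : sob_le 2 c B -> sob_le 1 c B.
Proof.
apply: l2_le_mono => // l.
rewrite mulr_ge0 ?cmod_ge0 ?japX_ge0//= ler_wpM2r ?cmod_ge0// expr1 expr2.
by rewrite ler_peMl ?jap_ge0 ?jap_ge1.
Qed.

(** Summability of 1/(1+l^2), by comparison with the telescoping 4/(k(k+1)). *)
Lemma sum_jap_inv N : \sum_(l <- zrange N) (jap l ^- 1) ^+ 2 <= 5 :> R.
Proof.
(* The bound that passes through the induction. *)
suff : \sum_(l <- zrange N) (jap l ^- 1) ^+ 2 <= 5 - 4 / N.+1%:R :> R.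
  by move/le_trans; apply; rewrite gerBl divr_ge0.
elim: N => [|N IH].
  rewrite /zrange/= big_seq1 subrr exprVn sqr_jap expr0n/= addr0 invr1; lra.
rewrite sum_zrangeS !exprVn !sqr_jap rmorphN/= sqrrN.
set x : R := N.+1%:R in IH *.
have x0 : 0 < x by rewrite ltr0n.
have -> : (N.+2%:R : R) = x + 1 by rewrite /x -natr1.
have -> : ((N.+1)%:~R : R) = x by [].
have h : (1 + x ^+ 2)^-1 <= 2 / (x * (x + 1)).
  rewrite -[leLHS]mul1r ler_pdivrMr ?addr_gt0 ?exprn_gt0//.
  rewrite mulrAC ler_pdivlMr ?mulr_gt0 ?addr_gt0//.
  by nra.
have e : 4 / x - 4 / (x + 1) = 2 * (2 / (x * (x + 1))).
  by field; apply/andP; split; apply: lt0r_neq0; lra.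
move: IH h e; move: (\sum_(j <- zrange N) _) (1 + x ^+ 2)^-1 (2 / (x * (x + 1))).
move: (4 / x) (4 / (x + 1)).
by move=> a b S i y; lra.
Qed.

(** The embedding of H^1 into the summable sequences; 3 bounds the square root
   of the sum of 1 / (1 + l^2). *)
Lemma sob_le_l1 c B : sob_le 1 c B -> l1_le (fun l => cmod (c l)) (3 * B).
Proof.
move=> [B0 h]; split; first by rewrite mulr_ge0.
move=> N; apply: le_of_sqr; first by rewrite mulr_ge0.
apply: (@le_trans _ _ (5 * B ^+ 2)); last first.
  by rewrite exprMn; have := sqr_ge0 B; nra.
under eq_bigr => l _.
  rewrite -[cmod _]mul1r -(mulVf (lt0r_neq0 (jap_gt0 l))) -mulrA -[X in _ * (X * _)]expr1.
  over.
apply: (le_trans (cauchy_schwarz _ _ _)).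
rewrite ler_pM ?h ?sum_jap_inv// sumr_ge0// => l _; exact: sqr_ge0.
Qed.

End Norms.

Section Trilinear.
Context {R : realType}.
Implicit Types (u v w : int -> R[i]) (k : int -> int -> int -> R[i]).

(** The cubic convolution with kernel k, truncated to frequencies at most N.
   The full convolution is met only as its limit in N. *)
Definition tri k u v w (N : nat) (l : int) : R[i] :=
  \sum_(l1 <- zrange N) \sum_(l2 <- zrange N) \sum_(l3 <- zrange N)
    (if l1 - l2 + l3 == l then k l1 l2 l3 * (u l1 * conjc (v l2) * w l3) else 0).

Definition rtri (a b c : int -> R) (N : nat) (l : int) : R :=
  \sum_(l1 <- zrange N) \sum_(l2 <- zrange N) \sum_(l3 <- zrange N)
    (if l1 - l2 + l3 == l then a l1 * b l2 * c l3 else 0).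

Lemma young2 (a b c : int -> R) (g : int -> int -> int -> int) A B G N :
  (forall l, 0 <= a l) -> (forall l, 0 <= b l) ->
  (forall i j, injective (g i j)) ->
  l1_le a A -> l1_le b B -> l2_le c G ->
  l2_le (fun l => \sum_(i <- zrange N) \sum_(j <- zrange N) a i * b j * c (g i j l))
       (A * B * G).
Proof.
move=> a0 b0 gi [A0 hA] [B0 hB] hG.
have := @young R _ [seq (i, j) | i <- zrange N, j <- zrange N]
  (fun p => a p.1 * b p.2) (fun p => g p.1 p.2) c (A * B) G.
have -> : (fun l => \sum_(i <- [seq (i, j) | i <- zrange N, j <- zrange N])
    a i.1 * b i.2 * c (g i.1 i.2 l)) =
  (fun l => \sum_(i <- zrange N) \sum_(j <- zrange N) a i * b j * c (g i j l)).
  by apply: funext => l; rewrite big_allpairs.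
apply => //.
- by move=> i; rewrite mulr_ge0.
- by rewrite big_allpairs/= -big_distrlr/= ler_pM// sumr_ge0.
Qed.

Section rtri_bounds.
Variables (a b c : int -> R).
Hypotheses (a0 : forall l, 0 <= a l) (b0 : forall l, 0 <= b l)
  (c0 : forall l, 0 <= c l).

Lemma rtri_ge0 N l : 0 <= rtri a b c N l.
Proof.
rewrite /rtri; apply: sumr_ge0 => ? _; apply: sumr_ge0 => ? _.
apply: sumr_ge0 => ? _; case: ifP => // _.
by rewrite !mulr_ge0.
Qed.

Lemma rtri3 A B G N : l1_le a A -> l1_le b B -> l2_le c G ->
  l2_le (rtri a b c N) (A * B * G).
Proof.
move=> hA hB hG.
have := @young2 a b c (fun i j l => l - i + j) _ _ _ N a0 b0 _ hA hB hG.
move=> /(_ _)/(l2_le_mono _ (lexx _)); apply; last by move=> i j x y; lia.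
move=> l; rewrite rtri_ge0/=; apply: ler_sum => i _; apply: ler_sum => j _.
apply: (@sum_if_le _ _ (fun x => i - j + x == l) (fun x => a i * b j * c x)).
- exact: zrange_uniq.
- by move=> x; lia.
- by move=> x; rewrite !mulr_ge0.
Qed.

Lemma rtri1 A B G N : l2_le a G -> l1_le b A -> l1_le c B ->
  l2_le (rtri a b c N) (A * B * G).
Proof.
move=> hG hA hB.
have := @young2 b c a (fun i j l => l + i - j) _ _ _ N b0 c0 _ hA hB hG.
move=> /(_ _)/(l2_le_mono _ (lexx _)); apply; last by move=> i j x y; lia.
move=> l; rewrite rtri_ge0/= /rtri exchange_big/=.
apply: ler_sum => i _; rewrite exchange_big/=; apply: ler_sum => j _.
rewrite [leRHS]mulrC mulrA.
apply: (@sum_if_le _ _ (fun x => x - i + j == l) (fun x => a x * b i * c j)).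
- exact: zrange_uniq.
- by move=> x; lia.
- by move=> x; rewrite !mulr_ge0.
Qed.

Lemma rtri2 A B G N : l1_le a A -> l2_le b G -> l1_le c B ->
  l2_le (rtri a b c N) (A * B * G).
Proof.
move=> hA hG hB.
have := @young2 a c b (fun i j l => i + j - l) _ _ _ N a0 c0 _ hA hB hG.
move=> /(_ _)/(l2_le_mono _ (lexx _)); apply; last by move=> i j x y; lia.
move=> l; rewrite rtri_ge0/= /rtri.
apply: ler_sum => i _; rewrite exchange_big/=; apply: ler_sum => j _.
rewrite [leRHS]mulrAC.
apply: (@sum_if_le _ _ (fun x => i - x + j == l) (fun x => a i * b x * c j)).
- exact: zrange_uniq.
- by move=> x; lia.
- by move=> x; rewrite !mulr_ge0.
Qed.

End rtri_bounds.

(** H^1 is an algebra: the weight of the output is at most the sum of those of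
   the three inputs, and the two unweighted factors are summable.  Hence the
   constant 27: three choices of the weighted factor, and the embedding
   constant 3 for each of the two others. *)
Lemma tri_H1 k u v w N K A B C :
  (forall l1 l2 l3, cmod (k l1 l2 l3) <= K) ->
  sob_le 1 u A -> sob_le 1 v B -> sob_le 1 w C ->
  sob_le 1 (tri k u v w N) (27 * K * A * B * C).
Proof.
move=> hk hu hv hw.
have K0 : 0 <= K by apply: le_trans (hk 0 0 0); exact: cmod_ge0.
have lu := sob_le_l1 hu; have lv := sob_le_l1 hv; have lw := sob_le_l1 hw.
pose m (u : int -> R[i]) l := cmod (u l).
pose j (u : int -> R[i]) l := jap l ^+ 1 * cmod (u l).
have m0 z l : 0 <= m z l by exact: cmod_ge0.
have j0 z l : 0 <= j z l by rewrite mulr_ge0 ?cmod_ge0 ?japX_ge0.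
have H1 := @rtri1 (j u) (m v) (m w) (j0 u) (m0 v) (m0 w) _ _ _ N hu lv lw.
have H2 := @rtri2 (m u) (j v) (m w) (m0 u) (j0 v) (m0 w) _ _ _ N lu hv lw.
have H3 := @rtri3 (m u) (m v) (j w) (m0 u) (m0 v) (j0 w) _ _ _ N lu lv hw.
have := l2_leZ K0 (l2_leD (l2_leD H1 H2) H3).
apply: l2_le_mono; last by rewrite le_eqVlt; apply/orP; left; apply/eqP; ring.
move=> l; rewrite mulr_ge0 ?cmod_ge0 ?japX_ge0//= expr1.
rewrite /tri /rtri -!big_split/= mulr_sumr.
apply: (@le_trans _ _ (jap l * \sum_(l1 <- zrange N) \sum_(l2 <- zrange N) \sum_(l3 <- zrange N)
  (if l1 - l2 + l3 == l then K * (m u l1 * m v l2 * m w l3) else 0))).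
  rewrite ler_wpM2l ?jap_ge0//.
  apply: (le_trans (cmod_sum _ _ _)); apply: ler_sum => l1 _.
  apply: (le_trans (cmod_sum _ _ _)); apply: ler_sum => l2 _.
  apply: (le_trans (cmod_sum _ _ _)); apply: ler_sum => l3 _.
  case: ifP => _; last by rewrite cmod0.
  by rewrite !cmodM cmodJ ler_wpM2r// ?mulr_ge0 ?cmod_ge0.
rewrite mulr_sumr; apply: ler_sum => l1 _.
rewrite -!big_split/= !mulr_sumr; apply: ler_sum => l2 _.
rewrite -!big_split/= !mulr_sumr; apply: ler_sum => l3 _.
case: eqP => [e|_]; last by rewrite !addr0 !mulr0.
rewrite mulrCA ler_wpM2l//.
apply: (@le_trans _ _ ((jap l1 + jap l2 + jap l3) * (m u l1 * m v l2 * m w l3))).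
  by rewrite ler_wpM2r ?mulr_ge0// -e jap_conv.
rewrite /j /m !expr1 le_eqVlt; apply/orP; left; apply/eqP; ring.
Qed.

Lemma sob_leSE p u B : sob_le p.+1 u B <-> sob_le p (fun l => (jap l)%:C * u l) B.
Proof.
rewrite /sob_le; have -> : (fun l => jap l ^+ p * cmod ((jap l)%:C * u l)) =
  (fun l => jap l ^+ p.+1 * cmod (u l)); last by [].
apply: funext => l.
by rewrite cmodM cmodR ger0_norm ?jap_ge0// mulrA exprSr.
Qed.

Lemma sum_jap_le (l1 l2 l3 : int) :
  jap l1 + jap l2 + jap l3 <= 3 * (jap l1 * jap l2 * jap l3) :> R.
Proof.
have := @jap_ge1 R l1; have := @jap_ge1 R l2; have := @jap_ge1 R l3.
move: (jap l1) (jap l2) (jap l3) => x y z hz hy hx.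
have xy : 1 <= x * y by rewrite mulr_ege1.
have yz : 1 <= y * z by rewrite mulr_ege1.
have xz : 1 <= x * z by rewrite mulr_ege1.
have : x <= x * y * z by rewrite -mulrA ler_peMr//; lra.
have : y <= x * y * z by rewrite mulrAC ler_peMl//; lra.
have : z <= x * y * z by rewrite ler_peMl//; lra.
lra.
Qed.

Lemma eq_tri k k' u v w u' v' w' N l :
  (forall l1 l2 l3, (`|l1| <= N)%N -> (`|l2| <= N)%N -> (`|l3| <= N)%N ->
    l1 - l2 + l3 = l ->
    k l1 l2 l3 * (u l1 * conjc (v l2) * w l3) =
    k' l1 l2 l3 * (u' l1 * conjc (v' l2) * w' l3)) ->
  tri k u v w N l = tri k' u' v' w' N l.
Proof.
move=> h; rewrite /tri; apply: eq_big_seq => l1; rewrite mem_zrange => h1.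
apply: eq_big_seq => l2; rewrite mem_zrange => h2.
apply: eq_big_seq => l3; rewrite mem_zrange => h3.
by case: eqP => // e; exact: h.
Qed.

Lemma conj_jap (l : int) (z : R[i]) :
  conjc ((jap l)%:C * z) = (jap l)%:C * conjc z.
Proof. by rewrite rmorphM/= oppr0. Qed.

(** The weights are absorbed into the factors, so that a kernel of the size of
   their product costs one derivative on each factor. *)
Lemma tri_H1_weighted k u v w N K A B C :
  (forall l1 l2 l3, (`|l1| <= N)%N -> (`|l2| <= N)%N -> (`|l3| <= N)%N ->
     cmod (k l1 l2 l3) <= K * (jap l1 * jap l2 * jap l3)) ->
  sob_le 2 u A -> sob_le 2 v B -> sob_le 2 w C ->
  sob_le 1 (tri k u v w N) (27 * K * A * B * C).
Proof.
move=> hk /sob_leSE hu /sob_leSE hv /sob_leSE hw.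
pose D (l1 l2 l3 : int) : R[i] := (jap l1)%:C * (jap l2)%:C * (jap l3)%:C.
pose k' l1 l2 l3 := if [&& (`|l1| <= N)%N, (`|l2| <= N)%N & (`|l3| <= N)%N]
  then k l1 l2 l3 / D l1 l2 l3 else 0.
have D0 l1 l2 l3 : D l1 l2 l3 != 0.
  rewrite /D -!rmorphM/= -(rmorph0 (real_complex R)) (inj_eq (@complexI _)).
  by rewrite !mulf_neq0// lt0r_neq0 ?jap_gt0.
have DE l1 l2 l3 : cmod (D l1 l2 l3) = jap l1 * jap l2 * jap l3.
  by rewrite !cmodM !cmodR !ger0_norm ?jap_ge0.
have K0 : 0 <= K.
  have := le_trans (cmod_ge0 _) (hk 0 0 0 isT isT isT).
  by rewrite pmulr_lge0// !mulr_gt0 ?jap_gt0.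
have := @tri_H1 k' _ _ _ N K _ _ _ _ hu hv hw.
move=> /(_ _)/(sob_le_ext _); apply.
  move=> l; apply: eq_tri => l1 l2 l3 h1 h2 h3 _; rewrite /k' h1 h2 h3/=.
  rewrite conj_jap.
  rewrite -[LHS]mul1r -(divff (D0 l1 l2 l3)) /D; ring.
move=> l1 l2 l3; rewrite /k'; case: ifP => [/and3P[h1 h2 h3]|_]; last by rewrite cmod0.
by rewrite cmodM cmodV ler_pdivrMr DE ?hk// !mulr_gt0 ?jap_gt0.
Qed.

(** The additional weight of the output is a kernel of the size of the product
   of the weights. *)
Lemma tri_H2 k u v w N K A B C :
  (forall l1 l2 l3, cmod (k l1 l2 l3) <= K) ->
  sob_le 2 u A -> sob_le 2 v B -> sob_le 2 w C ->
  sob_le 2 (tri k u v w N) (81 * K * A * B * C).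
Proof.
move=> hk hu hv hw; apply/sob_leSE.
have := @tri_H1_weighted (fun l1 l2 l3 => (jap (l1 - l2 + l3))%:C * k l1 l2 l3)
  u v w N (3 * K) A B C _ hu hv hw.
have -> : 27 * (3 * K) * A * B * C = 81 * K * A * B * C by ring.
move=> /(_ _)/(sob_le_ext _); apply.
  move=> l; rewrite /tri !mulr_sumr; apply: eq_bigr => l1 _.
  rewrite !mulr_sumr; apply: eq_bigr => l2 _.
  rewrite !mulr_sumr; apply: eq_bigr => l3 _.
  by case: eqP => [->|_]; rewrite ?mulr0// mulrA.
move=> l1 l2 l3 _ _ _; rewrite cmodM cmodR ger0_norm ?jap_ge0//.
rewrite mulrAC ler_pM ?jap_ge0 ?cmod_ge0//.
by rewrite (le_trans (jap_conv _ _ _)) ?sum_jap_le.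
Qed.

(** Trilinearity, as a Lipschitz estimate. *)
Lemma tri_lip k u u' N K A D :
  (forall l1 l2 l3, cmod (k l1 l2 l3) <= K) ->
  sob_le 1 u A -> sob_le 1 u' A -> sob_le 1 (fun l => u l - u' l) D ->
  sob_le 1 (fun l => tri k u u u N l - tri k u' u' u' N l) (81 * K * A ^+ 2 * D).
Proof.
move=> hk hu hu' hd; pose d l := u l - u' l.
have h1 := @tri_H1 k d u u N K _ _ _ hk hd hu hu.
have h2 := @tri_H1 k u' d u N K _ _ _ hk hu' hd hu.
have h3 := @tri_H1 k u' u' d N K _ _ _ hk hu' hu' hd.
have := sob_leD (sob_leD h1 h2) h3.
have -> : 27 * K * D * A * A + 27 * K * A * D * A + 27 * K * A * A * D =
  81 * K * A ^+ 2 * D by ring.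
apply: sob_le_ext => l; rewrite /tri -!sumrB -!big_split/=; apply: eq_bigr => l1 _.
rewrite -!sumrB -!big_split/=; apply: eq_bigr => l2 _.
rewrite -!sumrB -!big_split/=; apply: eq_bigr => l3 _.
case: eqP => [_|_]; last by rewrite subr0 !addr0.
rewrite /d [conjc (u l2 - u' l2)]rmorphB/=; ring.
Qed.

Lemma tri_lip_weighted k u u' N K A D :
  (forall l1 l2 l3, (`|l1| <= N)%N -> (`|l2| <= N)%N -> (`|l3| <= N)%N ->
     cmod (k l1 l2 l3) <= K * (jap l1 * jap l2 * jap l3)) ->
  sob_le 2 u A -> sob_le 2 u' A -> sob_le 2 (fun l => u l - u' l) D ->
  sob_le 1 (fun l => tri k u u u N l - tri k u' u' u' N l) (81 * K * A ^+ 2 * D).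
Proof.
move=> hk hu hu' hd; pose d l := u l - u' l.
have h1 := @tri_H1_weighted k d u u N K _ _ _ hk hd hu hu.
have h2 := @tri_H1_weighted k u' d u N K _ _ _ hk hu' hd hu.
have h3 := @tri_H1_weighted k u' u' d N K _ _ _ hk hu' hu' hd.
have := sob_leD (sob_leD h1 h2) h3.
have -> : 27 * K * D * A * A + 27 * K * A * D * A + 27 * K * A * A * D =
  81 * K * A ^+ 2 * D by ring.
apply: sob_le_ext => l; rewrite /tri -!sumrB -!big_split/=; apply: eq_bigr => l1 _.
rewrite -!sumrB -!big_split/=; apply: eq_bigr => l2 _.
rewrite -!sumrB -!big_split/=; apply: eq_bigr => l3 _.
case: eqP => [_|_]; last by rewrite subr0 !addr0.
rewrite /d [conjc (u l2 - u' l2)]rmorphB/=; ring.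
Qed.

Lemma triZ k u v w N l (z : R[i]) :
  tri (fun l1 l2 l3 => z * k l1 l2 l3) u v w N l = z * tri k u v w N l.
Proof.
rewrite /tri mulr_sumr; apply: eq_bigr => l1 _.
rewrite mulr_sumr; apply: eq_bigr => l2 _.
rewrite mulr_sumr; apply: eq_bigr => l3 _.
by case: ifP => _; [rewrite -[LHS]mulrA|rewrite mulr0].
Qed.

Lemma triBk k k' u v w N l :
  tri (fun l1 l2 l3 => k l1 l2 l3 - k' l1 l2 l3) u v w N l =
  tri k u v w N l - tri k' u v w N l.
Proof.
rewrite /tri -sumrB; apply: eq_bigr => l1 _.
rewrite -sumrB; apply: eq_bigr => l2 _.
rewrite -sumrB; apply: eq_bigr => l3 _.
by case: ifP => _; rewrite ?subr0// mulrBl.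
Qed.

(** The projection onto the frequencies at most N0. *)
Definition low_freq (N0 : nat) u (l : int) : R[i] := if (`|l| <= N0)%N then u l else 0.

(** Truncating the factors truncates the sum, so the low-frequency part of the
   cubic convolution is [tri] with N0 in place of N. *)
Lemma tri_low_freq k u v w N0 N l : (N0 <= N)%N ->
  tri k (low_freq N0 u) (low_freq N0 v) (low_freq N0 w) N l = tri k u v w N0 l.
Proof.
move=> h.
have key (F : int -> R[i]) : \sum_(x <- zrange N0) F x =
    \sum_(x <- zrange N) (if (`|x| <= N0)%N then F x else 0).
  rewrite -big_mkcond/= -[RHS]big_filter; apply: perm_big.
  apply: uniq_perm; rewrite ?filter_uniq ?zrange_uniq// => x.
  rewrite mem_filter !mem_zrange; case: leqP => //= xN.
  by rewrite (leq_trans xN).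
rewrite /tri [RHS]key; apply: eq_bigr => l1 _.
case: (boolP (`|l1| <= N0)%N) => h1; last first.
  rewrite big1// => l2 _; rewrite big1// => l3 _.
  by rewrite /low_freq (negbTE h1) !mul0r mulr0; case: ifP.
rewrite [RHS]key; apply: eq_bigr => l2 _.
case: (boolP (`|l2| <= N0)%N) => h2; last first.
  rewrite big1// => l3 _.
  by rewrite /low_freq (negbTE h2) conjc0 mulr0 mul0r mulr0; case: ifP.
rewrite [RHS]key; apply: eq_bigr => l3 _.
case: (boolP (`|l3| <= N0)%N) => h3; last first.
  by rewrite {3}/low_freq (negbTE h3) !mulr0; case: ifP.
by rewrite /low_freq h1 h2 h3.
Qed.

Lemma sob_le_low_freq p u N0 B : sob_le p u B -> sob_le p (low_freq N0 u) B.
Proof.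
apply: sob_le_mod => l; rewrite /low_freq; case: ifP => // _.
by rewrite cmod0 cmod_ge0.
Qed.

End Trilinear.

(** * Limits, the mean value inequality and the phase integrals *)

Section Limits.
Context {R : realType}.
Implicit Types (z w : nat -> R[i]).

Definition ccvg z (zl : R[i]) : Prop :=
  forall e : R, 0 < e -> exists N0, forall n, (N0 <= n)%N -> cmod (z n - zl) <= e.

Lemma ccvg_cst (zl : R[i]) : ccvg (fun=> zl) zl.
Proof. by move=> e e0; exists 0%N => n _; rewrite subrr cmod0 ltW. Qed.

Lemma ccvg_eventually z w zl :
  (exists N0, forall n, (N0 <= n)%N -> z n = w n) -> ccvg z zl -> ccvg w zl.
Proof.
move=> [N0 h] hz e /hz[N1 h1]; exists (maxn N0 N1) => n.
by rewrite geq_max => /andP[n0 n1]; rewrite -h// h1.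
Qed.

Lemma ccvg_ext z w zl : (forall n, z n = w n) -> ccvg z zl -> ccvg w zl.
Proof. by move=> h; apply: ccvg_eventually; exists 0%N. Qed.

Lemma ccvgD z w zl wl : ccvg z zl -> ccvg w wl ->
  ccvg (fun n => z n + w n) (zl + wl).
Proof.
move=> hz hw e e0; have e2 : 0 < e / 2 by rewrite divr_gt0.
have [N1 h1] := hz _ e2; have [N2 h2] := hw _ e2.
exists (maxn N1 N2) => n; rewrite geq_max => /andP[/h1 k1 /h2 k2].
rewrite (_ : _ - _ = (z n - zl) + (w n - wl)); last by ring.
by rewrite (le_trans (cmodD _ _))// (splitr e) lerD.
Qed.

Lemma ccvgZ z zl (c : R[i]) : ccvg z zl -> ccvg (fun n => c * z n) (c * zl).
Proof.
move=> hz e e0; have c1 : 0 < cmod c + 1 by rewrite ltr_wpDl// cmod_ge0.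
have [N1 h1] := hz _ (divr_gt0 e0 c1).
exists N1 => n /h1 h; rewrite -mulrBr cmodM.
apply: (@le_trans _ _ ((cmod c + 1) * (e / (cmod c + 1)))); last first.
  by rewrite mulrC divfK// lt0r_neq0.
by rewrite ler_pM ?cmod_ge0// lerDl.
Qed.

Lemma ccvgB z w zl wl : ccvg z zl -> ccvg w wl ->
  ccvg (fun n => z n - w n) (zl - wl).
Proof.
move=> hz hw; rewrite -(mulN1r wl).
by apply: ccvg_ext (ccvgD hz (ccvgZ (-1) hw)) => n; rewrite mulN1r.
Qed.

Lemma ccvg_Re z zl : ccvg z zl ->
  (fun n => complex.Re (z n)) @ \oo --> complex.Re zl.
Proof.
move=> hz; apply/cvgrPdist_le => e /hz[N0 h]; exists N0 => // n /= /h h1.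
rewrite -normrN opprB -RecN -RecD.
exact: le_trans (Re_le_cmod _) h1.
Qed.

Lemma ccvg_Im z zl : ccvg z zl ->
  (fun n => complex.Im (z n)) @ \oo --> complex.Im zl.
Proof.
move=> hz; apply/cvgrPdist_le => e /hz[N0 h]; exists N0 => // n /= /h h1.
rewrite -normrN opprB -ImcN -ImcD.
exact: le_trans (Im_le_cmod _) h1.
Qed.

Lemma ccvg_ReIm z zl :
  (fun n => complex.Re (z n)) @ \oo --> complex.Re zl ->
  (fun n => complex.Im (z n)) @ \oo --> complex.Im zl -> ccvg z zl.
Proof.
move=> /cvgrPdist_le hr /cvgrPdist_le hi e e0.
have e2 : 0 < e / 2 by rewrite divr_gt0.
have [N1 _ h1] := hr _ e2; have [N2 _ h2] := hi _ e2.
exists (maxn N1 N2) => n; rewrite geq_max => /andP[/h1/= k1 /h2/= k2].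
rewrite cmod_distC (le_trans (cmod_le_ReIm _))// (splitr e) lerD//.
  by rewrite RecD RecN.
by rewrite ImcD ImcN.
Qed.

Lemma ccvgM z w zl wl : ccvg z zl -> ccvg w wl ->
  ccvg (fun n => z n * w n) (zl * wl).
Proof.
move=> hz hw; have [zrange zi] := (ccvg_Re hz, ccvg_Im hz).
have [wr wi] := (ccvg_Re hw, ccvg_Im hw).
apply: ccvg_ReIm.
  rewrite RecM; under eq_fun do rewrite RecM.
  by apply: cvgB; apply: cvgM.
rewrite ImcM; under eq_fun do rewrite ImcM.
by apply: cvgD; apply: cvgM.
Qed.

Lemma ccvgJ z zl : ccvg z zl -> ccvg (fun n => conjc (z n)) (conjc zl).
Proof.
by move=> hz e /hz[N h]; exists N => n /h; rewrite -rmorphB/= cmodJ.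
Qed.

Lemma ccvg_unique z zl zm : ccvg z zl -> ccvg z zm -> zl = zm.
Proof.
move=> h0 h1; apply: complex_ext.
  exact: (cvg_unique _ (ccvg_Re h0) (ccvg_Re h1)).
exact: (cvg_unique _ (ccvg_Im h0) (ccvg_Im h1)).
Qed.

Lemma ccvg_cmod z zl : ccvg z zl -> (fun n => cmod (z n)) @ \oo --> cmod zl.
Proof.
move=> hz; apply/cvgrPdist_le => e /hz[N0 h]; exists N0 => // n /= /h h1.
have := cmodD zl (z n - zl); rewrite addrC subrK => k1.
have := cmodD (zl - z n) (z n); rewrite subrK cmod_distC => k2.
rewrite ler_norml; lra.
Qed.

(** Fatou's lemma for the sequence norms. *)
Lemma sob_le_lim p (F : nat -> int -> R[i]) (c : int -> R[i]) B N1 :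
  (forall N, (N1 <= N)%N -> sob_le p (F N) B) ->
  (forall l, ccvg (F^~ l) (c l)) -> sob_le p c B.
Proof.
move=> hF hc; have [B0 _] := hF N1 (leqnn _).
split => // N.
have H : (fun n => \sum_(l <- zrange N) (jap l ^+ p * cmod (F n l)) ^+ 2) @ \oo -->
    \sum_(l <- zrange N) (jap l ^+ p * cmod (c l)) ^+ 2.
  elim: (zrange N) => [|l s IH].
    by rewrite big_nil; under eq_fun do rewrite big_nil; exact: cvg_cst.
  rewrite big_cons; under eq_fun do rewrite big_cons.
  apply: cvgD => //; rewrite expr2; under eq_fun do rewrite expr2.
  by apply: cvgM; apply: cvgMr; exact: ccvg_cmod.
apply: (cvgr_to_le H); exists N1 => // n /= /hF[_]; exact.
Qed.

End Limits.

Section MeanValue.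
Context {R : realType}.
Implicit Types (f g : R -> R[i]) (t : R).

Definition is_cderive f t (d : R[i]) : Prop :=
  is_derive t 1 (fun s => complex.Re (f s)) (complex.Re d) /\
  is_derive t 1 (fun s => complex.Im (f s)) (complex.Im d).

Lemma is_cderiveD f g t df dg : is_cderive f t df -> is_cderive g t dg ->
  is_cderive (fun s => f s + g s) t (df + dg).
Proof.
move=> [f1 f2] [g1 g2]; split.
  rewrite RecD; under eq_fun do rewrite RecD.
  exact: (is_deriveD f1 g1).
rewrite ImcD; under eq_fun do rewrite ImcD.
exact: (is_deriveD f2 g2).
Qed.

Lemma is_cderive_cst t (z : R[i]) : is_cderive (fun=> z) t 0.
Proof. by split; apply: is_derive_cst. Qed.

Lemma is_cderiveZ f t df (z : R[i]) : is_cderive f t df ->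
  is_cderive (fun s => z * f s) t (z * df).
Proof.
move=> [f1 f2]; split.
  rewrite RecM; under eq_fun do rewrite RecM.
  exact: (is_deriveB (is_deriveZ (complex.Re z) f1) (is_deriveZ (complex.Im z) f2)).
rewrite ImcM; under eq_fun do rewrite ImcM.
exact: (is_deriveD (is_deriveZ (complex.Re z) f2) (is_deriveZ (complex.Im z) f1)).
Qed.

Lemma is_cderive_sum (I : Type) (s : seq I) (F : I -> R -> R[i]) dF t :
  (forall i, is_cderive (F i) t (dF i)) ->
  is_cderive (fun x => \sum_(i <- s) F i x) t (\sum_(i <- s) dF i).
Proof.
move=> h; elim: s => [|i s IH].
  rewrite big_nil; under [fun x => _]eq_fun do rewrite big_nil.
  exact: is_cderive_cst.
rewrite big_cons; under [fun x => _]eq_fun do rewrite big_cons.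
exact: is_cderiveD.
Qed.

Lemma is_cderive_cis (a b t : R) :
  is_cderive (fun s => cis (a * s + b)) t ('i%C * a%:C * cis (a * t + b)).
Proof.
have d : is_derive t 1 (fun s => a * s + b) a.
  have := is_deriveD (is_deriveZ a (is_derive_id t (1:R))) (is_derive_cst b t (1:R)).
  by rewrite addr0 [a *: 1]mulr1.
split.
  under eq_fun do rewrite cisE/=.
  have := @is_derive1_comp _ cos (fun s => a * s + b) t _ _ (is_derive_cos _) d.
  rewrite cisE/=; congr is_derive; ring.
under eq_fun do rewrite cisE/=.
have := @is_derive1_comp _ sin (fun s => a * s + b) t _ _ (is_derive_sin _) d.
rewrite cisE/=; congr is_derive; ring.
Qed.

(** The mean value inequality for a finite weighted family: pair the increment
   with itself and apply the scalar mean value theorem. *)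
Lemma mean_value_seq (I : Type) (s : seq I) (p : I -> R)
    (f g : I -> R -> R[i]) a b B :
  a <= b -> 0 <= B -> (forall i, 0 <= p i) ->
  (forall i t, t \in `[a, b] -> is_cderive (f i) t (g i t)) ->
  (forall t, t \in `[a, b] -> \sum_(i <- s) (p i * cmod (g i t)) ^+ 2 <= B ^+ 2) ->
  \sum_(i <- s) (p i * cmod (f i b - f i a)) ^+ 2 <= ((b - a) * B) ^+ 2.
Proof.
move=> ab B0 p0 hd hg.
(* h pairs f with its own increment, so that h b - h a is the sum to bound. *)
pose x i := complex.Re (f i b - f i a); pose y i := complex.Im (f i b - f i a).
pose h t := \sum_(i <- s) p i ^+ 2 *
  (x i * complex.Re (f i t) + y i * complex.Im (f i t)).
pose dh t := \sum_(i <- s) p i ^+ 2 *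
  (x i * complex.Re (g i t) + y i * complex.Im (g i t)).
have der t : t \in `[a, b] -> is_derive t 1 h (dh t).
  move=> tab; rewrite /h /dh; elim: s {hg h dh} => [|i s IH].
    rewrite big_nil; under [fun t0 => _]eq_fun do rewrite big_nil.
    exact: is_derive_cst.
  rewrite big_cons; under [fun t0 => _]eq_fun do rewrite big_cons.
  have [d1 d2] := hd i t tab.
  exact: (is_deriveD (is_deriveZ (p i ^+ 2)
    (is_deriveD (is_deriveZ (x i) d1) (is_deriveZ (y i) d2))) IH).
have dero t : t \in `]a, b[ -> is_derive t 1 h (dh t).
  by move=> tab; apply: der; exact: subset_itv_oo_cc tab.
have cont : {within `[a, b], continuous h}.
  by apply: derivable_within_continuous => t tab; have [] := der t tab.
have [t tab e] := MVT_segment ab dero cont.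
set N := \sum_(i <- s) _.
have N0 : 0 <= N by apply: sumr_ge0 => i _; rewrite sqr_ge0.
have hN : h b - h a = N.
  rewrite /h -sumrB; apply: eq_bigr => i _; rewrite -mulrBr exprMn sqr_cmod.
  by congr (_ * _); rewrite /x /y RecD ImcD RecN ImcN; ring.
have dN : dh t ^+ 2 <= N * B ^+ 2.
  apply: (@le_trans _ _ (N * \sum_(i <- s) (p i * cmod (g i t)) ^+ 2)); last first.
    by rewrite ler_wpM2l// hg.
  apply: (le_trans _ (cauchy_schwarz _ _ _)).
  have S0 : 0 <= \sum_(i <- s)
      (p i * cmod (f i b - f i a)) * (p i * cmod (g i t)).
    by apply: sumr_ge0 => i _; rewrite !mulr_ge0 ?cmod_ge0.
  rewrite -(real_normK (num_real (dh t))) ler_pXn2r ?nnegrE//.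
  rewrite (le_trans (ler_norm_sum _ _ _))//; apply: ler_sum => i _.
  rewrite normrM ger0_norm ?sqr_ge0// mulrACA -expr2 ler_wpM2l ?sqr_ge0//.
  have := Re_le_cmod ((f i b - f i a) * conjc (g i t)).
  rewrite cmodM cmodJ; apply: le_trans; rewrite RecM -/(x i) -/(y i).
  by case: (g i t) => u v /=; rewrite mulrN opprK.
have e2 : N ^+ 2 <= ((b - a) * B) ^+ 2 * N.
  have -> : N ^+ 2 = (b - a) ^+ 2 * dh t ^+ 2 by rewrite -hN e exprMn mulrC.
  have -> : ((b - a) * B) ^+ 2 * N = (b - a) ^+ 2 * (N * B ^+ 2) by ring.
  by rewrite ler_wpM2l ?sqr_ge0.
have [N00|Npos] := eqVneq N 0; first by rewrite N00 sqr_ge0.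
by rewrite -(@ler_pM2r _ N) ?lt0r ?Npos// -expr2.
Qed.

Lemma mean_value (f g : R -> R[i]) a b B : a <= b -> 0 <= B ->
  (forall t, t \in `[a, b] -> is_cderive f t (g t)) ->
  (forall t, t \in `[a, b] -> cmod (g t) <= B) ->
  cmod (f b - f a) <= (b - a) * B.
Proof.
move=> ab B0 hd hg.
have := @mean_value_seq unit [:: tt] (fun=> 1) (fun=> f) (fun=> g) a b B ab B0.
move=> /(_ (fun=> ler01) (fun=> hd)); rewrite big_seq1 mul1r => h.
apply: le_of_sqr; first by rewrite mulr_ge0// subr_ge0.
apply: h => t tab; rewrite big_seq1 mul1r ler_pXn2r ?nnegrE ?cmod_ge0//.
exact: hg.
Qed.

Lemma sob_le_mean_value p (f g : int -> R -> R[i]) a b B : a <= b -> 0 <= B ->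
  (forall l t, t \in `[a, b] -> is_cderive (f l) t (g l t)) ->
  (forall t, t \in `[a, b] -> sob_le p (g^~ t) B) ->
  sob_le p (fun l => f l b - f l a) ((b - a) * B).
Proof.
move=> ab B0 hd hg; split; first by rewrite mulr_ge0// subr_ge0.
move=> N; apply: (@mean_value_seq _ _ (fun l => jap l ^+ p) _ g _ _ _ ab B0 _ hd).
  by move=> l; exact: japX_ge0.
by move=> t /hg[_]; exact.
Qed.

End MeanValue.

Section Phases.
Context {R : realType}.
Implicit Types (x y s t : R).

(** The values of phi1 on the imaginary axis. *)
Definition phi1i x : R[i] := phi1 (x *i).

(** The integral of e^(ixr) over r in [0,s]. *)
Definition phase_int x s : R[i] := s%:C * phi1i (s * x).

Lemma phi1i0 : phi1i 0 = 1.
Proof. by rewrite /phi1i /phi1 eqxx. Qed.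

Lemma imag_neq0 x : x != 0 -> (x *i : R[i]) != 0.
Proof. by rewrite eq_complex/= eqxx. Qed.

Lemma imagE x : x *i = 'i%C * x%:C :> R[i].
Proof. by apply: complex_ext => /=; ring. Qed.

Lemma phi1iE x : x != 0 -> phi1i x = (cis x - 1) / ('i%C * x%:C).
Proof. by move=> x0; rewrite /phi1i /phi1 (negbTE (imag_neq0 x0)) -imagE. Qed.

Lemma cis_phi1i x : cis x - 1 = 'i%C * x%:C * phi1i x.
Proof.
have [->|x0] := eqVneq x 0; first by rewrite cis0 subrr mulr0 mul0r.
by rewrite phi1iE// mulrC divfK// -imagE imag_neq0.
Qed.

Lemma phase_int0 x : phase_int x 0 = 0.
Proof. by rewrite /phase_int mul0r. Qed.

Lemma is_cderive_phase_int x t : is_cderive (phase_int x) t (cis (x * t)).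
Proof.
have [->|x0] := eqVneq x 0.
  rewrite mul0r cis0.
  have -> : phase_int 0 = fun s => s%:C.
    by apply: funext => s; rewrite /phase_int mulr0 phi1i0 mulr1.
  by split; [exact: is_derive_id|exact: is_derive_cst].
have i0 := imag_neq0 x0; rewrite imagE in i0.
have -> : phase_int x = fun s => ('i%C * x%:C)^-1 * cis (x * s + 0) + - ('i%C * x%:C)^-1.
  apply: funext => s; rewrite /phase_int addr0.
  have := cis_phi1i (s * x); rewrite rmorphM/= [x * s]mulrC => /(canRL (subrK _)) ->.
  rewrite mulrDr mulr1 addrK.
  rewrite (_ : 'i%C * (s%:C * x%:C) * _ = ('i%C * x%:C) * (s%:C * phi1i (s * x))); last by ring.
  by rewrite mulKf.
have := is_cderiveD (is_cderiveZ ('i%C * x%:C)^-1 (is_cderive_cis x 0 t))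
  (is_cderive_cst t (- ('i%C * x%:C)^-1)).
by rewrite addr0 addr0 mulKf.
Qed.

Lemma phi1i_phase_int x : phi1i x = phase_int x 1 - phase_int x 0.
Proof. by rewrite phase_int0 subr0 /phase_int !mul1r. Qed.

Lemma phi1i_le1 x : cmod (phi1i x) <= 1.
Proof.
rewrite phi1i_phase_int -[leRHS]mulr1 -{2}(subr0 (1 : R)).
apply: mean_value => // t _; first exact: is_cderive_phase_int.
by rewrite cmod_cis.
Qed.

Lemma cis_sub1_le x : cmod (cis x - 1) <= `|x|.
Proof.
rewrite cis_phi1i !cmodM cmodi cmodR mul1r.
by rewrite ler_piMr// phi1i_le1.
Qed.

Lemma cis_lip x y : cmod (cis x - cis y) <= `|x - y|.
Proof.
rewrite -{1}(subrK y x) cisD -{2}(mul1r (cis y)) -mulrBl cmodM cmod_cis mulr1.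
exact: cis_sub1_le.
Qed.

Lemma phi1i_lip x y : cmod (phi1i x - phi1i y) <= `|x - y|.
Proof.
rewrite !phi1i_phase_int opprB addrC addrA -[leRHS]mul1r -{3}(subr0 (1 : R)).
rewrite (_ : _ - phase_int x 0 = (phase_int x 1 + -1 * phase_int y 1) - (phase_int x 0 + -1 * phase_int y 0)); last by ring.
apply: (@mean_value _ (fun s => phase_int x s + -1 * phase_int y s)
  (fun s => cis (x * s) + -1 * cis (y * s))) => // t.
  by move=> _; apply: is_cderiveD; [|apply: is_cderiveZ]; exact: is_cderive_phase_int.
rewrite in_itv/= => /andP[t0 t1]; rewrite mulN1r (le_trans (cis_lip _ _))//.
by rewrite -mulrBl normrM ler_piMr// ger0_norm.
Qed.

(** The only zero of e^(ix) - 1 in this range is x = 0, and it is simple. *)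
Lemma cis_sub1_ge x : `|x| <= 1 / 2 -> `|x| / 2 <= cmod (cis x - 1).
Proof.
move=> hx; rewrite cis_phi1i !cmodM cmodi cmodR mul1r ler_wpM2l//.
have h := phi1i_lip 0 x; rewrite phi1i0 sub0r normrN in h.
have := cmodD (phi1i x) (1 - phi1i x); rewrite addrC subrK cmod1.
lra.
Qed.

(** The closed form of the geometric sum: its size is governed by the distance
   of x to the resonance. *)
Lemma geometric_sum_le x n : x != 0 -> `|x| <= 1 / 2 ->
  cmod (\sum_(j < n) cis (j%:R * x)) <= 4 / `|x|.
Proof.
move=> x0 hx; have nx : 0 < `|x| by rewrite normr_gt0.
have e : (cis x - 1) * \sum_(j < n) cis (j%:R * x) = cis (n%:R * x) - 1.
  elim: n => [|n IH]; first by rewrite big_ord0 mulr0 mul0r cis0 subrr.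
  rewrite big_ord_recr/= mulrDr IH -natr1 [(_ + 1) * x]mulrDl mul1r cisD; ring.
have := cis_sub1_ge hx.
have : cmod (cis x - 1) * cmod (\sum_(j < n) cis (j%:R * x)) <= 2.
  rewrite -cmodM e (le_trans (cmodB _ _))// cmod_cis cmod1; lra.
rewrite ler_pdivlMr//; have := cmod_ge0 (\sum_(j < n) cis (j%:R * x)).
by nra.
Qed.

End Phases.

(** * Error analysis of the integrator on twisted Fourier coefficients *)

Section Kernels.
Context {R : realType}.
Implicit Types (t tau : R) (l : int).

(** On l = l1 - l2 + l3 this is l^2 + l2^2 - l1^2 - l3^2, the phase of the
   interaction of four frequencies. *)
Definition phase l1 l2 l3 : R := 2 * ((l1 - l2) * (l3 - l2))%:~R.

Definition phase_ker t l1 l2 l3 : R[i] := cis (t * phase l1 l2 l3).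

Definition resonant l1 l2 l3 : bool := (l1 - l2) * (l3 - l2) == 0.

(** The weight that the integrator gives to an interaction, divided by tau: on
   resonant triples that of the exact integral, on the others that of the
   phase 2 l2^2. *)
Definition nr_ker tau l1 l2 l3 : R[i] :=
  if resonant l1 l2 l3 then 1 else phi1i (2 * tau * l2%:~R ^+ 2).

(** The kernel of the integrator at time t, in the twisted variable. *)
Definition scheme_ker tau t l1 l2 l3 : R[i] := phase_ker t l1 l2 l3 * nr_ker tau l1 l2 l3.

(** The exact minus the numerical integral of the phase over one step started
   at time 0. *)
Definition defect tau l1 l2 l3 : R[i] :=
  tau%:C * (phi1i (tau * phase l1 l2 l3) - nr_ker tau l1 l2 l3).

(** The kernel of the errors of n successive steps, for a fixed profile. *)
Definition acc_ker tau (n : nat) l1 l2 l3 : R[i] :=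
  defect tau l1 l2 l3 * \sum_(j < n) phase_ker (j%:R * tau) l1 l2 l3.

Lemma phase_ker_le1 t l1 l2 l3 : cmod (phase_ker t l1 l2 l3) <= 1.
Proof. by rewrite cmod_cis. Qed.

Lemma nr_ker_le1 tau l1 l2 l3 : cmod (nr_ker tau l1 l2 l3) <= 1.
Proof. by rewrite /nr_ker; case: ifP => _; rewrite ?cmod1// phi1i_le1. Qed.

Lemma scheme_ker_le1 tau t l1 l2 l3 : cmod (scheme_ker tau t l1 l2 l3) <= 1.
Proof. by rewrite cmodM cmod_cis mul1r nr_ker_le1. Qed.

Lemma norm_mul_jap (l l' l'' : int) :
  `|l%:~R * l'%:~R| <= jap l * jap l' * jap l'' :> R.
Proof.
rewrite normrM -[leLHS]mulr1 ler_pM ?mulr_ge0// ?jap_ge1//.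
by rewrite ler_pM// norm_le_jap.
Qed.

(** The quadratic part 2 l2^2 of the phase is integrated exactly, so that the
   remainder carries at most one derivative on each of two factors. *)
Lemma defect_le tau l1 l2 l3 : 0 <= tau ->
  cmod (defect tau l1 l2 l3) <= 6 * tau ^+ 2 * (jap l1 * jap l2 * jap l3).
Proof.
move=> t0.
have J0 : 0 <= jap l1 * jap l2 * jap l3 :> R by rewrite !mulr_ge0 ?jap_ge0.
rewrite cmodM cmodR ger0_norm// /nr_ker /resonant.
case: eqP => [e|_].
  by rewrite /phase e mulr0 mulr0 phi1i0 subrr cmod0 mulr0 !mulr_ge0 ?sqr_ge0 ?jap_ge0.
have h : cmod (phi1i (tau * phase l1 l2 l3) - phi1i (2 * tau * l2%:~R ^+ 2)) <=
    tau * (6 * (jap l1 * jap l2 * jap l3)).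
  apply: (le_trans (phi1i_lip _ _)).
  rewrite (_ : _ - _ = tau * (2 * (l1%:~R * l3%:~R - l1%:~R * l2%:~R - l2%:~R * l3%:~R))).
    rewrite normrM ger0_norm// ler_wpM2l// normrM ger0_norm//.
    have h13 : `|l1%:~R * l3%:~R| <= jap l1 * jap l2 * jap l3 :> R.
      by rewrite (le_trans (norm_mul_jap _ _ l2))// mulrAC.
    have h12 := norm_mul_jap l1 l2 l3.
    have h23 : `|l2%:~R * l3%:~R| <= jap l1 * jap l2 * jap l3 :> R.
      by rewrite (le_trans (norm_mul_jap _ _ l1))// mulrC mulrA.
    have := ler_normB (l1%:~R * l3%:~R - l1%:~R * l2%:~R) (l2%:~R * l3%:~R : R).
    have := ler_normB (l1%:~R * l3%:~R) (l1%:~R * l2%:~R : R).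
    lra.
  by rewrite /phase rmorphM/= !rmorphB/=; ring.
rewrite (le_trans (ler_wpM2l t0 h))// le_eqVlt; apply/orP; left; apply/eqP; ring.
Qed.

Lemma phase_ge2 l1 l2 l3 : ~~ resonant l1 l2 l3 -> 2 <= `|phase l1 l2 l3|.
Proof.
rewrite /resonant /phase normrM ger0_norm// => h.
rewrite ler_peMr// -intr_norm -[leLHS]/(1%:~R) ler_int.
by move: h; move: (_ * _) => z; lia.
Qed.

Lemma phase_le (N0 : nat) l1 l2 l3 :
  (`|l1| <= N0)%N -> (`|l2| <= N0)%N -> (`|l3| <= N0)%N ->
  `|phase l1 l2 l3| <= 8 * N0%:R ^+ 2.
Proof.
move=> h1 h2 h3; rewrite /phase normrM ger0_norm// -intr_norm normrM.
have a : (`|l1 - l2| <= (2 * N0)%N%:Z)%R by lia.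
have b : (`|l3 - l2| <= (2 * N0)%N%:Z)%R by lia.
have : (`|l1 - l2| * `|l3 - l2| <= (2 * N0)%N%:Z * (2 * N0)%N%:Z)%R.
  by rewrite ler_pM.
rewrite -(ler_int R) [X in _ <= X -> _]rmorphM/= -!pmulrn natrM.
by nra.
Qed.

(** Low frequencies stay away from the resonances of the time grid, so that the
   phases of the errors average out: one power of tau is gained. *)
Lemma acc_ker_le tau n (N0 : nat) l1 l2 l3 : 0 < tau ->
  16 * tau * N0%:R ^+ 2 <= 1 ->
  (`|l1| <= N0)%N -> (`|l2| <= N0)%N -> (`|l3| <= N0)%N ->
  cmod (acc_ker tau n l1 l2 l3) <= 12 * tau * (jap l1 * jap l2 * jap l3).
Proof.
move=> t0 ht h1 h2 h3.
have J0 : 0 <= jap l1 * jap l2 * jap l3 :> R by rewrite !mulr_ge0 ?jap_ge0.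
have [r|nr] := boolP (resonant l1 l2 l3).
  have -> : acc_ker tau n l1 l2 l3 = 0.
    rewrite /acc_ker /defect /nr_ker r /phase (eqP r) mulr0 mulr0 phi1i0 subrr mulr0.
    by rewrite mul0r.
  by rewrite cmod0 mulr_ge0// mulr_ge0// ltW.
have o2 := phase_ge2 nr; have o8 := phase_le h1 h2 h3.
have om0 : 0 < `|phase l1 l2 l3| by exact: lt_le_trans o2.
have o0 : tau * phase l1 l2 l3 != 0.
  by rewrite mulf_neq0// -?normr_gt0// gtr0_norm.
have oh : `|tau * phase l1 l2 l3| <= 1 / 2.
  rewrite normrM gtr0_norm//; nra.
have g : cmod (\sum_(j < n) phase_ker (j%:R * tau) l1 l2 l3) <= 2 / tau.
  have := geometric_sum_le n o0 oh.
  under eq_bigr do rewrite mulrA.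
  move/le_trans; apply.
  rewrite normrM gtr0_norm// invfM mulrA ler_pdivrMr//.
  rewrite mulrAC ler_wpM2r ?invr_ge0 ?(ltW t0)//; lra.
rewrite cmodM.
apply: (@le_trans _ _ (6 * tau ^+ 2 * (jap l1 * jap l2 * jap l3) * (2 / tau))).
  by rewrite ler_pM ?cmod_ge0// defect_le// ltW.
by rewrite le_eqVlt; apply/orP; left; apply/eqP; field; rewrite gt_eqF.
Qed.

Lemma acc_ker0 tau l1 l2 l3 : acc_ker tau 0 l1 l2 l3 = 0.
Proof. by rewrite /acc_ker big_ord0 mulr0. Qed.

Lemma acc_kerS tau n l1 l2 l3 :
  acc_ker tau n.+1 l1 l2 l3 - acc_ker tau n l1 l2 l3 =
  phase_ker (n%:R * tau) l1 l2 l3 * defect tau l1 l2 l3.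
Proof. by rewrite /acc_ker big_ord_recr/=; ring. Qed.

(** The integral over [t, t + s] of the kernel [phase_ker]. *)
Definition Qker t s l1 l2 l3 : R[i] := phase_ker t l1 l2 l3 * phase_int (phase l1 l2 l3) s.

Lemma Qker_scheme_ker tau t l1 l2 l3 :
  Qker t tau l1 l2 l3 - tau%:C * scheme_ker tau t l1 l2 l3 =
  phase_ker t l1 l2 l3 * defect tau l1 l2 l3.
Proof. rewrite /Qker /scheme_ker /defect /phase_int; ring. Qed.

(** Abel summation of the oscillating errors. *)
Lemma abel_tri tau (v : nat -> int -> R[i]) n N0 l :
  \sum_(k < n) (tri (Qker (k%:R * tau) tau) (v k) (v k) (v k) N0 l -
     tau%:C * tri (scheme_ker tau (k%:R * tau)) (v k) (v k) (v k) N0 l) =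
  tri (acc_ker tau n) (v n) (v n) (v n) N0 l -
  \sum_(k < n) (tri (acc_ker tau k.+1) (v k.+1) (v k.+1) (v k.+1) N0 l -
     tri (acc_ker tau k.+1) (v k) (v k) (v k) N0 l).
Proof.
elim: n => [|n IH].
  rewrite !big_ord0 subr0 /tri big1// => l1 _; rewrite big1// => l2 _.
  by rewrite big1// => l3 _; rewrite acc_ker0 mul0r; case: ifP.
rewrite !big_ord_recr/= IH -triZ -triBk.
have -> : tri (fun l1 l2 l3 => Qker (n%:R * tau) tau l1 l2 l3 -
      tau%:C * scheme_ker tau (n%:R * tau) l1 l2 l3) (v n) (v n) (v n) N0 l =
    tri (fun l1 l2 l3 => acc_ker tau n.+1 l1 l2 l3 - acc_ker tau n l1 l2 l3)
      (v n) (v n) (v n) N0 l.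
  by apply: eq_tri => l1 l2 l3 _ _ _ _; rewrite Qker_scheme_ker acc_kerS.
by rewrite triBk; ring.
Qed.

End Kernels.

(** A Lipschitz constant of the cubic convolution on the ball of radius K of
   H^1. *)
Definition lip_const {R : realType} (K : R) : R := 81 * K ^+ 2.

Definition err_const {R : realType} (T K : R) : R :=
  2 * T * lip_const K + T * (lip_const K ^+ 2 * K) +
  12 * (27 * K ^+ 3 + T * (lip_const K ^+ 2 * K)).

Section Convergence.
Context {R : realType}.
Variables (T e2 tau S K eta : R) (N0 : nat).
Variables (V c : R -> int -> R[i]) (X Z : nat -> int -> R[i]).
Hypotheses (e2_gt0 : 0 < e2) (tau_gt0 : 0 < tau) (T_ge : e2 * S <= T).
Hypotheses (N0_small : 16 * tau * N0%:R ^+ 2 <= 1).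
Hypothesis V_H2 : forall t, 0 <= t <= S -> sob_le 2 (V t) K.
Hypothesis V_tail : forall t, 0 <= t <= S ->
  sob_le 1 (fun l => V t l - low_freq N0 (V t) l) eta.
Hypothesis V_der : forall t, 0 <= t <= S ->
  forall l, is_cderive (V^~ l) t (- 'i%C * e2%:C * c t l).
Hypothesis V_nl : forall t, 0 <= t <= S ->
  forall l, ccvg (fun N => tri (phase_ker t) (V t) (V t) (V t) N l) (c t l).
Hypothesis X0 : forall l, X 0%N l = V 0 l.
Hypothesis X_step : forall n l, X n.+1 l = X n l - 'i%C * e2%:C * tau%:C * Z n l.
Hypothesis X_nl : forall n l,
  ccvg (fun N => tri (scheme_ker tau (n%:R * tau)) (X n) (X n) (X n) N l) (Z n l).

Let E : R := lip_const K.
Let E' : R := lip_const (K + 1).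
Let tn (n : nat) : R := n%:R * tau.

Let T_ge0 : 0 <= S -> 0 <= T.
Proof. by move=> S0; apply: le_trans T_ge; rewrite mulr_ge0// ltW. Qed.

Lemma nonlinearity_H2 t : 0 <= t <= S -> sob_le 2 (c t) (E * K).
Proof.
move=> ht; have hV := V_H2 ht.
have -> : E * K = 81 * 1 * K * K * K by rewrite /E /lip_const; ring.
apply: (@sob_le_lim _ 2 (fun N => tri (phase_ker t) (V t) (V t) (V t) N) _ _ 0) => [N _|l].
  exact: (tri_H2 _ (phase_ker_le1 t)).
exact: V_nl.
Qed.

(** With the free flow removed only the nonlinearity moves the profile, at speed
   eps^2. *)
Lemma twisted_increment a b : 0 <= a -> a <= b -> b <= S ->
  sob_le 2 (fun l => V b l - V a l) ((b - a) * (e2 * (E * K))).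
Proof.
move=> a0 ab bS.
have K0 : 0 <= K by apply: sob_le_ge0 (V_H2 (_ : 0 <= a <= S)); rewrite a0 (le_trans ab).
have sub t : t \in `[a, b] -> 0 <= t <= S.
  by rewrite in_itv/= => /andP[h1 h2]; rewrite (le_trans a0)//= (le_trans h2).
apply: (sob_le_mean_value (f := fun l s => V s l) (g := fun l t => - 'i%C * e2%:C * c t l)) => //.
- by rewrite !mulr_ge0// ltW.
- by move=> l t /sub ht; exact: V_der.
- move=> t /sub ht.
  have := sob_leZ (- 'i%C * e2%:C) (nonlinearity_H2 ht).
  by rewrite cmodM cmodN cmodi cmodR mul1r gtr0_norm.
Qed.

(** Freezing the profile over one step and discarding the high frequencies. *)
Lemma local_expansion n : tn n.+1 <= S ->
  sob_le 1 (fun l => V (tn n.+1) l - V (tn n) l + 'i%C * e2%:C *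
      tri (Qker (tn n) tau) (V (tn n)) (V (tn n)) (V (tn n)) N0 l)
    (tau * (e2 * (E * (tau * (e2 * (E * K)) + eta)))).
Proof.
move=> hS; set a := tn n; set b := tn n.+1.
have ba : b - a = tau by rewrite /a /b /tn -natr1; ring.
have ab : a <= b by rewrite -subr_ge0 ba ltW.
have a0 : 0 <= a by rewrite mulr_ge0// ltW.
have aS : 0 <= a <= S by rewrite a0 (le_trans ab).
have hVa := V_H2 aS; have K0 := sob_le_ge0 hVa.
have eta0 := sob_le_ge0 (V_tail aS).
pose f l t := V t l + 'i%C * e2%:C * tri (Qker a (t - a)) (V a) (V a) (V a) N0 l.
pose g l t := - 'i%C * e2%:C * c t l +
  'i%C * e2%:C * tri (phase_ker t) (V a) (V a) (V a) N0 l.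
have sub t : t \in `[a, b] -> 0 <= t <= S.
  by rewrite in_itv/= => /andP[h1 h2]; rewrite (le_trans a0)//= (le_trans h2).
have E0 : 0 <= E by rewrite /E /lip_const mulr_ge0// sqr_ge0.
have H : sob_le 1 (fun l => f l b - f l a)
    ((b - a) * (e2 * (E * (tau * (e2 * (E * K)) + eta)))).
  apply: (sob_le_mean_value (g := g)) => //.
  - by rewrite !(mulr_ge0, addr_ge0)// ltW.
  - move=> l t /sub ht; apply: is_cderiveD; first exact: V_der.
    apply: is_cderiveZ; rewrite /tri.
    apply: is_cderive_sum => l1; apply: is_cderive_sum => l2.
    apply: is_cderive_sum => l3.
    case: eqP => _; last exact: is_cderive_cst.
    have d : is_cderive (fun s => Qker a (s - a) l1 l2 l3) t (phase_ker t l1 l2 l3).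
      have -> : phase_ker t l1 l2 l3 = phase_ker a l1 l2 l3 * (1 * cis (phase l1 l2 l3 * (t - a))).
        by rewrite mul1r -cisD; congr cis; ring.
      rewrite /Qker; apply: is_cderiveZ.
      have [d1 d2] := is_cderive_phase_int (phase l1 l2 l3) (t - a).
      have ds : is_derive t 1 (fun s : R => s - a) 1.
        have := is_deriveB (is_derive_id t (1:R)) (is_derive_cst a t (1:R)).
        by rewrite subr0.
      rewrite mul1r; split.
        have := @is_derive1_comp _ (fun s => complex.Re (phase_int (phase l1 l2 l3) s))
          (fun s => s - a) t _ _ d1 ds; by rewrite mulr1.
      have := @is_derive1_comp _ (fun s => complex.Im (phase_int (phase l1 l2 l3) s))
          (fun s => s - a) t _ _ d2 ds; by rewrite mulr1.
    rewrite [X in is_cderive _ _ X]mulrC; under eq_fun do rewrite mulrC.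
    exact: is_cderiveZ.
  - move=> t tab; have ht := sub t tab; have hVt := V_H2 ht.
    have /andP[at' tb] : a <= t <= b by move: tab; rewrite in_itv.
    have hd : sob_le 1 (fun l => V t l - V a l) (tau * (e2 * (E * K))).
      apply: sob_le_le (sob_le21 (twisted_increment a0 at' (andP ht).2)).
      by rewrite ler_wpM2r ?mulr_ge0 ?(ltW e2_gt0)// -ba lerD2r.
    have lim1 : sob_le 1 (fun l => c t l - tri (phase_ker t) (V a) (V a) (V a) N0 l)
        (81 * 1 * K ^+ 2 * (tau * (e2 * (E * K))) + 81 * 1 * K ^+ 2 * eta).
      apply: (@sob_le_lim _ 1 (fun N l => (tri (phase_ker t) (V t) (V t) (V t) N l -
        tri (phase_ker t) (V a) (V a) (V a) N l) + (tri (phase_ker t) (V a) (V a) (V a) N l -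
        tri (phase_ker t) (low_freq N0 (V a)) (low_freq N0 (V a)) (low_freq N0 (V a)) N l)) _ _ N0).
        move=> N hN; apply: sob_leD.
          by apply: tri_lip => //; [exact: phase_ker_le1|exact: sob_le21|exact: sob_le21].
        apply: tri_lip; [exact: phase_ker_le1|exact: sob_le21| |exact: V_tail].
        by apply: sob_le_low_freq; exact: sob_le21.
      move=> l; apply: ccvg_eventually (ccvgB (V_nl ht l) (ccvg_cst _)).
      by exists N0 => N hN; rewrite tri_low_freq//; ring.
    have := sob_leZ (- 'i%C * e2%:C) lim1.
    rewrite cmodM cmodN cmodi cmodR mul1r gtr0_norm// mulr1 -mulrDr.
    by apply: sob_le_ext => l; rewrite /g; ring.
rewrite ba in H; apply: sob_le_ext H => l; rewrite /f subrr ba.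
have -> : tri (Qker a 0) (V a) (V a) (V a) N0 l = 0.
  rewrite /tri big1// => l1 _; rewrite big1// => l2 _; rewrite big1// => l3 _.
  by rewrite /Qker phase_int0 mulr0 mul0r; case: ifP.
ring.
Qed.

(** Passing from the numerical to the exact profile is a Lipschitz error,
   discarding the high frequencies another one. *)
Lemma scheme_consistency n En : tn n <= S -> En <= 1 ->
  sob_le 1 (fun l => X n l - V (tn n) l) En ->
  sob_le 1 (fun l => Z n l -
      tri (scheme_ker tau (tn n)) (V (tn n)) (V (tn n)) (V (tn n)) N0 l)
    (E' * En + E * eta).
Proof.
move=> hS hE hd.
have aS : 0 <= tn n <= S by rewrite hS mulr_ge0// ltW.
have hV := sob_le21 (V_H2 aS); have K0 := sob_le_ge0 hV.
have hX : sob_le 1 (X n) (K + 1).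
  apply: sob_le_ext (sob_le_le _ (sob_leD hd hV)) => [l|]; first by rewrite subrK.
  by rewrite addrC lerD2l.
have hV1 : sob_le 1 (V (tn n)) (K + 1) by apply: sob_le_le hV; rewrite lerDl.
have -> : E' * En + E * eta =
    81 * 1 * (K + 1) ^+ 2 * En + 81 * 1 * K ^+ 2 * eta by rewrite /E /E' /lip_const; ring.
apply: (@sob_le_lim _ 1 (fun N l => (tri (scheme_ker tau (tn n)) (X n) (X n) (X n) N l -
   tri (scheme_ker tau (tn n)) (V (tn n)) (V (tn n)) (V (tn n)) N l) +
  (tri (scheme_ker tau (tn n)) (V (tn n)) (V (tn n)) (V (tn n)) N l -
   tri (scheme_ker tau (tn n)) (low_freq N0 (V (tn n))) (low_freq N0 (V (tn n)))
     (low_freq N0 (V (tn n))) N l)) _ _ N0).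
  move=> N hN; apply: sob_leD; apply: tri_lip => //; try exact: scheme_ker_le1.
    by apply: sob_le_low_freq.
  exact: V_tail.
move=> l; apply: ccvg_eventually (ccvgB (X_nl n l) (ccvg_cst _)).
by exists N0 => N hN; rewrite tri_low_freq//; ring.
Qed.

(** After Abel summation only increments of the profile are summed; each gains a
   factor eps^2 tau, and eps^2 tau times the number of steps is at most T. *)
Lemma oscillation_bound n : tn n <= S ->
  sob_le 1 (fun l => \sum_(k < n)
     (tri (Qker (tn k) tau) (V (tn k)) (V (tn k)) (V (tn k)) N0 l -
      tau%:C * tri (scheme_ker tau (tn k)) (V (tn k)) (V (tn k)) (V (tn k)) N0 l))
    (12 * tau * (27 * K ^+ 3 + T * (E ^+ 2 * K))).
Proof.
move=> hS.
have tn_ge0 k : 0 <= tn k by rewrite mulr_ge0// ltW.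
have S0 : 0 <= S by apply: le_trans hS.
have tS k : (k <= n)%N -> 0 <= tn k <= S.
  by move=> kn; rewrite tn_ge0/= (le_trans _ hS)// ler_wpM2r ?ler_nat// ltW.
have K0 : 0 <= K by apply: sob_le_ge0 (V_H2 (tS n (leqnn n))).
have A m l1 l2 l3 h1 h2 h3 := @acc_ker_le R tau m N0 l1 l2 l3 tau_gt0 N0_small h1 h2 h3.
have hn := @tri_H1_weighted _ (acc_ker tau n) _ _ _ N0 _ _ _ _ (A n)
  (V_H2 (tS n (leqnn n))) (V_H2 (tS n (leqnn n))) (V_H2 (tS n (leqnn n))).
have hk k : (k < n)%N -> sob_le 1 (fun l =>
    tri (acc_ker tau k.+1) (V (tn k.+1)) (V (tn k.+1)) (V (tn k.+1)) N0 l -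
    tri (acc_ker tau k.+1) (V (tn k)) (V (tn k)) (V (tn k)) N0 l)
    (81 * (12 * tau) * K ^+ 2 * (tau * (e2 * (E * K)))).
  move=> kn; apply: (tri_lip_weighted (A k.+1)).
  - exact: V_H2 (tS k.+1 kn).
  - exact: V_H2 (tS k (ltnW kn)).
  have := @twisted_increment (tn k) (tn k.+1) (tn_ge0 k).
  have -> : tn k.+1 - tn k = tau by rewrite /tn -natr1; ring.
  apply; first by rewrite ler_wpM2r ?ler_nat// ltW.
  by have /andP[] := tS k.+1 kn.
have := sob_leB hn (sob_le_sum hk).
rewrite sumr_const card_ord => /(sob_le_le _)/(sob_le_ext _); apply.
  by move=> l; rewrite (abel_tri tau (fun k => V (tn k))).
rewrite -[_ *+ n]mulr_natr.
have -> : 81 * (12 * tau) * K ^+ 2 * (tau * (e2 * (E * K))) * n%:R =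
  12 * tau * ((e2 * (n%:R * tau)) * (E ^+ 2 * K)) by rewrite /E /lip_const; ring.
have -> : 27 * (12 * tau) * K * K * K = 12 * tau * (27 * K ^+ 3) by ring.
rewrite -mulrDr ler_wpM2l ?mulr_ge0 ?(ltW tau_gt0)// lerD2l ler_wpM2r//.
  by rewrite mulr_ge0// sqr_ge0.
by rewrite (le_trans _ T_ge)// ler_wpM2l// ltW.
Qed.

Let D0 : R := err_const T K.

(** The error recursion, closed by a discrete Gronwall argument.  The hypothesis
   that the resulting bound is at most 1 keeps the numerical solution in the
   ball of radius K + 1 on which the scheme is Lipschitz. *)
Theorem scheme_error :
  err_const T K * (e2 * tau + eta) * expR (T * lip_const (K + 1)) <= 1 ->
  forall n, n%:R * tau <= S ->
  sob_le 1 (fun l => X n l - V (n%:R * tau) l)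
    (err_const T K * (e2 * tau + eta) * expR (T * lip_const (K + 1))).
Proof.
rewrite -/E' -/D0 => small n hn.
have tn_ge0 k : 0 <= tn k by rewrite mulr_ge0// ltW.
have S0 : 0 <= S by apply: le_trans hn; exact: tn_ge0.
have T0 := T_ge0 S0.
have S00 : 0 <= (0 : R) <= S by rewrite lexx.
have K0 : 0 <= K by apply: sob_le_ge0 (V_H2 S00).
have eta0 : 0 <= eta by apply: sob_le_ge0 (V_tail S00).
have E0 : 0 <= E by rewrite /E /lip_const mulr_ge0// sqr_ge0.
have E'0 : 0 <= E' by rewrite /E' /lip_const mulr_ge0// sqr_ge0.
have tau0 := ltW tau_gt0; have e20 := ltW e2_gt0.
have EK0 : 0 <= E ^+ 2 * K by rewrite mulr_ge0// sqr_ge0.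
have D00 : 0 <= D0.
  by rewrite /D0 /err_const -/E !(addr_ge0, mulr_ge0)// exprn_ge0.
set D1 := D0 * (e2 * tau + eta).
have D10 : 0 <= D1 by rewrite mulr_ge0// addr_ge0// mulr_ge0.
set q := e2 * tau * E'; have q0 : 0 <= q by rewrite mulr_ge0// mulr_ge0.
pose Eb k := D1 * (1 + q) ^+ k.
have Eb_le k : tn k <= S -> Eb k <= D1 * expR (T * E').
  move=> hk; rewrite ler_wpM2l//.
  apply: (@le_trans _ _ (expR q ^+ k)).
    by rewrite lerXn2r ?nnegrE ?expR_ge0 ?addr_ge0// expR_ge1Dx.
  rewrite -expRM_natl ler_expR.
  have -> : k%:R * q = (e2 * (k%:R * tau)) * E' by rewrite /q; ring.
  by rewrite ler_wpM2r// (le_trans _ T_ge)// ler_wpM2l.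
suff H : forall k, tn k <= S -> sob_le 1 (fun l => X k l - V (tn k) l) (Eb k).
  exact: sob_le_le (Eb_le n hn) (H n hn).
elim/ltn_ind => k IH hk.
have sub j : (j <= k)%N -> tn j <= S.
  by move=> jk; rewrite (le_trans _ hk)// ler_wpM2r// ler_nat.
pose A j l := - 'i%C * e2%:C * tau%:C * (Z j l -
    tri (scheme_ker tau (tn j)) (V (tn j)) (V (tn j)) (V (tn j)) N0 l) -
  (V (tn j.+1) l - V (tn j) l + 'i%C * e2%:C *
    tri (Qker (tn j) tau) (V (tn j)) (V (tn j)) (V (tn j)) N0 l).
pose B j := e2 * tau * (E' * Eb j + E * eta) +
  tau * (e2 * (E * (tau * (e2 * (E * K)) + eta))).
have hA j : (j < k)%N -> sob_le 1 (A j) (B j).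
  move=> jk; apply: sob_leB; last by apply: local_expansion; exact: sub.
  have jS := sub j (ltnW jk).
  have Ej1 : Eb j <= 1 := le_trans (Eb_le j jS) small.
  have := sob_leZ (- 'i%C * e2%:C * tau%:C) (scheme_consistency jS Ej1 (IH j jk jS)).
  by rewrite !cmodM cmodN cmodi !cmodR mul1r !gtr0_norm.
have hO := sob_leZ ('i%C * e2%:C) (oscillation_bound hk).
have hS := sob_leD (sob_le_sum hA) hO.
rewrite cmodM cmodi cmodR mul1r gtr0_norm// in hS.
apply: (sob_le_ext _ (sob_le_le _ hS)).
  move=> l; rewrite mulr_sumr -big_split/= /A.
  elim: (k) => [|j IHj]; first by rewrite big_ord0 X0 /tn mul0r subrr.
  by rewrite big_ord_recr/= -IHj X_step; ring.
(* The geometric bounds Eb solve the recursion with equality. *)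
have Gr : D1 + \sum_(j < k) q * Eb j = Eb k.
  elim: (k) => [|j IHj]; first by rewrite big_ord0 addr0 /Eb expr0 mulr1.
  by rewrite big_ord_recr/= addrA IHj /Eb exprS; ring.
rewrite -Gr.
have -> : \sum_(j < k) B j = \sum_(j < k) (q * Eb j + (e2 * tau) *
    (2 * E * eta + E ^+ 2 * K * (e2 * tau))).
  by apply: eq_bigr => j _; rewrite /B /q; ring.
rewrite big_split/= sumr_const card_ord -[_ *+ k]mulr_natr -addrA [D1 + _]addrC lerD2l.
have -> : e2 * tau * (2 * E * eta + E ^+ 2 * K * (e2 * tau)) * k%:R =
  (e2 * (k%:R * tau)) * (2 * E * eta + E ^+ 2 * K * (e2 * tau)) by ring.
apply: (@le_trans _ _ (T * (2 * E * eta + E ^+ 2 * K * (e2 * tau)) +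
   e2 * (12 * tau * (27 * K ^+ 3 + T * (E ^+ 2 * K))))).
  rewrite lerD2r ler_wpM2r ?(addr_ge0, mulr_ge0)//.
  by rewrite (le_trans _ T_ge)// ler_wpM2l.
rewrite -subr_ge0 /D1 /D0 /err_const -/E.
rewrite (_ : _ - _ = 2 * T * E * (e2 * tau) + (T * (E ^+ 2 * K) +
  12 * (27 * K ^+ 3 + T * (E ^+ 2 * K))) * eta); last by ring.
by rewrite !(addr_ge0, mulr_ge0)// exprn_ge0.
Qed.

End Convergence.

(** * Integration of complex-valued functions *)

Section ComplexIntegration.
Context {R : realType}.
Implicit Types (D : set R) (f g : R -> R[i]).
Let mu := @lebesgue_measure R.
Local Notation borel D := (measurable (D : set (measurableTypeR R))).

Lemma ae_mono (P Q : R -> Prop) : {ae mu, forall x, P x} ->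
  (forall x, P x -> Q x) -> {ae mu, forall x, Q x}.
Proof. by move=> h PQ; apply: (@filterS _ _ (ae_filter_ringOfSetsType mu) _ _ PQ h). Qed.

Definition cmeas D f : Prop :=
  measurable_fun D (fun x => complex.Re (f x)) /\
  measurable_fun D (fun x => complex.Im (f x)).

Definition cintegrable D f : Prop :=
  mu.-integrable D (EFin \o (fun x => complex.Re (f x))) /\
  mu.-integrable D (EFin \o (fun x => complex.Im (f x))).

Lemma cmeasD D f g : cmeas D f -> cmeas D g -> cmeas D (fun x => f x + g x).
Proof.
move=> [f1 f2] [g1 g2]; split.
  by under eq_fun do rewrite RecD; exact: measurable_funD.
by under eq_fun do rewrite ImcD; exact: measurable_funD.
Qed.

Lemma cmeasM D f g : cmeas D f -> cmeas D g -> cmeas D (fun x => f x * g x).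
Proof.
move=> [f1 f2] [g1 g2]; split.
  under eq_fun do rewrite RecM.
  by apply: measurable_funB;
    exact: measurable_funM.
under eq_fun do rewrite ImcM.
by apply: measurable_funD;
  exact: measurable_funM.
Qed.

Lemma cmeas_cst D (c : R[i]) : cmeas D (fun=> c).
Proof. by split; exact: measurable_cst. Qed.

Lemma RecJ (z : R[i]) : complex.Re (conjc z) = complex.Re z.
Proof. by case: z. Qed.
Lemma ImcJ (z : R[i]) : complex.Im (conjc z) = - complex.Im z.
Proof. by case: z. Qed.

Lemma cmeasJ D f : cmeas D f -> cmeas D (fun x => conjc (f x)).
Proof.
move=> [f1 f2]; split; first by under eq_fun do rewrite RecJ.
by under eq_fun do rewrite ImcJ; exact: measurable_funN.
Qed.

Lemma cmeasN D f : cmeas D f -> cmeas D (fun x => - f x).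
Proof.
move=> [f1 f2]; split.
  by under eq_fun do rewrite RecN; exact: measurable_funN.
by under eq_fun do rewrite ImcN; exact: measurable_funN.
Qed.

Lemma cmeas_sum D (I : Type) (s : seq I) (F : I -> R -> R[i]) :
  (forall i, cmeas D (F i)) -> cmeas D (fun x => \sum_(i <- s) F i x).
Proof.
move=> h; elim: s => [|i s IH].
  by under [fun x => _]eq_fun do rewrite big_nil; exact: cmeas_cst.
by under [fun x => _]eq_fun do rewrite big_cons; exact: cmeasD.
Qed.

Lemma cmeas_lim D (F : nat -> R -> R[i]) f :
  (forall n, cmeas D (F n)) -> (forall x, D x -> ccvg (F^~ x) (f x)) -> cmeas D f.
Proof.
move=> hF hl; split.
  apply: (@measurable_fun_cvg _ _ _ _
    (fun n x => complex.Re (F n x))) => [n|x /hl]; first by have [] := hF n.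
  exact: ccvg_Re.
apply: (@measurable_fun_cvg _ _ _ _
    (fun n x => complex.Im (F n x))) => [n|x /hl]; first by have [] := hF n.
exact: ccvg_Im.
Qed.

Lemma cmeas_cis D (h : R -> R) : measurable_fun D h -> cmeas D (fun x => cis (h x)).
Proof.
move=> mh; split.
  under eq_fun do rewrite cisE/=.
  apply: (measurableT_comp _ mh); exact: continuous_measurable_fun (@continuous_cos R).
under eq_fun do rewrite cisE/=.
apply: (measurableT_comp _ mh); exact: continuous_measurable_fun (@continuous_sin R).
Qed.

Lemma cintegrable_meas D f : cintegrable D f -> cmeas D f.
Proof.
move=> [/integrableP[m1 _] /integrableP[m2 _]].
by split; apply/measurable_EFinP.
Qed.

Lemma cintegrable_dom D f (g : R -> R) : borel D -> cmeas D f ->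
  mu.-integrable D (EFin \o g) -> (forall x, D x -> cmod (f x) <= g x) ->
  cintegrable D f.
Proof.
move=> mD [m1 m2] ig h; split.
  refine (@le_integrable _ _ _ mu D mD (EFin \o (fun x => complex.Re (f x))) (EFin \o g) _ _ ig).
    exact/measurable_EFinP.
  move=> x /h hx /=; rewrite lee_fin (le_trans (Re_le_cmod _))//.
  by rewrite (le_trans hx)// ler_norm.
refine (@le_integrable _ _ _ mu D mD (EFin \o (fun x => complex.Im (f x))) (EFin \o g) _ _ ig).
  exact/measurable_EFinP.
move=> x /h hx /=; rewrite lee_fin (le_trans (Im_le_cmod _))//.
by rewrite (le_trans hx)// ler_norm.
Qed.

Lemma integrable_cst_fin D (M : R) : borel D -> (mu D < +oo)%E ->
  mu.-integrable D (EFin \o (fun=> M)).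
Proof.
move=> mD fD; apply: measurable_bounded_integrable => //.
by exists `|M|; split; rewrite ?num_real// => z hz x _ /=; exact: ltW.
Qed.

Lemma cintegrable_bounded D f M : borel D -> (mu D < +oo)%E -> cmeas D f ->
  (forall x, D x -> cmod (f x) <= M) -> cintegrable D f.
Proof.
by move=> mD fD mf h; apply: (@cintegrable_dom _ _ (fun=> M)) => //;
  exact: integrable_cst_fin.
Qed.

Lemma cintegrableD D f g : borel D -> cintegrable D f -> cintegrable D g ->
  cintegrable D (fun x => f x + g x).
Proof.
move=> mD [f1 f2] [g1 g2]; split.
  under eq_fun do rewrite RecD.
  exact: (integrableD mD f1 g1).
under eq_fun do rewrite ImcD.
exact: (integrableD mD f2 g2).
Qed.

Lemma integrable_norm_cmod D f : borel D -> cintegrable D f ->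
  mu.-integrable D (EFin \o (fun x => `|complex.Re (f x)| + `|complex.Im (f x)|)).
Proof.
by move=> mD [f1 f2]; exact: (integrableD mD (integrable_norm f1) (integrable_norm f2)).
Qed.

Lemma cintegrableM_bounded D f g M : borel D -> cintegrable D f ->
  cmeas D g -> (forall x, D x -> cmod (g x) <= M) ->
  cintegrable D (fun x => f x * g x).
Proof.
move=> mD hf mg hg.
apply: (@cintegrable_dom _ _ (fun x => M * (`|complex.Re (f x)| + `|complex.Im (f x)|))).
- by [].
- exact: cmeasM (cintegrable_meas hf) mg.
- exact: (integrableZl mD M (integrable_norm_cmod mD hf)).
move=> x Dx; rewrite cmodM mulrC ler_pM ?cmod_ge0 ?hg//.
exact: cmod_le_ReIm.
Qed.

Lemma cintegrableZ D f (c : R[i]) : borel D -> cintegrable D f ->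
  cintegrable D (fun x => c * f x).
Proof.
move=> mD hf; under eq_fun do rewrite mulrC.
by apply: (@cintegrableM_bounded _ _ _ (cmod c)) => //; exact: cmeas_cst.
Qed.

Lemma cintegrable_sum D (I : Type) (s : seq I) (F : I -> R -> R[i]) :
  borel D -> (forall i, cintegrable D (F i)) ->
  cintegrable D (fun x => \sum_(i <- s) F i x).
Proof.
move=> mD h; elim: s => [|i s IH].
  under [fun x => _]eq_fun do rewrite big_nil.
  by split; exact: integrable0.
by under [fun x => _]eq_fun do rewrite big_cons; exact: cintegrableD.
Qed.

Lemma cintegralD D f g : borel D -> cintegrable D f -> cintegrable D g ->
  cintegral D (fun x => f x + g x) = cintegral D f + cintegral D g.
Proof.
move=> mD [f1 f2] [g1 g2]; apply: complex_ext => /=.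
  under eq_Rintegral do rewrite RecD.
  exact: RintegralD.
under eq_Rintegral do rewrite ImcD.
exact: RintegralD.
Qed.

Lemma cintegralZ D f (c : R[i]) : borel D -> cintegrable D f ->
  cintegral D (fun x => c * f x) = c * cintegral D f.
Proof.
move=> mD [f1 f2]; apply: complex_ext.
  rewrite RecM /=; under eq_Rintegral do rewrite RecM.
  rewrite RintegralB//; last 2 first.
  - exact: (integrableZl mD _ f1).
  - exact: (integrableZl mD _ f2).
  by rewrite !RintegralZl.
rewrite ImcM /=; under eq_Rintegral do rewrite ImcM.
rewrite RintegralD//; last 2 first.
- exact: (integrableZl mD _ f2).
- exact: (integrableZl mD _ f1).
by rewrite !RintegralZl.
Qed.

Lemma cintegral_sum D (I : Type) (s : seq I) (F : I -> R -> R[i]) :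
  borel D -> (forall i, cintegrable D (F i)) ->
  cintegral D (fun x => \sum_(i <- s) F i x) = \sum_(i <- s) cintegral D (F i).
Proof.
move=> mD h; elim: s => [|i s IH].
  rewrite big_nil; under [fun x => _]eq_fun do rewrite big_nil.
  by apply: complex_ext => /=; rewrite Rintegral_cst// mul0r.
rewrite big_cons -IH; under [fun x => _]eq_fun do rewrite big_cons.
by apply: cintegralD => //; exact: cintegrable_sum.
Qed.

Lemma eq_cintegral D f g : (forall x, D x -> f x = g x) ->
  cintegral D f = cintegral D g.
Proof.
move=> h; apply: complex_ext => /=; apply: eq_Rintegral => x; rewrite inE => Dx.
  by rewrite h.
by rewrite h.
Qed.

Lemma cintegral_ae D f g : borel D -> cmeas D f -> cmeas D g ->
  {ae mu, forall x, D x -> f x = g x} -> cintegral D f = cintegral D g.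
Proof.
move=> mD [f1 f2] [g1 g2] h; apply: complex_ext => /=; congr fine.
  apply: ae_eq_integral => //; try exact/measurable_EFinP.
  by apply: (ae_mono h) => x hx /hx ->.
apply: ae_eq_integral => //; try exact/measurable_EFinP.
by apply: (ae_mono h) => x hx /hx ->.
Qed.

Lemma cmod_cintegral_le D f M : borel D -> (mu D < +oo)%E -> cmeas D f ->
  (forall x, D x -> cmod (f x) <= M) ->
  cmod (cintegral D f) <= 2 * (M * fine (mu D)).
Proof.
move=> mD fD mf h; have [f1 f2] := cintegrable_bounded mD fD mf h.
rewrite (le_trans (cmod_le_ReIm _))//= mulr_natl mulr2n lerD//.
  apply: (le_trans (le_normr_Rintegral mD f1)); rewrite -Rintegral_cst//.
  apply: le_Rintegral => //; first exact: (integrable_norm f1).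
    exact: integrable_cst_fin.
  by move=> x /h; apply: le_trans; exact: Re_le_cmod.
apply: (le_trans (le_normr_Rintegral mD f2)); rewrite -Rintegral_cst//.
apply: le_Rintegral => //; first exact: (integrable_norm f2).
  exact: integrable_cst_fin.
by move=> x /h; apply: le_trans; exact: Im_le_cmod.
Qed.

Lemma cvg_Rintegral D (F : nat -> R -> R) (f g : R -> R) : borel D ->
  (forall n, measurable_fun D (F n)) -> measurable_fun D f ->
  {ae mu, forall x, D x -> F ^~ x @ \oo --> f x} ->
  mu.-integrable D (EFin \o g) ->
  (forall n x, D x -> `|F n x| <= g x) ->
  mu.-integrable D (EFin \o f) /\
  (fun n => Rintegral mu D (F n)) @ \oo --> Rintegral mu D f.
Proof.
move=> mD mF mf hl ig hg.
have [||||i1 _ h] := @dominated_convergence _ _ _ mu D mD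
    (fun n x => (F n x)%:E) (fun x => (f x)%:E) (EFin \o g) _ _ _ ig.
- move=> n; exact: (measurable_EFinP D (F n)).2 (mF n).
- exact: (measurable_EFinP D f).2 mf.
- apply: (ae_mono hl) => x h /h hx; apply: cvg_EFin => //.
  by apply: nearW.
- apply: nearW => x n Dx /=; rewrite lee_fin; exact: hg.
split => //.
have fin := integrable_fin_num mD i1.
by rewrite -(fineK fin) in h; have [_] := (fine_cvgP _ _).1 h.
Qed.

Lemma cdominated D (F : nat -> R -> R[i]) f (g : R -> R) : borel D ->
  (forall n, cmeas D (F n)) -> cmeas D f ->
  {ae mu, forall x, D x -> ccvg (F ^~ x) (f x)} ->
  mu.-integrable D (EFin \o g) ->
  (forall n x, D x -> cmod (F n x) <= g x) ->
  cintegrable D f /\ ccvg (fun n => cintegral D (F n)) (cintegral D f).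
Proof.
move=> mD mF [m1 m2] hl ig hg.
have [|||i1 l1] := @cvg_Rintegral D (fun n x => complex.Re (F n x))
   (fun x => complex.Re (f x)) g mD _ m1 _ ig.
- by move=> n; have [] := mF n.
- by apply: (ae_mono hl) => x h /h /ccvg_Re.
- by move=> n x Dx; rewrite (le_trans (Re_le_cmod _))// hg.
have [|||i2 l2] := @cvg_Rintegral D (fun n x => complex.Im (F n x))
   (fun x => complex.Im (f x)) g mD _ m2 _ ig.
- by move=> n; have [] := mF n.
- by apply: (ae_mono hl) => x h /h /ccvg_Im.
- by move=> n x Dx; rewrite (le_trans (Im_le_cmod _))// hg.
split; first by split.
by apply: ccvg_ReIm.
Qed.

End ComplexIntegration.

(** * Fourier coefficients and Fourier series *)

Section FourierSeries.
Context {R : realType}.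
Implicit Types (f g : R -> R[i]) (c : int -> R[i]).
Let mu := @lebesgue_measure R.

Lemma measurable_torus : measurable (torus R : set (measurableTypeR R)).
Proof. exact: measurable_itv. Qed.

Lemma pi2_gt0 : 0 < 2 * pi :> R.
Proof. by rewrite mulr_gt0// pi_gt0. Qed.

Lemma mu_itvoo (a b : R) : a <= b -> mu `]a, b[%classic = (b - a)%:E.
Proof.
move=> ab; rewrite /mu lebesgue_measure_itv/= lte_fin.
by case: ltP => // ba; rewrite (le_anti (introT andP (conj ab ba))) subrr.
Qed.

Lemma mu_torus : mu (torus R) = (2 * pi)%:E.
Proof.
rewrite /torus mu_itvoo; last by have := pi_gt0 R; lra.
by congr EFin; ring.
Qed.

Lemma mu_torus_fin : (mu (torus R) < +oo)%E.
Proof. by rewrite mu_torus ltry. Qed.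

Lemma Rintegral_FTC (f F : R -> R) (a b : R) : a < b ->
  (forall x : R, is_derive x 1 F (f x)) -> continuous f ->
  mu.-integrable `[a, b]%classic (EFin \o f) ->
  Rintegral mu `[a, b]%classic f = F b - F a.
Proof.
move=> ab dF cf intf.
have dvF x : derivable F x 1 by have [] := dF x.
have cF : continuous F.
  by move=> x; apply: differentiable_continuous; apply/derivable1_diffP.
rewrite /Rintegral (@continuous_FTC2 _ f F a b ab)//.
- by apply: continuous_subspaceT.
- split => [x _| |]; first exact: dvF.
    exact: cvg_at_right_filter (cF a).
  exact: cvg_at_left_filter (cF b).
- by move=> x _; rewrite derive1E; have [_ ->] := dF x.
Qed.

Lemma Rintegral_itvoo_cc (a b : R) (f : R -> R) :
  mu.-integrable `[a, b]%classic (EFin \o f) ->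
  Rintegral mu `]a, b[%classic f = Rintegral mu `[a, b]%classic f.
Proof.
move=> h; rewrite Rintegral_itv_obnd_cbnd; last first.
  apply: (integrableS _ _ _ h) => //.
  by apply: subset_itv_oo_cc.
rewrite Rintegral_itv_bndo_bndc//.
apply: (integrableS _ _ _ h) => //.
by apply: subset_itv_co_cc.
Qed.

Lemma cmeas_exp D (l : int) : measurable (D : set (measurableTypeR R)) ->
  cmeas D (fun x : R => cis (l%:~R * x)).
Proof.
move=> mD; apply: cmeas_cis; apply: measurable_funM => //.
Qed.

Lemma continuous_cis (k : R) :
  continuous (fun x : R => complex.Re (cis (k * x))) /\
  continuous (fun x : R => complex.Im (cis (k * x))).
Proof.
have e : (fun s => cis (k * s)) = (fun s => cis (k * s + 0)).
  by apply: funext => s; rewrite addr0.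
have d (x : R) : is_cderive (fun s => cis (k * s)) x ('i%C * k%:C * cis (k * x + 0)).
  by rewrite e; exact: is_cderive_cis.
split => x; apply: differentiable_continuous; apply/derivable1_diffP.
  by have [[]] := d x.
by have [_ []] := d x.
Qed.

Lemma cis_int_pi (l : int) : cis (l%:~R * pi) = cis (l%:~R * - pi) :> R[i].
Proof.
have h (n : nat) : cis (n%:R * pi) = cis (- (n%:R * pi)) :> R[i].
  elim: n => [|n IH]; first by rewrite mul0r oppr0.
  have e : cis (- pi) = cis pi :> R[i] by rewrite !cisE cosN sinN sinpi oppr0.
  by rewrite -natr1 mulrDl mul1r opprD [LHS]cisD [RHS]cisD IH e.
rewrite mulrN; case: l => n; first exact: h.
by rewrite NegzE rmorphN/= mulNr opprK -[X in X * pi]/(n.+1%:R) -h.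
Qed.

Lemma cintegrable_exp (l : int) (D : set R) :
  measurable (D : set (measurableTypeR R)) -> (mu D < +oo)%E ->
  cintegrable D (fun x : R => cis (l%:~R * x)).
Proof.
move=> mD fD; apply: (@cintegrable_bounded _ _ _ 1) => //; first exact: cmeas_exp.
by move=> x _; rewrite cmod_cis.
Qed.

(** The primitive [phase_int] has the same value at both ends of a period. *)
Lemma cintegral_exp (l : int) :
  cintegral (torus R) (fun x => cis (l%:~R * x)) = if l == 0 then (2 * pi)%:C else 0.
Proof.
have p0 := pi_gt0 R; have ab : - pi < pi :> R by lra.
have [ir ii] : cintegrable `[(- pi), pi]%classic (fun x : R => cis (l%:~R * x)).
  apply: cintegrable_exp; first exact: measurable_itv.
  by rewrite /mu lebesgue_measure_itv/= lte_fin ab ltry.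
have d (x : R) := is_cderive_phase_int (l%:~R : R) x.
have [cr ci] := continuous_cis (l%:~R : R).
have e : cintegral (torus R) (fun x => cis (l%:~R * x)) =
    phase_int l%:~R pi - phase_int l%:~R (- pi).
  apply: complex_ext.
    rewrite RecD RecN -(Rintegral_FTC ab (fun x => (d x).1) cr ir)/=.
    exact: Rintegral_itvoo_cc.
  rewrite ImcD ImcN -(Rintegral_FTC ab (fun x => (d x).2) ci ii)/=.
  exact: Rintegral_itvoo_cc.
rewrite e /phase_int; case: eqP => [->|/eqP l0].
  by rewrite !mulr0 phi1i0 !mulr1 -rmorphB/= opprK mulr2n mulrDl mul1r.
have i0 : 'i%C * l%:~R%:C != 0 :> R[i].
  by rewrite -imagE imag_neq0// intr_eq0.
apply: (mulfI i0); rewrite mulr0 mulrBr !mulrA -!mulrA.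
have h (x : R) : 'i%C * (l%:~R%:C * (x%:C * phi1i (x * l%:~R))) =
    cis (l%:~R * x) - 1.
  by rewrite [l%:~R * x]mulrC cis_phi1i rmorphM/=; ring.
by rewrite !h cis_int_pi subrr.
Qed.

Lemma fpartialE c (x : R) N :
  fpartial c x N = \sum_(l <- zrange N) c l * cis (l%:~R * x).
Proof. by rewrite /fpartial /zrange big_map. Qed.

Lemma fcoefE f l : fcoef f l = ((2 * pi)^-1)%:C *
  cintegral (torus R) (fun x => f x * cis (- (l%:~R * x))).
Proof. by []. Qed.

Lemma cis_opp (l : int) (x : R) : cis (- (l%:~R * x)) = cis ((- l)%:~R * x).
Proof. by rewrite rmorphN/= mulNr. Qed.

Lemma fcoef_exp (k l : int) :
  fcoef (fun x : R => cis (k%:~R * x)) l = (k == l)%:R.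
Proof.
rewrite fcoefE; under eq_cintegral => x _.
  by rewrite cis_opp -cisD -mulrDl -rmorphD/=; over.
rewrite cintegral_exp subr_eq0; case: eqP => _; last by rewrite mulr0.
by rewrite -rmorphM/= mulVf// gt_eqF// pi2_gt0.
Qed.

Lemma cintegrable_fexp f l : cintegrable (torus R) f ->
  cintegrable (torus R) (fun x => f x * cis (- (l%:~R * x))).
Proof.
move=> hf; apply: (@cintegrableM_bounded _ _ _ _ 1) => //.
- exact: measurable_torus.
- under eq_fun do rewrite cis_opp; apply: cmeas_exp; exact: measurable_torus.
- by move=> x _; rewrite cmod_cis.
Qed.

Lemma fcoefD f g l : cintegrable (torus R) f -> cintegrable (torus R) g ->
  fcoef (fun x => f x + g x) l = fcoef f l + fcoef g l.
Proof.
move=> hf hg; rewrite !fcoefE -mulrDr -cintegralD; first last.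
- exact: cintegrable_fexp.
- exact: cintegrable_fexp.
- exact: measurable_torus.
by congr (_ * _); apply: eq_cintegral => x _; rewrite mulrDl.
Qed.

Lemma fcoefZ f (z : R[i]) l : cintegrable (torus R) f ->
  fcoef (fun x => z * f x) l = z * fcoef f l.
Proof.
move=> hf; rewrite !fcoefE mulrCA -[z * cintegral _ _]cintegralZ; first last.
- exact: cintegrable_fexp.
- exact: measurable_torus.
by congr (_ * _); apply: eq_cintegral => x _; rewrite mulrA.
Qed.

Lemma fcoefB f g l : cintegrable (torus R) f -> cintegrable (torus R) g ->
  fcoef (fun x => f x - g x) l = fcoef f l - fcoef g l.
Proof.
move=> hf hg; under eq_fun do rewrite -[- g _]mulN1r.
rewrite fcoefD//; last by apply: cintegrableZ => //; exact: measurable_torus.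
by rewrite fcoefZ// mulN1r.
Qed.

Lemma fcoef_sum (I : Type) (s : seq I) (F : I -> R -> R[i]) l :
  (forall i, cintegrable (torus R) (F i)) ->
  fcoef (fun x => \sum_(i <- s) F i x) l = \sum_(i <- s) fcoef (F i) l.
Proof.
move=> h; rewrite fcoefE -mulr_sumr -cintegral_sum; last 2 first.
- exact: measurable_torus.
- by move=> i; exact: cintegrable_fexp.
by congr (_ * _); apply: eq_cintegral => x _; rewrite mulr_suml.
Qed.

Lemma eq_fcoef f g l : (forall x, torus R x -> f x = g x) -> fcoef f l = fcoef g l.
Proof. by move=> h; congr (_ * _); apply: eq_cintegral => x /h ->. Qed.

Lemma fcoef_ae f g l : cmeas (torus R) f -> cmeas (torus R) g ->
  {ae mu, forall x, torus R x -> f x = g x} -> fcoef f l = fcoef g l.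
Proof.
move=> mf mg h; have me : cmeas (torus R) (fun x : R => cis (- (l%:~R * x))).
  by under eq_fun do rewrite cis_opp; apply: cmeas_exp; exact: measurable_torus.
congr (_ * _); apply: cintegral_ae; [exact: measurable_torus|exact: cmeasM|exact: cmeasM|].
by apply: (ae_mono h) => x hx /hx ->.
Qed.

Lemma cintegrable_fpartial c N : cintegrable (torus R) (fun x => fpartial c x N).
Proof.
under eq_fun do rewrite fpartialE.
apply: cintegrable_sum; first exact: measurable_torus.
move=> l; apply: cintegrableZ; first exact: measurable_torus.
by apply: cintegrable_exp; [exact: measurable_torus|exact: mu_torus_fin].
Qed.

Lemma fcoef_fpartial c N l :
  fcoef (fun x => fpartial c x N) l = if (`|l| <= N)%N then c l else 0.
Proof.
under eq_fun do rewrite fpartialE.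
have ie k : cintegrable (torus R) (fun x : R => cis (k%:~R * x)).
  by apply: cintegrable_exp; [exact: measurable_torus|exact: mu_torus_fin].
rewrite fcoef_sum; last first.
  by move=> k; apply: cintegrableZ => //; exact: measurable_torus.
under eq_bigr do rewrite fcoefZ// fcoef_exp.
rewrite -mem_zrange; case: ifP => hl.
  rewrite (bigD1_seq l) ?zrange_uniq// eqxx mulr1 big1 => [|k /negbTE ->].
    exact: addr0.
  by rewrite mulr0.
rewrite big1_seq// => k /andP[_ kN]; case: eqP => [e|_]; last by rewrite mulr0.
by rewrite -e kN in hl.
Qed.

Definition cbounded f : Prop :=
  cmeas (torus R) f /\ exists M, forall x, torus R x -> cmod (f x) <= M.

Lemma cbounded_integrable f : cbounded f -> cintegrable (torus R) f.
Proof.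
move=> [mf [M h]]; apply: (cintegrable_bounded _ _ mf h).
  exact: measurable_torus.
exact: mu_torus_fin.
Qed.

(** Fourier coefficients pass to bounded pointwise limits. *)
Lemma fcoef_lim (F : nat -> R -> R[i]) g M :
  (forall n, cmeas (torus R) (F n)) ->
  (forall n x, torus R x -> cmod (F n x) <= M) ->
  (forall x, torus R x -> ccvg (F^~ x) (g x)) ->
  forall l, ccvg (fun n => fcoef (F n) l) (fcoef g l).
Proof.
move=> mF hM hl l; have me : cmeas (torus R) (fun x : R => cis (- (l%:~R * x))).
  by under eq_fun do rewrite cis_opp; apply: cmeas_exp; exact: measurable_torus.
have mg := cmeas_lim mF hl.
apply: ccvgZ.
have [] := @cdominated _ (torus R) (fun n x => F n x * cis (- (l%:~R * x)))
   (fun x => g x * cis (- (l%:~R * x))) (fun=> M).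
- exact: measurable_torus.
- by move=> n; exact: cmeasM.
- exact: cmeasM.
- apply: aeW => x Dx; apply: ccvgM; [exact: hl|exact: ccvg_cst].
- by apply: integrable_cst_fin; [exact: measurable_torus|exact: mu_torus_fin].
- by move=> n x Dx; rewrite cmodM cmod_cis mulr1 hM.
- by [].
Qed.

Lemma cbounded_lim (F : nat -> R -> R[i]) g M :
  (forall n, cmeas (torus R) (F n)) ->
  (forall n x, torus R x -> cmod (F n x) <= M) ->
  (forall x, torus R x -> ccvg (F^~ x) (g x)) -> cbounded g.
Proof.
move=> mF hM hl; split; first exact: cmeas_lim hl.
exists M => x Dx; apply: (cvgr_to_le (ccvg_cmod (hl x Dx))).
by apply: nearW => n; exact: hM.
Qed.

Lemma fcoef_fpartial_lim c g M :
  (forall N x, torus R x -> cmod (fpartial c x N) <= M) ->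
  (forall x, torus R x -> ccvg (fpartial c x) (g x)) ->
  forall l, fcoef g l = c l.
Proof.
move=> hM hl l.
have h := @fcoef_lim (fun N x => fpartial c x N) g M
  (fun N => cintegrable_meas (cintegrable_fpartial c N)) hM hl l.
apply: (ccvg_unique h); apply: ccvg_eventually (ccvg_cst (c l)).
by exists `|l|%N => N hN; rewrite fcoef_fpartial hN.
Qed.

Lemma zrange_sum_cvg (a : int -> R) (B : R) : (forall N, \sum_(l <- zrange N) `|a l| <= B) ->
  exists s : R, (fun N => \sum_(l <- zrange N) a l) @ \oo --> s.
Proof.
move=> hB.
have mono (b : int -> R) : (forall l, 0 <= b l) -> (forall N, \sum_(l <- zrange N) b l <= 2 * B) ->
    exists s : R, (fun N => \sum_(l <- zrange N) b l) @ \oo --> s.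
  move=> b0 hb; exists (limn (fun N => \sum_(l <- zrange N) b l)).
  apply: nondecreasing_is_cvgn.
    move=> n m nm; apply: sum_sub_seq => // [|l]; first exact: zrange_uniq.
    by rewrite !mem_zrange => /leq_trans; apply.
  by exists (2 * B) => _ [N _ <-].
have [|N|s1 h1] := mono (fun l => `|a l|) => //.
  have := hB N; have : 0 <= \sum_(l <- zrange N) `|a l| by apply: sumr_ge0.
  lra.
have [l|N|s2 h2] := mono (fun l => a l + `|a l|).
- by have := ler_norm (- a l); rewrite normrN; lra.
- rewrite big_split/=; have := hB N.
  have : \sum_(l <- zrange N) a l <= \sum_(l <- zrange N) `|a l|.
    by apply: ler_sum => l _; exact: ler_norm.
  lra.
exists (s2 - s1).
rewrite (_ : (fun N => _) = (fun N => \sum_(l <- zrange N) (a l + `|a l|) -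
  \sum_(l <- zrange N) `|a l|)); first exact: cvgB h2 h1.
by apply: funext => N /=; rewrite big_split/= addrK.
Qed.

Lemma l1_zrange_cvg (c : int -> R[i]) B : l1_le (fun l => cmod (c l)) B ->
  exists s, ccvg (fun N => \sum_(l <- zrange N) c l) s.
Proof.
move=> [_ hB].
have [N|r hr] := @zrange_sum_cvg (fun l => complex.Re (c l)) B.
  by apply: le_trans (hB N); apply: ler_sum => l _; exact: Re_le_cmod.
have [N|i hi] := @zrange_sum_cvg (fun l => complex.Im (c l)) B.
  by apply: le_trans (hB N); apply: ler_sum => l _; exact: Im_le_cmod.
exists (r +i* i); apply: ccvg_ReIm.
  by under eq_fun do rewrite Rec_sum.
by under eq_fun do rewrite Imc_sum.
Qed.

Lemma fseries_eq c (x : R) s : ccvg (fpartial c x) s -> fseries c x = s.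
Proof.
move=> h; apply: complex_ext => /=; apply: cvg_lim => //.
  exact: ccvg_Re.
exact: ccvg_Im.
Qed.

Section summable.
Variables (c : int -> R[i]) (B : R).
Hypothesis cB : l1_le (fun l => cmod (c l)) B.

Lemma cmod_fpartial_le (x : R) N : cmod (fpartial c x N) <= B.
Proof.
rewrite fpartialE (le_trans (cmod_sum _ _ _))//; apply: le_trans (cB.2 N).
by apply: ler_sum => l _; rewrite cmodM cmod_cis mulr1.
Qed.

Lemma fseries_cvg (x : R) : ccvg (fpartial c x) (fseries c x).
Proof.
have [|s h] := @l1_zrange_cvg (fun l => c l * cis (l%:~R * x)) B.
  rewrite (_ : (fun l => _) = (fun l => cmod (c l)))//.
  by apply: funext => l; rewrite cmodM cmod_cis mulr1.
have h' : ccvg (fpartial c x) s.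
  by apply: ccvg_ext h => N; rewrite fpartialE.
by rewrite (fseries_eq h').
Qed.

Lemma fcoef_fseries l : fcoef (fseries c) l = c l.
Proof.
apply: (@fcoef_fpartial_lim _ _ B) => [N x _|x _]; first exact: cmod_fpartial_le.
exact: fseries_cvg.
Qed.

Lemma cbounded_fseries : cbounded (fseries c).
Proof.
apply: (@cbounded_lim (fun N x => fpartial c x N) _ B) => [n|n x _|x _].
- exact: cintegrable_meas (cintegrable_fpartial c n).
- exact: cmod_fpartial_le.
- exact: fseries_cvg.
Qed.

End summable.

Lemma cboundedD f g : cbounded f -> cbounded g -> cbounded (fun x => f x + g x).
Proof.
move=> [mf [M hM]] [mg [N hN]]; split; first exact: cmeasD.
by exists (M + N) => x Dx; rewrite (le_trans (cmodD _ _))// lerD ?hM ?hN.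
Qed.

Lemma cboundedM f g : cbounded f -> cbounded g -> cbounded (fun x => f x * g x).
Proof.
move=> [mf [M hM]] [mg [N hN]]; split; first exact: cmeasM.
by exists (M * N) => x Dx; rewrite cmodM ler_pM ?cmod_ge0 ?hM ?hN.
Qed.

Lemma cboundedJ f : cbounded f -> cbounded (fun x => conjc (f x)).
Proof.
move=> [mf [M hM]]; split; first exact: cmeasJ.
by exists M => x Dx; rewrite cmodJ hM.
Qed.

Lemma cbounded_cst (z : R[i]) : cbounded (fun=> z).
Proof. by split; [exact: cmeas_cst|exists (cmod z)]. Qed.

Lemma square_integrable_integrable f : square_integrable f -> cintegrable (torus R) f.
Proof.
move=> [m1 m2 hi].
have i1 := integrable_cst_fin 1 measurable_torus mu_torus_fin.
apply: (@cintegrable_dom _ _ _ (fun x => 1 + (complex.Re (f x) ^+ 2 + complex.Im (f x) ^+ 2))).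
- exact: measurable_torus.
- by [].
- exact: (integrableD measurable_torus i1 hi).
move=> x _; rewrite -sqr_cmod; have := sqr_ge0 (cmod (f x) - 1).
have := cmod_ge0 (f x); nra.
Qed.

Lemma square_integrable_dom f (g : R -> R) : cmeas (torus R) f ->
  mu.-integrable (torus R) (EFin \o g) ->
  (forall x, torus R x -> cmod (f x) ^+ 2 <= g x) -> square_integrable f.
Proof.
move=> [m1 m2] ig h; split => //.
refine (@le_integrable _ _ _ mu (torus R) measurable_torus
  (EFin \o (fun x => complex.Re (f x) ^+ 2 + complex.Im (f x) ^+ 2)) (EFin \o g) _ _ ig).
  apply/measurable_EFinP.
  by apply: measurable_funD; apply: measurable_funX.
move=> x /h hx /=; rewrite lee_fin -sqr_cmod ger0_norm ?sqr_ge0//.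
by rewrite (le_trans hx)// ler_norm.
Qed.

Lemma cbounded_square_integrable f : cbounded f -> square_integrable f.
Proof.
move=> [mf [M h]]; apply: (@square_integrable_dom _ (fun=> M ^+ 2)) => //.
  exact: integrable_cst_fin measurable_torus mu_torus_fin.
move=> x /h hx; rewrite ler_pXn2r// ?nnegrE ?cmod_ge0//.
exact: le_trans (cmod_ge0 _) hx.
Qed.

Lemma square_integrableB f g : square_integrable f -> square_integrable g ->
  square_integrable (fun x => f x - g x).
Proof.
move=> [f1 f2 fi] [g1 g2 gi].
pose sq (h : R -> R[i]) x := complex.Re (h x) ^+ 2 + complex.Im (h x) ^+ 2.
apply: (@square_integrable_dom _ (fun x => 2 * (sq f x + sq g x))).
- under eq_fun do rewrite -[- g _]mulN1r.
  by apply: cmeasD => //; apply: cmeasM => //; exact: cmeas_cst.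
- exact: (integrableZl measurable_torus 2 (integrableD measurable_torus fi gi)).
move=> x _; rewrite /sq -!sqr_cmod; have := cmodB (f x) (g x).
have := cmod_ge0 (f x); have := cmod_ge0 (g x); have := cmod_ge0 (f x - g x).
have := sqr_ge0 (cmod (f x) - cmod (g x)).
nra.
Qed.

End FourierSeries.

(** * Uniqueness of Fourier coefficients *)

Section Uniqueness.
Context {R : realType}.
Let mu := @lebesgue_measure R.
Let tor := torus R.

(** The class of trigonometric polynomials, closed under products since the
   frequencies add. *)
Inductive trigpoly : (R -> R[i]) -> Prop :=
| trig_exp (c : R[i]) (l : int) : trigpoly (fun x => c * cis (l%:~R * x))
| trig_add P Q : trigpoly P -> trigpoly Q -> trigpoly (fun x => P x + Q x).

Lemma trig_mul P Q : trigpoly P -> trigpoly Q -> trigpoly (fun x => P x * Q x).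
Proof.
move=> hP; elim: hP Q => [c l|P1 P2 _ IH1 _ IH2] Q hQ; last first.
  by under eq_fun do rewrite mulrDl; apply: trig_add; [exact: IH1|exact: IH2].
elim: hQ => [d k|Q1 Q2 _ h1 _ h2].
  under eq_fun do rewrite mulrACA -cisD -mulrDl -rmorphD/=.
  exact: trig_exp.
by under eq_fun do rewrite mulrDr; apply: trig_add.
Qed.

Lemma trig_cst (c : R[i]) : trigpoly (fun=> c).
Proof.
have := trig_exp c 0; rewrite (_ : (fun x => _) = fun=> c)//.
by apply: funext => x; rewrite mul0r cis0 mulr1.
Qed.

Lemma trig_exprn P n : trigpoly P -> trigpoly (fun x => P x ^+ n).
Proof.
move=> hP; elim: n => [|n IH]; first by under eq_fun do rewrite expr0; exact: trig_cst.
by under eq_fun do rewrite exprS; exact: trig_mul.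
Qed.

Lemma trig_cos (a : R) : trigpoly (fun x => (cos (x - a))%:C).
Proof.
rewrite (_ : (fun x => _) = fun x => 2^-1 * cis (- a) * cis (1%:~R * x) +
    2^-1 * cis a * cis ((-1)%:~R * x)); last first.
  apply: funext => x; have -> : (-1)%:~R * x = - x by rewrite mulrNz mulN1r.
  have -> : 2^-1 * cis (- a) * cis (1%:~R * x) + 2^-1 * cis a * cis (- x) =
      2^-1 * (cis (x - a) + cis (- (x - a))).
    by rewrite mul1r opprB !cisD; ring.
  have -> : cis (x - a) + cis (- (x - a)) = 2 * (cos (x - a))%:C.
    by rewrite !cisE cosN sinN; apply: complex_ext => /=; ring.
  by rewrite mulKf// pnatr_eq0.
by apply: trig_add; exact: trig_exp.
Qed.

Lemma trig_cbounded P : trigpoly P -> cbounded P.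
Proof.
elim=> [c l|P1 P2 _ h1 _ h2]; last exact: cboundedD.
apply: cboundedM; first exact: cbounded_cst.
split; first exact: cmeas_exp measurable_torus.
by exists 1 => x _; rewrite cmod_cis.
Qed.

Lemma trig_orth f P : cintegrable tor f -> (forall l, fcoef f l = 0) ->
  trigpoly P -> cintegral tor (fun x => f x * P x) = 0.
Proof.
move=> hf h0; elim=> [c l|P1 P2 t1 h1 t2 h2].
  have := h0 (- l); rewrite fcoefE => /eqP; rewrite mulf_eq0 => /orP[|/eqP e].
    by rewrite eq_complex/= eqxx andbT invr_eq0 gt_eqF// pi2_gt0.
  transitivity (c * cintegral tor (fun x => f x * cis (- ((- l)%:~R * x)))).
    rewrite -cintegralZ; [|exact: measurable_torus|exact: cintegrable_fexp].
    apply: eq_cintegral => x _; rewrite cis_opp opprK; ring.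
  by rewrite e mulr0.
under eq_cintegral do rewrite mulrDr.
have [m1 [M1 b1]] := trig_cbounded t1; have [m2 [M2 b2]] := trig_cbounded t2.
rewrite cintegralD ?h1 ?h2 ?addr0//; first exact: measurable_torus.
  exact: (cintegrableM_bounded measurable_torus hf m1 b1).
exact: (cintegrableM_bounded measurable_torus hf m2 b2).
Qed.

Lemma bernoulli_ineq (x : R) n : 0 <= 1 + x -> 1 + n%:R * x <= (1 + x) ^+ n.
Proof.
move=> x1; elim: n => [|n IH]; first by rewrite mul0r addr0 expr0.
rewrite exprS; apply: (le_trans _ (ler_wpM2l x1 IH)).
rewrite -natr1; have := mulr_ge0 (ler0n R n) (sqr_ge0 x); nra.
Qed.

(** Polynomials on [0,1], bounded by 1, that converge to 1 on [0,1/2[ and to 0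
   on ]1/2,1]. *)
Definition bump (n : nat) (s : R) : R := (1 - s ^+ n) ^+ (2 ^ n)%N.

Lemma bump01 n s : 0 <= s <= 1 -> 0 <= bump n s <= 1.
Proof.
move=> /andP[s0 s1]; have a0 : 0 <= s ^+ n by rewrite exprn_ge0.
have a1 : s ^+ n <= 1 by rewrite exprn_ile1.
by rewrite exprn_ge0 ?exprn_ile1//=; lra.
Qed.

(** Bernoulli's inequality gives 1 - (2s)^n as a lower bound. *)
Lemma bump_lo s : 0 <= s < 1 / 2 -> (fun n => bump n s) @ \oo --> (1 : R).
Proof.
move=> /andP[s0 s1].
have z1 : `|2 * s| < 1 by rewrite ger0_norm; lra.
have h : (fun n => 1 - (2 * s) ^+ n) @ \oo --> (1 : R).
  rewrite -[X in _ --> X]subr0; apply: cvgB; first exact: cvg_cst.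
  exact: cvg_expr.
apply: (squeeze_cvgr _ h (cvg_cst (1 : R))); apply: nearW => n /=.
have s01 : 0 <= s <= 1 by lra.
have /andP[_ ->] := bump01 n s01; rewrite andbT.
have a1 : s ^+ n <= 1 by rewrite exprn_ile1//; lra.
have := @bernoulli_ineq (- s ^+ n) (2 ^ n)%N.
rewrite subr_ge0 => /(_ a1); apply: le_trans.
by rewrite mulrN natrX exprMn.
Qed.

(** Since (1 - x)^N (1 + x)^N <= 1, Bernoulli's inequality for (1 + x)^N gives
   the upper bound (2s)^(-n). *)
Lemma bump_hi s : 1 / 2 < s <= 1 -> (fun n => bump n s) @ \oo --> (0 : R).
Proof.
move=> /andP[s0 s1].
have d0 : 0 < 2 * s by lra.
have z1 : `|(2 * s)^-1| < 1.
  by rewrite ger0_norm ?invr_ge0 ?(ltW d0)// invf_lt1//; lra.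
apply: (squeeze_cvgr _ (cvg_cst (0 : R)) (cvg_expr z1)); apply: nearW => n /=.
have s01 : 0 <= s <= 1 by lra.
have /andP[b0 _] := bump01 n s01; rewrite b0/= exprVn.
rewrite -[leRHS]mul1r ler_pdivlMr ?exprn_gt0//.
set N := (2 ^ n)%N; have a0 : 0 <= s ^+ n by rewrite exprn_ge0//; lra.
have a1 : s ^+ n <= 1 by rewrite exprn_ile1//; lra.
have hb : (2 * s) ^+ n <= (1 + s ^+ n) ^+ N.
  have := @bernoulli_ineq (s ^+ n) N; rewrite addr_ge0// => /(_ isT).
  by rewrite natrX -exprMn; apply: le_trans; rewrite lerDr.
apply: (le_trans (ler_wpM2l b0 hb)).
rewrite /bump -exprMn exprn_ile1//; nra.
Qed.

Lemma cos_gt_cos (x d : R) : d <= pi -> `|x| < d -> cos d < cos x.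
Proof.
move=> dpi xd; rewrite -(cos_norm x) ltr_cos// in_itv/=.
  by rewrite normr_ge0/=; lra.
by apply/andP; split; [apply: (le_trans (normr_ge0 x)); exact: ltW|].
Qed.

Lemma cos_lt_cos (x d : R) : 0 <= d <= pi -> d < x < 2 * pi - d -> cos x < cos d.
Proof.
move=> /andP[d0 dpi] /andP[dx xd]; have [xpi|xpi] := leP x pi.
  by rewrite ltr_cos// in_itv/=; apply/andP; split; lra.
have -> : cos x = cos (2 * pi - x).
  by rewrite (_ : 2 * pi - x = - x + pi *+ 2) ?cosD2pi ?cosN//; ring.
by rewrite ltr_cos// ?in_itv/=; [lra|apply/andP; split; lra|apply/andP; split; lra].
Qed.

Lemma measurable_below (h : R -> R) (y : R) : measurable_fun tor h ->
  measurable_fun tor (fun x => if x <= y then h x else 0).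
Proof.
move=> mh.
have my : measurable_fun tor (fun x : R => x <= y).
  by apply: measurable_fun_ler => //; exact: measurable_id.
apply: (measurable_fun_if measurable_torus my).
  by apply: (measurable_funS measurable_torus _ mh) => x [].
exact: measurable_cst.
Qed.

(** Since x lies on the arc ]-pi,y[ exactly when the cosine of its distance to
   the midpoint exceeds that of the half-length, polynomials in that cosine
   approximate the indicator of the arc. *)
Lemma integral_below_eq0 f (y : R) : cintegrable tor f ->
  (forall l, fcoef f l = 0) -> - pi < y < pi ->
  cintegral tor (fun x => if x <= y then f x else 0) = 0.
Proof.
move=> hf h0 /andP[y0 y1]; have p0 := pi_gt0 R.
(* The midpoint and the half-length of the arc; s < 1/2 exactly inside it. *)
pose a := (y - pi) / 2; pose d := (y + pi) / 2.
pose s x := 1 / 2 - (cos (x - a) - cos d) / 4.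
have s01 x : 0 <= s x <= 1.
  have := cos_geN1 (x - a); have := cos_le1 (x - a).
  by have := cos_geN1 d; have := cos_le1 d; rewrite /s; lra.
have ts : trigpoly (fun x => (s x)%:C).
  rewrite (_ : (fun x => _) = fun x => (1 / 2 + cos d / 4)%:C +
      (- 4^-1)%:C * (cos (x - a))%:C); last first.
    by apply: funext => x; rewrite /s -rmorphM/= -rmorphD/=; congr _%:C; field.
  by apply: trig_add; [exact: trig_cst|apply: trig_mul; [exact: trig_cst|exact: trig_cos]].
have tb n : trigpoly (fun x => (bump n (s x))%:C).
  rewrite (_ : (fun x => _) = fun x => (1 + (-1) * (s x)%:C ^+ n) ^+ (2 ^ n)); last first.
    by apply: funext => x; rewrite /bump rmorphXn/= rmorphB/= rmorphXn/= rmorph1 mulN1r.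
  apply: trig_exprn; apply: trig_add; first exact: trig_cst.
  by apply: trig_mul; [exact: trig_cst|exact: trig_exprn].
have lim x : tor x -> x != y -> ccvg (fun n => f x * (bump n (s x))%:C)
    (if x <= y then f x else 0).
  rewrite /tor /torus/= in_itv/= => /andP[x0 x1] xy.
  have cR (u : nat -> R) (v : R) : u @ \oo --> v -> ccvg (fun n => (u n)%:C) v%:C.
    move=> h; apply: ccvg_ReIm => //=; exact: cvg_cst.
  have [lexy|ltyx] := leP x y.
    have ltxy : x < y by rewrite lt_neqAle xy.
    rewrite -[X in ccvg _ X]mulr1; apply: ccvgM; first exact: ccvg_cst.
    rewrite -[X in ccvg _ X](rmorph1 (real_complex R)).
    apply: cR; apply: bump_lo; have /andP[-> _] := s01 x.
    have : cos d < cos (x - a).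
      apply: cos_gt_cos; first by rewrite /d; lra.
      by rewrite ltr_norml /a /d; apply/andP; split; lra.
    by rewrite /s/=; lra.
  rewrite -[X in ccvg _ X](mulr0 (f x)); apply: ccvgM; first exact: ccvg_cst.
  rewrite -[X in ccvg _ X](rmorph0 (real_complex R)).
  apply: cR; apply: bump_hi; have /andP[_ ->] := s01 x; rewrite andbT.
  have : cos (x - a) < cos d.
    by apply: cos_lt_cos; rewrite /a /d; apply/andP; split; lra.
  by rewrite /s; lra.
have mf := cintegrable_meas hf.
have mt n : cmeas tor (fun x => (bump n (s x))%:C) := (trig_cbounded (tb n)).1.
have mg : cmeas tor (fun x => if x <= y then f x else 0).
  have [m1 m2] := mf; split.
    rewrite (_ : (fun x => _) = fun x => if x <= y then complex.Re (f x) else 0).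
      exact: measurable_below.
    by apply: funext => x; case: ifP.
  rewrite (_ : (fun x => _) = fun x => if x <= y then complex.Im (f x) else 0).
    exact: measurable_below.
  by apply: funext => x; case: ifP.
have aelim : {ae mu, forall x, tor x -> ccvg (fun n => f x * (bump n (s x))%:C)
    (if x <= y then f x else 0)}.
  exists [set y]; split; first exact: measurable_set1.
    exact: lebesgue_measure_set1.
  move=> x /= hx; apply/eqP; apply: contrapT => /negP xy; apply: hx => tx.
  exact: lim.
have dom n x : tor x -> cmod (f x * (bump n (s x))%:C) <=
    `|complex.Re (f x)| + `|complex.Im (f x)|.
  move=> _; rewrite cmodM cmodR; have /andP[b0 b1] := bump01 n (s01 x).
  rewrite ger0_norm// (le_trans _ (cmod_le_ReIm _))//.
  by rewrite ler_piMr ?cmod_ge0.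
have [_ h] := cdominated measurable_torus (fun n => cmeasM mf (mt n)) mg aelim
  (integrable_norm_cmod measurable_torus hf) dom.
apply: (ccvg_unique h); apply: ccvg_ext (ccvg_cst 0) => n.
by rewrite trig_orth.
Qed.

(** Almost everywhere the function is the derivative of its primitive, which
   vanishes. *)
Lemma ae_eq0_of_integrals (h : R -> R) : mu.-integrable tor (EFin \o h) ->
  (forall y, - pi < y < pi -> Rintegral mu tor (fun x => if x <= y then h x else 0) = 0) ->
  {ae mu, forall x, tor x -> h x = 0}.
Proof.
move=> ih h0; pose ht := h \_ tor.
have iht : mu.-integrable setT (EFin \o ht).
  have := (@integrable_mkcond _ _ _ mu tor (EFin \o h) measurable_torus).1 ih.
  by rewrite /ht restrict_EFin.
have loc : locally_integrable setT ht := integrable_locally measurable_torus ih.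
have iy y : mu.-integrable `]-oo, y]%classic (EFin \o ht).
  exact: (@integrableS _ _ _ mu setT `]-oo, y]%classic (EFin \o ht) measurableT
    (measurable_itv _) (@subsetT _ _) iht).
apply: (ae_mono (FTC1Ny iy loc)) => x [_ dF] tx.
have -> : h x = ht x by rewrite /ht patchE mem_set.
rewrite -dF derive1E.
set F := fun _ => _.
have F0 z : - pi < z < pi -> F z = 0.
  move=> hz; rewrite /F -Rintegral_mkcondr setIC Rintegral_mkcondr -[RHS](h0 z hz).
  apply: eq_Rintegral => t _; rewrite patchE; case: ifP => tz.
    by move: tz; rewrite inE/= in_itv/= => ->.
  move: tz; rewrite (_ : (t \in _) = (t <= z)) => [->//|].
  by apply/idP/idP; rewrite inE/= in_itv.
rewrite (@near_eq_derive _ _ _ F (cst 0) x 1); first exact: derive_cst.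
have : \forall z \near x, z \in `](- pi), pi[.
  exact: near_in_itvoo.
by apply: filterS => z; rewrite in_itv/= => /F0.
Qed.

(** A function with vanishing Fourier coefficients integrates to zero over every
   arc ]-pi,y]; differentiate in y. *)
Theorem fourier_unique f : cintegrable tor f -> (forall l, fcoef f l = 0) ->
  {ae mu, forall x, tor x -> f x = 0}.
Proof.
move=> hf h0; have [i1 i2] := hf.
have r0 : {ae mu, forall x, tor x -> complex.Re (f x) = 0}.
  apply: ae_eq0_of_integrals => // y hy.
  have := congr1 (@complex.Re R) (integral_below_eq0 hf h0 hy); rewrite /= => e; rewrite -[RHS]e.
  by apply: eq_Rintegral => x _; case: ifP.
have j0 : {ae mu, forall x, tor x -> complex.Im (f x) = 0}.
  apply: ae_eq0_of_integrals => // y hy.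
  have := congr1 (@complex.Im R) (integral_below_eq0 hf h0 hy); rewrite /= => e; rewrite -[RHS]e.
  by apply: eq_Rintegral => x _; case: ifP.
have := @filterI _ _ (ae_filter_ringOfSetsType mu) _ _ r0 j0.
by move/ae_mono; apply => x [hr hi] tx; apply: complex_ext; rewrite ?hr ?hi.
Qed.

End Uniqueness.

(** * Sobolev norms and products in terms of Fourier coefficients *)

Section SobolevCoefficients.
Context {R : realType}.
Implicit Types (f g : R -> R[i]) (u v w c : int -> R[i]).
Let mu := @lebesgue_measure R.
Let tor := torus R.

Lemma conjcM (z z' : R[i]) : conjc (z * z') = conjc z * conjc z'.
Proof. exact: rmorphM. Qed.

Lemma esum_int_le (F : int -> R) (B : R) : (forall l, 0 <= F l) ->
  (\esum_(l in [set: int]) (F l)%:E <= B%:E)%E <->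
  (forall N, \sum_(l <- zrange N) F l <= B).
Proof.
move=> F0; split => [h N|h].
  rewrite -lee_fin; apply: le_trans h; apply: esum_ge.
  exists [set` zrange N]; first by split; [exact: finite_seq|exact: subsetT].
  by rewrite -fsbig_seq ?zrange_uniq// sumEFin.
apply: ge_ereal_sup => _ [A [fA _] <-].
rewrite fsbig_finite// sumEFin lee_fin.
by apply: sum_uniq_le => //; exact: finmap.fset_uniq.
Qed.

Lemma sqrte_le (x : \bar R) (B : R) : (0 <= x)%E -> 0 <= B ->
  (x `^ 2^-1 <= B%:E)%E <-> (x <= (B ^+ 2)%:E)%E.
Proof.
move=> x0 B0; rewrite poweR12_sqrt//; case: x x0 => [r| |] //= r0.
rewrite !lee_fin; split => h.
  by rewrite -(sqr_sqrtr r0) ler_pXn2r// ?nnegrE ?sqrtr_ge0.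
by rewrite -[leRHS](ger0_norm B0) -sqrtr_sqr ler_wsqrtr.
Qed.

(** The weighted sums of [sobolev_norm], for a real order s. *)
Definition wsum_le (s : R) c (B : R) : Prop :=
  forall N, \sum_(l <- zrange N) (1 + l%:~R ^+ 2) `^ s * cmod (c l) ^+ 2 <= B ^+ 2.

Lemma sobolev_normP (s : R) f (B : R) : 0 <= B ->
  (sobolev_norm s f <= B%:E)%E <-> square_integrable f /\ wsum_le s (fcoef f) B.
Proof.
move=> B0; rewrite /sobolev_norm; case: asboolP => sf; last first.
  by split => [//|[]].
rewrite sqrte_le//; last first.
  by apply: esum_ge0 => l _; rewrite lee_fin mulr_ge0 ?powR_ge0// addr_ge0 ?sqr_ge0.
rewrite esum_int_le; last first.
  by move=> l; rewrite mulr_ge0 ?powR_ge0// addr_ge0 ?sqr_ge0.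
have e N : \sum_(l <- zrange N) (1 + l%:~R ^+ 2) `^ s * cmod (fcoef f l) ^+ 2 =
    \sum_(l <- zrange N) (1 + l%:~R ^+ 2) `^ s *
     (complex.Re (fcoef f l) ^+ 2 + complex.Im (fcoef f l) ^+ 2).
  by apply: eq_bigr => l _; rewrite sqr_cmod.
split => [h|[_ h] N]; last by rewrite -e.
by split => // N; rewrite e.
Qed.

Lemma sobolev_norm_ge0 (s : R) f : (0 <= sobolev_norm s f)%E.
Proof. by rewrite /sobolev_norm; case: ifP => // _; exact: poweR_ge0. Qed.

Lemma wsum_sob_le p (s : R) c B : 0 <= B -> p%:R <= s -> wsum_le s c B -> sob_le p c B.
Proof.
move=> B0 ps h; split => // N; apply: le_trans (h N).
apply: ler_sum => l _; rewrite exprMn ler_wpM2r ?sqr_ge0//.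
rewrite -exprM mulnC exprM sqr_jap -powR_mulrn; last by rewrite addr_ge0 ?sqr_ge0.
by apply: ler_powR => //; rewrite lerDl sqr_ge0.
Qed.

Lemma sobolev_norm1P f B : 0 <= B ->
  (sobolev_norm 1 f <= B%:E)%E <-> square_integrable f /\ sob_le 1 (fcoef f) B.
Proof.
move=> B0; rewrite sobolev_normP//; split => -[sf h]; split => //.
  exact: wsum_sob_le h.
move=> N; apply: le_trans (h.2 N); apply: ler_sum => l _.
by rewrite exprMn expr1 sqr_jap powRr1// addr_ge0 ?sqr_ge0.
Qed.

(** Both functions have the same Fourier coefficients. *)
Lemma ae_fseries f B : square_integrable f -> l1_le (fun l => cmod (fcoef f l)) B ->
  {ae mu, forall x, tor x -> f x = fseries (fcoef f) x}.
Proof.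
move=> /square_integrable_integrable hf hB.
have hs := cbounded_integrable (cbounded_fseries hB).
have h : {ae mu, forall x, tor x -> f x - fseries (fcoef f) x = 0}.
  apply: fourier_unique => [|l].
    under eq_fun do rewrite -[- fseries _ _]mulN1r.
    apply: cintegrableD => //; first exact: measurable_torus.
    by apply: cintegrableZ => //; exact: measurable_torus.
  by rewrite fcoefB// (fcoef_fseries hB) subrr.
by apply: (ae_mono h) => x hx /hx /eqP; rewrite subr_eq0 => /eqP.
Qed.

(** The conjugation on the middle factor matches the cubic nonlinearity. *)
Definition product_coef u v w (l : int) : R[i] :=
  fcoef (fun x => fseries u x * conjc (fseries v x) * fseries w x) l.

(** The product of the partial sums is a trigonometric polynomial with
   coefficients [tri]; the limit is taken under the integral. *)
Lemma product_coef_cvg u v w A B C l :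
  l1_le (fun l => cmod (u l)) A -> l1_le (fun l => cmod (v l)) B ->
  l1_le (fun l => cmod (w l)) C ->
  ccvg (fun N => tri (fun _ _ _ => 1) u v w N l) (product_coef u v w l).
Proof.
move=> hu hv hw.
pose F N x := fpartial u x N * conjc (fpartial v x N) * fpartial w x N.
have mF N : cmeas tor (F N).
  have m z := cintegrable_meas (cintegrable_fpartial z N).
  by apply: cmeasM; [apply: cmeasM; [|apply: cmeasJ]|]; exact: m.
have bF N x : tor x -> cmod (F N x) <= A * B * C.
  move=> _; rewrite !cmodM cmodJ !ler_pM ?mulr_ge0 ?cmod_ge0//; exact: cmod_fpartial_le.
have lF x : tor x -> ccvg (F^~ x) (fseries u x * conjc (fseries v x) * fseries w x).
  move=> _; apply: ccvgM; [apply: ccvgM; [|apply: ccvgJ]|].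
  - exact: fseries_cvg hu x.
  - exact: fseries_cvg hv x.
  - exact: fseries_cvg hw x.
apply: ccvg_ext (fcoef_lim mF bF lF l) => N.
have ie k : cintegrable tor (fun x : R => cis (k%:~R * x)).
  by apply: cintegrable_exp; [exact: measurable_torus|exact: mu_torus_fin].
have mt := @measurable_torus R.
have -> : F N = fun x => \sum_(l1 <- zrange N) \sum_(l2 <- zrange N) \sum_(l3 <- zrange N)
    (u l1 * conjc (v l2) * w l3) * cis ((l1 - l2 + l3)%:~R * x).
  apply: funext => x; rewrite /F !fpartialE rmorph_sum/= big_distrlr/=.
  rewrite mulr_suml; apply: eq_bigr => l1 _; rewrite mulr_suml; apply: eq_bigr => l2 _.
  rewrite mulr_sumr; apply: eq_bigr => l3 _.
  have -> : conjc (v l2 * cis (l2%:~R * x)) = conjc (v l2) * cis (- (l2%:~R * x)).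
    by rewrite cisN -conjcM.
  by rewrite rmorphD rmorphB/= !mulrDl mulNr !cisD; ring.
rewrite fcoef_sum => [|l1]; last first.
  apply: cintegrable_sum => // l2; apply: cintegrable_sum => // l3; exact: cintegrableZ.
apply: eq_bigr => l1 _; rewrite fcoef_sum => [|l2]; last first.
  apply: cintegrable_sum => // l3; exact: cintegrableZ.
apply: eq_bigr => l2 _; rewrite fcoef_sum => [|l3]; last exact: cintegrableZ.
apply: eq_bigr => l3 _; rewrite fcoefZ// fcoef_exp.
by case: eqP => _; rewrite ?mulr1 ?mul1r ?mulr0.
Qed.

Lemma product_coef_sob_le u v w A B C :
  sob_le 1 u A -> sob_le 1 v B -> sob_le 1 w C ->
  sob_le 1 (product_coef u v w) (27 * A * B * C).
Proof.
move=> hu hv hw; rewrite -[27]mulr1.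
apply: (@sob_le_lim _ 1 (fun N => tri (fun _ _ _ => 1) u v w N) _ _ 0) => [N _|l].
  by apply: tri_H1 => // *; rewrite cmod1.
exact: product_coef_cvg (sob_le_l1 hu) (sob_le_l1 hv) (sob_le_l1 hw).
Qed.

Lemma sum_zrange_opp (V : nmodType) N (F : int -> V) :
  \sum_(l <- zrange N) F (- l) = \sum_(l <- zrange N) F l.
Proof.
rewrite -(big_map (fun l => - l) xpredT F); apply: perm_big.
apply: uniq_perm; rewrite ?zrange_uniq//.
  by rewrite map_inj_uniq ?zrange_uniq//; exact: oppr_inj.
move=> l; rewrite mem_zrange; apply/mapP/idP => [[k]|h].
  by rewrite mem_zrange => hk ->; rewrite abszN.
by exists (- l); rewrite ?opprK// mem_zrange abszN.
Qed.

Lemma fseries_conj c B (x : R) : l1_le (fun l => cmod (c l)) B ->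
  fseries (fun l => conjc (c (- l))) x = conjc (fseries c x).
Proof.
move=> hB; apply: fseries_eq; apply: ccvg_ext (ccvgJ (fseries_cvg hB x)) => N.
rewrite !fpartialE rmorph_sum/= -sum_zrange_opp; apply: eq_bigr => l _.
by rewrite conjcM -cisN cis_opp opprK.
Qed.

Lemma fcoef_conj f l : cintegrable tor f ->
  fcoef (conj_fun f) l = conjc (fcoef f (- l)).
Proof.
move=> hf; rewrite !fcoefE rmorphM/= oppr0; congr (_ * _).
have [i1 i2] := @cintegrable_fexp _ f (- l) hf.
apply: complex_ext; rewrite ?RecJ ?ImcJ /=.
  apply: eq_Rintegral => x _; rewrite /conj_fun -RecJ; congr complex.Re.
  by rewrite conjcM conjcK -cisN opprK cis_opp opprK.
rewrite -mulN1r -RintegralZl//; last exact: measurable_torus.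
apply: eq_Rintegral => x _; rewrite mulN1r -ImcJ; congr complex.Im.
by rewrite conjcM -cisN opprK cis_opp.
Qed.

(** Conjugation reflects the frequencies, which an even symbol does not see. *)
Lemma multiplier_conj f (sg : int -> R[i]) B (x : R) : cintegrable tor f ->
  (forall l, cmod (sg l) <= 1) -> (forall l, sg (- l) = sg l) ->
  l1_le (fun l => cmod (fcoef f l)) B ->
  multiplier sg (conj_fun f) x = conjc (fseries (fun l => conjc (sg l) * fcoef f l) x).
Proof.
move=> hf sg1 sgN [B0 hB].
rewrite -(@fseries_conj _ B); last first.
  split => // N; apply: le_trans (hB N); apply: ler_sum => l _.
  by rewrite cmodM cmodJ ler_piMl ?cmod_ge0.
rewrite /multiplier (_ : (fun l => _) = fun l => sg l * fcoef (conj_fun f) l)//.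
by apply: funext => l; rewrite fcoef_conj//= conjcM conjcK sgN.
Qed.

End SobolevCoefficients.

(** * The integrator on Fourier coefficients *)

Section SchemeCoefficients.
Context {R : realType}.
Implicit Types (f g : R -> R[i]) (u v w c : int -> R[i]).
Let mu := @lebesgue_measure R.
Let tor := torus R.

(** Removes the free flow up to time t. *)
Definition twist (t : R) c (l : int) : R[i] := cis (t * l%:~R ^+ 2) * c l.

Lemma cmod_twist t c l : cmod (twist t c l) = cmod (c l).
Proof. by rewrite cmodM cmod_cis mul1r. Qed.

Lemma sob_le_twist p t c B : sob_le p (twist t c) B <-> sob_le p c B.
Proof. by split; apply: sob_le_mod => l; rewrite cmod_twist. Qed.

(** Twisting by the free flow multiplies the kernel by the phase of the
   interaction. *)
Lemma tri_twist t k c N l :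
  tri (fun l1 l2 l3 => phase_ker t l1 l2 l3 * k l1 l2 l3)
    (twist t c) (twist t c) (twist t c) N l =
  cis (t * l%:~R ^+ 2) * tri k c c c N l.
Proof.
rewrite -triZ; apply: eq_tri => l1 l2 l3 _ _ _ e.
have -> : cis (t * l%:~R ^+ 2) = phase_ker t l1 l2 l3 * cis (t * l1%:~R ^+ 2) *
    cis (- (t * l2%:~R ^+ 2)) * cis (t * l3%:~R ^+ 2).
  rewrite /phase_ker -!cisD -e; congr cis.
  by rewrite /phase rmorphD/= rmorphM/= !rmorphB/=; ring.
rewrite /twist conjcM -cisN; ring.
Qed.

(** The symbol of [phi1_op]. *)
Definition phi_sym (tau : R) (l : int) : R[i] := phi1i (2 * tau * l%:~R ^+ 2).

Lemma phi_sym_le1 tau l : cmod (phi_sym tau l) <= 1.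
Proof. exact: phi1i_le1. Qed.

Lemma phi_symN tau l : phi_sym tau (- l) = phi_sym tau l.
Proof. by rewrite /phi_sym rmorphN/= sqrrN. Qed.

(** The coefficients of the function whose conjugate is [phi1_op] applied to the
   conjugate. *)
Definition damp tau c l : R[i] := conjc (phi_sym tau l) * c l.

Lemma sob_le_damp p tau c B : sob_le p c B -> sob_le p (damp tau c) B.
Proof. by apply: sob_le_mod => l; rewrite cmodM cmodJ ler_piMl ?cmod_ge0 ?phi_sym_le1. Qed.

(** The coefficients of the constant 1, through which a product of two factors is
   a case of [product_coef]. *)
Definition delta0 (l : int) : R[i] := (l == 0)%:R.

Lemma sum_pick N (y : int) (F : int -> R[i]) :
  \sum_(x <- zrange N) (if x == y then F x else 0) = if (`|y| <= N)%N then F y else 0.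
Proof.
rewrite -mem_zrange; case: ifP => hy.
  rewrite (bigD1_seq y) ?zrange_uniq// eqxx big1 => [|k /negbTE ->//].
  exact: addr0.
by rewrite big1_seq// => k /andP[_ kN]; case: eqP => // e; rewrite -e kN in hy.
Qed.

Lemma sob_le_delta0 : sob_le 1 delta0 1.
Proof.
split => // N; rewrite (eq_bigr (fun l => if l == 0 then 1 else 0)).
  by rewrite -big_mkcond/= -big_filter filter_pred1_uniq ?zrange_uniq ?mem_zrange// big_seq1 expr1n.
move=> l _; rewrite /delta0; case: eqP => [->|_].
  by rewrite cmod1 mulr1 expr1 sqr_jap expr0n/= addr0.
by rewrite cmod0 mulr0 expr0n.
Qed.

Lemma fseries_delta0 (x : R) : fseries delta0 x = 1.
Proof.
apply: fseries_eq; apply: ccvg_ext (ccvg_cst 1) => N; rewrite fpartialE.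
rewrite (eq_bigr (fun l => if l == 0 then cis (l%:~R * x) else 0)) => [|l _].
  by rewrite sum_pick/= mul0r cis0.
by rewrite /delta0; case: eqP => _; rewrite ?mul1r ?mul0r.
Qed.

Lemma tri_delta0 c v N :
  tri (fun _ _ _ => 1) c v delta0 N 0 = \sum_(l <- zrange N) c l * conjc (v l).
Proof.
apply: eq_big_seq => l1; rewrite mem_zrange => h1.
transitivity (\sum_(l2 <- zrange N) if l2 == l1 then c l1 * conjc (v l2) else 0).
  apply: eq_bigr => l2 _.
  transitivity (\sum_(l3 <- zrange N) if l3 == 0 then
      (if l2 == l1 then c l1 * conjc (v l2) else 0) else 0).
    apply: eq_bigr => l3 _; rewrite /delta0; case: (eqVneq l3 0) => [->|_].
      rewrite addr0 subr_eq0 eq_sym.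
      by case: ifP => _; rewrite ?mul1r ?mulr1.
    by case: ifP => _; rewrite ?mulr0.
  by rewrite sum_pick.
by rewrite sum_pick h1.
Qed.

(** Splitting off the resonant triples: those with l1 = l2 and those with
   l3 = l2 each contribute a mass term, and the diagonal is counted twice. *)
Lemma tri_nr_ker tau c N l : (`|l| <= N)%N ->
  tri (nr_ker tau) c c c N l = tri (fun _ _ _ => 1) c (damp tau c) c N l +
    2 * (\sum_(k <- zrange N) c k * conjc (c k) -
         \sum_(k <- zrange N) c k * conjc (damp tau c k)) * c l -
    (1 - phi_sym tau l) * conjc (c l) * c l * c l.
Proof.
move=> hl.
pose m k := (1 - phi_sym tau k) * (c k * conjc (c k)).
(* Inclusion-exclusion on the resonant set: K1 + K3 - K13. *)
pose K1 (l1 l2 l3 : int) : R[i] := if l1 == l2 then 1 - phi_sym tau l2 else 0.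
pose K3 (l1 l2 l3 : int) : R[i] := if l3 == l2 then 1 - phi_sym tau l2 else 0.
pose K13 (l1 l2 l3 : int) : R[i] :=
  if (l1 == l2) && (l3 == l2) then 1 - phi_sym tau l2 else 0.
pose K0 (l1 l2 l3 : int) : R[i] := phi_sym tau l2.
have -> : tri (nr_ker tau) c c c N l = tri (fun l1 l2 l3 => (K0 l1 l2 l3 -
    (K13 l1 l2 l3 - K1 l1 l2 l3)) - -1 * K3 l1 l2 l3) c c c N l.
  apply: eq_tri => l1 l2 l3 _ _ _ _; congr (_ * _).
  rewrite /nr_ker /resonant /K1 /K3 /K13 /K0 mulf_eq0 !subr_eq0.
  by do 2 case: eqP => _ //=; rewrite /phi_sym; ring.
rewrite !triBk triZ.
have e0 : tri K0 c c c N l = tri (fun _ _ _ => 1) c (damp tau c) c N l.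
  apply: eq_tri => l1 l2 l3 _ _ _ _.
  by rewrite /K0 /damp conjcM conjcK; ring.
have e1 : tri K1 c c c N l = (\sum_(k <- zrange N) m k) * c l.
  rewrite /tri mulr_suml; apply: eq_big_seq => l1; rewrite mem_zrange => h1.
  transitivity (\sum_(l2 <- zrange N) if l2 == l1 then m l2 * c l else 0).
    apply: eq_bigr => l2 _.
    transitivity (\sum_(l3 <- zrange N) if l3 == l then
        (if l2 == l1 then m l2 * c l3 else 0) else 0); last by rewrite sum_pick hl.
    apply: eq_bigr => l3 _; rewrite /K1 [l1 == l2]eq_sym.
    case: (eqVneq l2 l1) => [->|_]; last by rewrite mul0r; do 2 case: ifP.
    by rewrite subrr add0r; case: ifP => // _; rewrite /m; ring.
  by rewrite sum_pick h1.
have e3 : tri K3 c c c N l = (\sum_(k <- zrange N) m k) * c l.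
  rewrite /tri exchange_big/= mulr_suml; apply: eq_big_seq => l2; rewrite mem_zrange => h2.
  transitivity (\sum_(l1 <- zrange N) if l1 == l then m l2 * c l1 else 0); last first.
    by rewrite sum_pick hl.
  apply: eq_bigr => l1 _.
  transitivity (\sum_(l3 <- zrange N) if l3 == l2 then
      (if l1 == l then m l2 * c l1 else 0) else 0); last by rewrite sum_pick h2.
  apply: eq_bigr => l3 _; rewrite /K3.
  case: (eqVneq l3 l2) => [->|_]; last by rewrite mul0r; case: ifP.
  by rewrite subrK; case: ifP => // _; rewrite /m; ring.
have e13 : tri K13 c c c N l = m l * c l.
  rewrite /tri.
  transitivity (\sum_(l1 <- zrange N) if l1 == l then m l1 * c l1 else 0); last first.
    by rewrite sum_pick hl.
  apply: eq_big_seq => l1; rewrite mem_zrange => h1.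
  transitivity (\sum_(l2 <- zrange N) if l2 == l1 then
      (if l1 == l then m l1 * c l1 else 0) else 0); last by rewrite sum_pick h1.
  apply: eq_big_seq => l2; rewrite mem_zrange => h2.
  transitivity (\sum_(l3 <- zrange N) if l3 == l2 then
      (if l2 == l1 then (if l1 == l then m l1 * c l1 else 0) else 0) else 0); last first.
    by rewrite sum_pick h2.
  apply: eq_bigr => l3 _; rewrite /K13 [l1 == l2]eq_sym.
  case: (eqVneq l2 l1) => [->|_]/=; last by rewrite mul0r; do 2 case: ifP.
  case: (eqVneq l3 l1) => [->|_]/=; last by rewrite mul0r; case: ifP.
  by rewrite subrK; case: ifP => // _; rewrite /m; ring.
rewrite e0 e1 e3 e13.
have -> : \sum_(k <- zrange N) m k = \sum_(k <- zrange N) c k * conjc (c k) -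
    \sum_(k <- zrange N) c k * conjc (damp tau c k).
  rewrite -sumrB; apply: eq_bigr => k _.
  by rewrite /m /damp conjcM conjcK; ring.
rewrite /m; ring.
Qed.

(** The zeroth coefficient of [nlri_g]. *)
Definition mass_defect tau c : R[i] :=
  product_coef c c delta0 0 - product_coef c (damp tau c) delta0 0.

Definition hcoef tau c l : R[i] := (1 - phi_sym tau l) * conjc (c l) * c l * c l.

Definition scheme_nl tau c l : R[i] :=
  product_coef c (damp tau c) c l + 2 * mass_defect tau c * c l - hcoef tau c l.

(** The three explicit terms of the integrator are one cubic convolution, with
   kernel [nr_ker]. *)
Lemma scheme_nl_cvg tau c B l : sob_le 1 c B ->
  ccvg (fun N => tri (nr_ker tau) c c c N l) (scheme_nl tau c l).
Proof.
move=> hc; have hd := sob_le_damp tau hc.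
have lc := sob_le_l1 hc; have ld := sob_le_l1 hd; have l0 := sob_le_l1 sob_le_delta0.
have p1 := product_coef_cvg l lc ld lc.
have p2 := product_coef_cvg 0 lc lc l0.
have p3 := product_coef_cvg 0 lc ld l0.
have := ccvgB (ccvgD p1 (ccvgM (ccvgZ 2 (ccvgB p2 p3)) (ccvg_cst (c l))))
  (ccvg_cst (hcoef tau c l)).
apply: ccvg_eventually; exists `|l|%N => N hN.
by rewrite tri_nr_ker// !tri_delta0.
Qed.

Lemma hcoef_sob_le tau c B : sob_le 1 c B -> sob_le 1 (hcoef tau c) (2 * B * B * B).
Proof.
move=> hc; have B0 := sob_le_ge0 hc.
have h : sob_le 1 (fun l => (2 * B * B)%:C * c l) (cmod (2 * B * B)%:C * B) := sob_leZ _ hc.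
rewrite cmodR ger0_norm in h; last by rewrite !mulr_ge0.
apply: sob_le_mod h => l; rewrite !cmodM cmodR ger0_norm ?mulr_ge0// cmodJ.
have hp := sob_le_pt l hc; have h0 := cmod_ge0 (c l).
rewrite ler_wpM2r// !ler_pM ?mulr_ge0 ?cmod_ge0//.
by rewrite (le_trans (cmodB _ _))// cmod1 -[leRHS]/(1 + 1) lerD2l phi_sym_le1.
Qed.

Lemma fcoef_fseries_comb c1 c2 c3 B1 B2 B3 (z2 z3 : R[i]) l :
  l1_le (fun l => cmod (c1 l)) B1 -> l1_le (fun l => cmod (c2 l)) B2 ->
  l1_le (fun l => cmod (c3 l)) B3 ->
  fcoef (fun x => fseries c1 x + z2 * fseries c2 x + z3 * fseries c3 x) l =
  c1 l + z2 * c2 l + z3 * c3 l.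
Proof.
move=> h1 h2 h3.
have i1 := cbounded_integrable (cbounded_fseries h1).
have i2 := cbounded_integrable (cbounded_fseries h2).
have i3 := cbounded_integrable (cbounded_fseries h3).
have iz z g : cintegrable tor g -> cintegrable tor (fun x => z * g x).
  exact: cintegrableZ measurable_torus.
rewrite fcoefD ?fcoefD ?fcoefZ//; try exact: iz; last first.
  by apply: cintegrableD; [exact: measurable_torus|exact: i1|exact: iz].
by rewrite (fcoef_fseries h1) (fcoef_fseries h2) (fcoef_fseries h3).
Qed.

Section step.
Variables (eps tau : R) (f : R -> R[i]) (B : R).
Hypotheses (sf : square_integrable f) (hf : sob_le 1 (fcoef f) B).

Let a := fcoef f.
Let ca : R -> R[i] := fseries a.
Let cd : R -> R[i] := fseries (damp tau a).

Let mf : cmeas tor f.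
Proof. by case: sf. Qed.

Let fint : cintegrable tor f.
Proof. exact: square_integrable_integrable. Qed.

Let hd : sob_le 1 (damp tau a) B.
Proof. exact: sob_le_damp. Qed.

Let f_ae : {ae mu, forall x, tor x -> f x = ca x}.
Proof. exact: ae_fseries sf (sob_le_l1 hf). Qed.

Let bca : cbounded ca.
Proof. exact: cbounded_fseries (sob_le_l1 hf). Qed.

Let bcd : cbounded cd.
Proof. exact: cbounded_fseries (sob_le_l1 hd). Qed.

Lemma phi1_op_conj (x : R) : phi1_op tau (conj_fun f) x = conjc (cd x).
Proof.
exact: (multiplier_conj x fint (phi_sym_le1 tau) (phi_symN tau) (sob_le_l1 hf)).
Qed.

Lemma fcoef_g : fcoef (nlri_g tau f) 0 = mass_defect tau a.
Proof.
have b0 : cbounded (fseries (delta0 : int -> R[i])).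
  exact: cbounded_fseries (sob_le_l1 sob_le_delta0).
have b1 := cboundedM (cboundedM bca (cboundedJ bca)) b0.
have b2 := cboundedM (cboundedM bca (cboundedJ bcd)) b0.
rewrite /mass_defect /product_coef -fcoefB; try exact: cbounded_integrable.
apply: fcoef_ae.
- rewrite /nlri_g /conj_fun; under eq_fun do rewrite phi1_op_conj.
  by apply: cmeasM => //; apply: cmeasD; [exact: cmeasJ|apply: cmeasN; have [] := cboundedJ bcd].
- by apply: cmeasD; [have [] := b1|apply: cmeasN; have [] := b2].
apply: (ae_mono f_ae) => x hx /hx e.
by rewrite /nlri_g /conj_fun phi1_op_conj e fseries_delta0 /ca /cd; ring.
Qed.

Let G (y : R) : R[i] := f y - 'i%C * (tau * eps ^+ 2)%:C *
  (f y ^+ 2 * phi1_op tau (conj_fun f) y).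

Lemma fcoef_G l : fcoef G l =
  a l - 'i%C * (tau * eps ^+ 2)%:C * product_coef a (damp tau a) a l.
Proof.
have b2 := cboundedM (cboundedM bca (cboundedJ bcd)) bca.
have b3 := cboundedM (cbounded_cst ('i%C * (tau * eps ^+ 2)%:C)) b2.
transitivity (fcoef (fun x => f x - 'i%C * (tau * eps ^+ 2)%:C *
    (ca x * conjc (cd x) * ca x)) l); last first.
  rewrite (fcoefB l fint (cbounded_integrable b3)).
  by rewrite (fcoefZ _ l (cbounded_integrable b2)).
apply: fcoef_ae.
- rewrite /G; apply: cmeasD => //; apply: cmeasN; apply: cmeasM; first exact: cmeas_cst.
  under eq_fun do rewrite phi1_op_conj expr2.
  by apply: cmeasM; [exact: cmeasM|have [] := cboundedJ bcd].
- by apply: cmeasD => //; apply: cmeasN; have [] := b3.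
apply: (ae_mono f_ae) => x hx /hx e.
by rewrite /G phi1_op_conj e /ca /cd; ring.
Qed.

Lemma nlri_hE (x : R) : nlri_h tau f x = fseries (hcoef tau a) x.
Proof.
have -> : hcoef tau a = fun l => (1 - phi1 ((2 * l%:~R ^+ 2 * tau) *i)) *
    conjc (fcoef f l) * fcoef f l * fcoef f l.
  by apply: funext => l; rewrite /hcoef /phi_sym /phi1i [2 * l%:~R ^+ 2 * tau]mulrAC.
by [].
Qed.

Let hP : sob_le 1 (product_coef a (damp tau a) a) (27 * B * B * B).
Proof. exact: product_coef_sob_le. Qed.

Lemma nlri_step_spec :
  cbounded (nlri_step eps tau f) /\
  forall l, fcoef (nlri_step eps tau f) l = cis (- (tau * l%:~R ^+ 2)) *
    (a l - 'i%C * (eps ^+ 2)%:C * tau%:C * scheme_nl tau a l).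
Proof.
pose tw (c : int -> R[i]) l := cis (- (tau * l%:~R ^+ 2)) * c l.
have twB c D : sob_le 1 c D -> sob_le 1 (tw c) D.
  by apply: sob_le_mod => l; rewrite cmodM cmod_cis mul1r.
have hG : exists D, sob_le 1 (fcoef G) D.
  eexists; apply: sob_le_ext (sob_leB hf (sob_leZ ('i%C * (tau * eps ^+ 2)%:C) hP)) => l.
  exact: fcoef_G.
have [D /twB h1] := hG; have h2 := twB _ _ hf; have h3' := hcoef_sob_le tau hf.
have b4 : cbounded (fseries (hcoef tau a)) := cbounded_fseries (sob_le_l1 h3').
have h3 := twB _ _ h3'.
have b1 := cbounded_fseries (sob_le_l1 h1); have b2 := cbounded_fseries (sob_le_l1 h2).
have b3 := cbounded_fseries (sob_le_l1 h3).
pose g0 := mass_defect tau a.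
pose F x := fseries (tw (fcoef G)) x +
  (- (2 * 'i%C * (eps ^+ 2 * tau)%:C * g0)) * fseries (tw a) x +
  'i%C * (eps ^+ 2 * tau)%:C * fseries (tw (hcoef tau a)) x.
have FE : nlri_step eps tau f = F.
  apply: funext => x; rewrite /nlri_step /F fcoef_g mulNr.
  have -> : schrodinger tau (nlri_h tau f) x = fseries (tw (hcoef tau a)) x.
    have -> : nlri_h tau f = fseries (hcoef tau a).
      by apply: funext => y; exact: nlri_hE.
    have -> : tw (hcoef tau a) =
        fun l => cis (- (tau * l%:~R ^+ 2)) * fcoef (fseries (hcoef tau a)) l.
      by apply: funext => l; rewrite (@fcoef_fseries _ (hcoef tau a) _ (sob_le_l1 h3') l).
    by [].
  by [].
have bb2 := cboundedM (cbounded_cst (- (2 * 'i%C * (eps ^+ 2 * tau)%:C * g0))) b2.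
have bb3 := cboundedM (cbounded_cst ('i%C * (eps ^+ 2 * tau)%:C)) b3.
rewrite FE; split; first exact: cboundedD (cboundedD b1 bb2) bb3.
move=> l; rewrite (fcoef_fseries_comb _ _ l (sob_le_l1 h1) (sob_le_l1 h2) (sob_le_l1 h3)).
rewrite /tw fcoef_G /scheme_nl -/g0 -/a !rmorphM/=; ring.
Qed.

Lemma nlri_step_H1 : square_integrable (nlri_step eps tau f) /\
  exists D, sob_le 1 (fcoef (nlri_step eps tau f)) D.
Proof.
have [b e] := nlri_step_spec; split; first exact: cbounded_square_integrable.
have hs := sob_leB (sob_leD hP (sob_leZ (2 * mass_defect tau a) hf)) (hcoef_sob_le tau hf).
have hr := sob_leB hf (sob_leZ ('i%C * (eps ^+ 2)%:C * tau%:C) hs).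
eexists; apply: sob_le_mod hr => l.
by rewrite e cmodM cmod_cis mul1r.
Qed.

End step.

Lemma nlri_H1 eps tau (phi : R -> R[i]) B n :
  square_integrable phi -> sob_le 1 (fcoef phi) B ->
  square_integrable (nlri eps tau phi n) /\
  exists D, sob_le 1 (fcoef (nlri eps tau phi n)) D.
Proof.
move=> sp hp; elim: n => [|n [s [D h]]]; first by split => //; exists B.
exact: nlri_step_H1 s h.
Qed.

End SchemeCoefficients.

(** * The mild solution on Fourier coefficients *)

Section ContinuousComplex.
Context {R : realType}.
Implicit Types (f g : R -> R[i]).
Let mu := @lebesgue_measure R.

Definition ccontinuous f : Prop :=
  continuous (fun s => complex.Re (f s)) /\ continuous (fun s => complex.Im (f s)).

Lemma ccontinuousM f g : ccontinuous f -> ccontinuous g ->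
  ccontinuous (fun s => f s * g s).
Proof.
move=> [f1 f2] [g1 g2]; split.
  under eq_fun do rewrite RecM.
  by move=> x; apply: cvgB; apply: cvgM; [exact: f1|exact: g1|exact: f2|exact: g2].
under eq_fun do rewrite ImcM.
by move=> x; apply: cvgD; apply: cvgM; [exact: f1|exact: g2|exact: f2|exact: g1].
Qed.

Lemma ccontinuous_eps f :
  (forall t e, 0 < e -> exists2 d, 0 < d &
     forall s, `|s - t| < d -> cmod (f s - f t) <= e) -> ccontinuous f.
Proof.
move=> h; split => t; apply/cvgrPdist_le => e e0; have [d d0 hd] := h t e e0.
  exists d => //= s /= hs; rewrite distrC -RecN -RecD.
  by rewrite (le_trans (Re_le_cmod _))// hd// distrC.
exists d => //= s /= hs; rewrite distrC -ImcN -ImcD.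
by rewrite (le_trans (Im_le_cmod _))// hd// distrC.
Qed.

Lemma ccontinuous_cis (a b : R) : ccontinuous (fun s => cis (a * s + b)).
Proof.
by split => s; apply: differentiable_continuous; apply/derivable1_diffP;
  have [[? _] [? _]] := is_cderive_cis a b s.
Qed.

Lemma ccontinuous_meas (D : set R) f : ccontinuous f -> cmeas D f.
Proof.
by move=> [f1 f2]; split; apply: measurable_funTS;
  exact: continuous_measurable_fun.
Qed.

Lemma ccontinuous_integrable (a b : R) f : ccontinuous f ->
  cintegrable `[a, b]%classic f.
Proof.
move=> [f1 f2]; split; apply: continuous_compact_integrable;
  by [exact: segment_compact|exact: continuous_subspaceT].
Qed.

Lemma is_cderive_integral (a x : R) f : a < x -> ccontinuous f ->
  is_cderive (fun t => cintegral `[a, t]%classic f) x (f x).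
Proof.
move=> ax cf; have [f1 f2] := cf.
have xu : x < x + 1 by rewrite ltrDl.
have [i1 i2] := ccontinuous_integrable a (x + 1) cf.
have ax' : (BLeft a < BRight x)%E by rewrite /= lte_fin.
have [d1 e1] := @continuous_FTC1 R (fun s => complex.Re (f s)) (BLeft a) x (x + 1)
  xu i1 ax' (f1 x).
have [d2 e2] := @continuous_FTC1 R (fun s => complex.Im (f s)) (BLeft a) x (x + 1)
  xu i2 ax' (f2 x).
split.
  by apply: DeriveDef; [exact: d1|rewrite -derive1E].
by apply: DeriveDef; [exact: d2|rewrite -derive1E].
Qed.

Lemma cintegral_itvB (a x b : R) f : a <= x <= b -> ccontinuous f ->
  cintegral `[a, b]%classic f - cintegral `[a, x]%classic f =
  cintegral `[x, b]%classic f.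
Proof.
move=> /andP[ax xb] cf.
have [i1 i2] := ccontinuous_integrable a b cf.
have [j1 j2] := ccontinuous_integrable x b cf.
have sub h : mu.-integrable `[x, b]%classic (EFin \o h) ->
    mu.-integrable `]x, b]%classic (EFin \o h).
  move=> hh; apply: (@integrableS _ _ _ mu `[x, b]%classic `]x, b]%classic (EFin \o h)) => //.
  by apply: subset_itv_oc_cc.
apply: complex_ext; rewrite ?RecD ?ImcD ?RecN ?ImcN /=.
  by rewrite Rintegral_itvB ?bnd_simp// Rintegral_itv_obnd_cbnd//; exact: sub.
by rewrite Rintegral_itvB ?bnd_simp// Rintegral_itv_obnd_cbnd//; exact: sub.
Qed.

End ContinuousComplex.

Section MildSolution.
Context {R : realType}.
Let mu := @lebesgue_measure R.
Let tor := torus R.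
Variables (eps S m K : R) (phi : R -> R[i]) (w : R -> R -> R[i]).
Hypotheses (S_gt0 : 0 < S) (m_ge1 : 1 <= m) (K_ge0 : 0 <= K).
Hypothesis w_mild : mild_nls eps S phi w.
Hypothesis w_bound : (Linfty_sobolev S m w <= K%:E)%E.

Definition wcoef (t : R) (l : int) : R[i] := fcoef (w t) l.

Lemma w_L2 t : 0 <= t <= S -> square_integrable (w t).
Proof.
have [h _ _ _] := w_mild => /h; rewrite /sobolev_norm.
by case: asboolP.
Qed.

Lemma wcoef_sub s t l : 0 <= s <= S -> 0 <= t <= S ->
  fcoef (fun x => w s x - w t x) l = wcoef s l - wcoef t l.
Proof.
by move=> hs ht; rewrite fcoefB//; apply: square_integrable_integrable; exact: w_L2.
Qed.

Lemma wcoef_continuous t e : 0 <= t <= S -> 0 < e -> exists2 d, 0 < d &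
  forall s, 0 <= s <= S -> `|s - t| < d -> sob_le 1 (fun l => wcoef s l - wcoef t l) e.
Proof.
move=> ht e0; have [_ h _ _] := w_mild.
have [hfin hcvg] := (fine_cvgP _ _).1 (h t ht).
have [d1 /= d10 hd1] := hfin.
have /cvgrPdist_le/(_ e e0)[d2 /= d20 hd2] := hcvg.
exists (Num.min d1 d2); first by rewrite lt_min d10.
move=> s hs; rewrite lt_min => /andP[s1 s2].
have sS : `[0, S]%classic s by rewrite /= in_itv.
have f1 := hd1 s; rewrite /ball_/= distrC in f1; have {}f1 := f1 s1 sS.
have f2 := hd2 s; rewrite /ball_/= distrC in f2; have {}f2 := f2 s2 sS.
have le : (sobolev_norm 1 (fun x => w s x - w t x)%R <= e%:E)%E.
  rewrite -(fineK f1) lee_fin; apply: le_trans f2.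
  by rewrite sub0r normrN ler_norm.
have [_ hh] := (sobolev_norm1P _ (ltW e0)).1 le.
by apply: sob_le_ext hh => l; rewrite wcoef_sub.
Qed.

(** A null set of times has no interior in [0,S]. *)
Lemma dense_times (P : R -> Prop) t e : {ae mu, forall s, P s} ->
  0 <= t <= S -> 0 < e -> exists s, [/\ 0 <= s <= S, `|s - t| < e & P s].
Proof.
move=> [N [mN N0 hN]] /andP[t0 tS] e0.
apply: contrapT => hno.
(* If all times near t were exceptional, so would be the interval ]a,b[. *)
pose a := Num.max 0 (t - e / 2); pose b := Num.min S (t + e / 2).
have ab : a < b.
  have S0 := S_gt0; rewrite /a /b; case: (leP 0 (t - e / 2)); case: (leP S (t + e / 2)) => *; lra.
have : mu `]a, b[%classic = 0.
  apply: (@subset_measure0 _ _ _ mu `]a, b[%classic N) => //.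
  move=> s /=; rewrite in_itv/= => /andP[sa sb]; apply: hN => /= Ps.
  move: sa sb; rewrite /a /b gt_max lt_min => /andP[s0 sl] /andP[sS sr].
  apply: hno; exists s; split => //; first by rewrite !ltW.
  by rewrite ltr_norml; apply/andP; split; lra.
rewrite /mu mu_itvoo ?ltW// => -[] /eqP; rewrite subr_eq0 => /eqP e'.
by rewrite e' ltxx in ab.
Qed.

Lemma wsum_lim (s B : R) (F : nat -> int -> R[i]) (c : int -> R[i]) :
  (forall n, wsum_le s (F n) B) -> (forall l, ccvg (F^~ l) (c l)) -> wsum_le s c B.
Proof.
move=> hF hc N.
have H : (fun n => \sum_(l <- zrange N) (1 + l%:~R ^+ 2) `^ s * cmod (F n l) ^+ 2) @ \oo -->
    \sum_(l <- zrange N) (1 + l%:~R ^+ 2) `^ s * cmod (c l) ^+ 2.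
  elim: (zrange N) => [|l r IH].
    by rewrite big_nil; under eq_fun do rewrite big_nil; exact: cvg_cst.
  rewrite big_cons; under eq_fun do rewrite big_cons.
  apply: cvgD => //; apply: cvgMr; rewrite expr2; under eq_fun do rewrite expr2.
  by apply: cvgM; exact: ccvg_cmod.
by apply: (cvgr_to_le H); apply: nearW => n; exact: hF.
Qed.

(** Bounds valid at almost every time hold at every time, by continuity in H^1
   and lower semicontinuity of the H^s norm. *)
Lemma wsum_all_times (s B : R) t : 0 <= B -> (Linfty_sobolev S s w <= B%:E)%E ->
  0 <= t <= S -> wsum_le s (wcoef t) B.
Proof.
move=> B0 /ess_supP hB ht.
have ex n : exists r, [/\ 0 <= r <= S, wsum_le s (wcoef r) B &
    sob_le 1 (fun l => wcoef r l - wcoef t l) n.+1%:R^-1].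
  have n0 : 0 < n.+1%:R^-1 :> R by rewrite invr_gt0.
  have [d d0 hd] := wcoef_continuous ht n0.
  have [r [rS rd hr]] := dense_times hB ht d0.
  exists r; split => //; last exact: hd.
  move: hr; rewrite (_ : r \in `[0, S])//.
  by move/(sobolev_normP _ _ B0) => [].
have [r hr] := choice ex.
apply: (@wsum_lim _ _ (fun n => wcoef (r n))) => [n|l]; first by have [] := hr n.
move=> e e0; exists (Num.truncn e^-1) => n hn.
have [_ _ /(sob_le_pt l) h] := hr n; apply: (le_trans h).
rewrite invf_ple ?posrE// ltW// (lt_le_trans (truncnS_gt _))// ler_nat ltnS//.
Qed.

Lemma wcoef_wsum t : 0 <= t <= S -> wsum_le m (wcoef t) K.
Proof. exact: wsum_all_times. Qed.

Lemma wcoef_hle1 t : 0 <= t <= S -> sob_le 1 (wcoef t) K.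
Proof. by move=> ht; exact: (@wsum_sob_le _ 1 m _ _ K_ge0 m_ge1 (wcoef_wsum ht)). Qed.

Definition nlcoef (t : R) : int -> R[i] := product_coef (wcoef t) (wcoef t) (wcoef t).

Lemma nlcoef_sob_le t : 0 <= t <= S -> sob_le 1 (nlcoef t) (27 * K * K * K).
Proof. by move=> /wcoef_hle1 h; exact: product_coef_sob_le. Qed.

Lemma nlcoef_cvg t l : 0 <= t <= S ->
  ccvg (fun N => tri (fun _ _ _ => 1) (wcoef t) (wcoef t) (wcoef t) N l) (nlcoef t l).
Proof.
by move=> ht; have h1 := sob_le_l1 (wcoef_hle1 ht); exact: (product_coef_cvg l h1 h1 h1).
Qed.

Lemma fcoef_cubic t l : 0 <= t <= S -> fcoef (fun y => cubic (w t y)) l = nlcoef t l.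
Proof.
move=> ht; have h1 := sob_le_l1 (wcoef_hle1 ht).
have b := cbounded_fseries h1.
have [m1 m2 _] := w_L2 ht.
apply: fcoef_ae.
- by rewrite /cubic; apply: cmeasM => //; apply: cmeasM => //; exact: cmeasJ.
- by have [] := cboundedM (cboundedM b (cboundedJ b)) b.
by apply: (ae_mono (ae_fseries (w_L2 ht) h1)) => x hx /hx ->.
Qed.

Lemma nlcoef_lip s t D : 0 <= s <= S -> 0 <= t <= S ->
  sob_le 1 (fun l => wcoef s l - wcoef t l) D ->
  sob_le 1 (fun l => nlcoef s l - nlcoef t l) (81 * 1 * K ^+ 2 * D).
Proof.
move=> hs ht hD.
apply: (@sob_le_lim _ 1 (fun N l => tri (fun _ _ _ => 1) (wcoef s) (wcoef s) (wcoef s) N l -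
  tri (fun _ _ _ => 1) (wcoef t) (wcoef t) (wcoef t) N l) _ _ 0) => [N _|l].
  by apply: tri_lip => //; [move=> *; rewrite cmod1|exact: wcoef_hle1|exact: wcoef_hle1].
by apply: ccvgB; exact: nlcoef_cvg.
Qed.

(** Times outside [0,S] are sent to the nearest endpoint. *)
Definition clamp (s : R) : R := Num.max 0 (Num.min s S).

Lemma clamp_in s : 0 <= clamp s <= S.
Proof.
have S0 := ltW S_gt0.
by rewrite /clamp le_max lexx/= ge_max S0 ge_min lexx orbT.
Qed.

Lemma clamp_id s : 0 <= s <= S -> clamp s = s.
Proof. by move=> /andP[s0 sS]; rewrite /clamp (min_idPl sS) (max_idPr s0). Qed.

Lemma clamp_lip s t : `|clamp s - clamp t| <= `|s - t|.
Proof.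
have S0 := S_gt0; rewrite /clamp.
have h (x : R) : Num.max 0 (Num.min x S) = if x <= 0 then 0 else if x <= S then x else S.
  case: (leP x S) => xS; last first.
    by rewrite (max_idPr (ltW S0)); case: leP => // x0; lra.
  by case: (leP x 0).
rewrite !h.
have := ler_norm (s - t); have := ler_norm (t - s); rewrite (distrC t s).
by case: (leP s 0); case: (leP t 0); case: (leP s S); case: (leP t S) => *;
  rewrite ler_norml; apply/andP; split; lra.
Qed.

Lemma nlcoef_clamp_continuous l : ccontinuous (fun s => nlcoef (clamp s) l).
Proof.
apply: ccontinuous_eps => t e e0.
pose e' := e / (81 * 1 * K ^+ 2 + 1).
have k0 : 0 <= 81 * 1 * K ^+ 2 by rewrite !mulr_ge0// sqr_ge0.
have k1 : 0 < 81 * 1 * K ^+ 2 + 1 by rewrite ltr_wpDl.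
have e'0 : 0 < e' by rewrite divr_gt0.
have [d d0 hd] := wcoef_continuous (clamp_in t) e'0.
exists d => // s hs.
have h := nlcoef_lip (clamp_in s) (clamp_in t)
  (hd _ (clamp_in s) (le_lt_trans (clamp_lip s t) hs)).
apply: (le_trans (sob_le_pt l h)).
apply: (@le_trans _ _ ((81 * 1 * K ^+ 2 + 1) * e')).
  by rewrite ler_wpM2r ?(ltW e'0)// lerDl.
by rewrite mulrC divfK// gt_eqF.
Qed.

Let kern (t : R) (s : R) (l : int) : R[i] :=
  cis (- ((t - s) * l%:~R ^+ 2)) * nlcoef (clamp s) l.

Let kern_continuous t l : ccontinuous (fun s => kern t s l).
Proof.
apply: ccontinuousM; last exact: nlcoef_clamp_continuous.
rewrite (_ : (fun s => _) = (fun s => cis (l%:~R ^+ 2 * s + - (t * l%:~R ^+ 2)))).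
  exact: ccontinuous_cis.
by apply: funext => s; congr cis; ring.
Qed.

Let kern_sob_le t s : sob_le 1 (kern t s) (27 * K * K * K).
Proof.
apply: sob_le_mod (nlcoef_sob_le (clamp_in s)) => l.
by rewrite cmodM cmod_cis mul1r.
Qed.

Let duh (t : R) (l : int) : R[i] := cintegral `[0, t]%classic (kern t ^~ l).

Let M : R := 3 * (27 * K * K * K).

(** The Duhamel integral is itself a Fourier series: its partial sums are
   integrals of partial sums, to which dominated convergence in time applies. *)
Lemma duhamel_term t l : 0 <= t <= S ->
  let I x := cintegral `[0, t]%classic
    (fun s => schrodinger (t - s) (fun y => cubic (w s y)) x) in
  cbounded I /\ fcoef I l = duh t l.
Proof.
move=> ht I; have /andP[t0 tS] := ht.
have mt : measurable (`[0, t]%classic : set (measurableTypeR R)).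
  exact: measurable_itv.
have ft : (mu (`[0%R, t]%classic : set R) < +oo)%E.
  by rewrite /mu lebesgue_measure_itv/=; case: ifP => _; rewrite ?ltry// ltry.
have IE x : I x = cintegral `[0, t]%classic (fun s => fseries (kern t s) x).
  apply: eq_cintegral => s; rewrite /= in_itv/= => /andP[s0 st].
  have hs : 0 <= s <= S by rewrite s0 (le_trans st).
  have -> : kern t s = fun k => cis (- ((t - s) * k%:~R ^+ 2)) *
      fcoef (fun y => cubic (w s y)) k.
    by apply: funext => k; rewrite (fcoef_cubic k hs) /kern (clamp_id hs).
  by [].
have cfp N x : cmeas `[0, t]%classic (fun s => fpartial (kern t s) x N).
  have -> : (fun s => fpartial (kern t s) x N) =
      fun s => \sum_(k <- zrange N) kern t s k * cis (k%:~R * x).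
    by apply: funext => s; rewrite fpartialE.
  apply: cmeas_sum => k; apply: cmeasM; last exact: cmeas_cst.
  exact: ccontinuous_meas.
have bfp N x s : `[0, t]%classic s -> cmod (fpartial (kern t s) x N) <= M.
  by move=> _; exact: cmod_fpartial_le (sob_le_l1 (kern_sob_le t s)) x N.
have pE N x : fpartial (duh t) x N =
    cintegral `[0, t]%classic (fun s => fpartial (kern t s) x N).
  transitivity (cintegral `[0, t]%classic
      (fun s => \sum_(k <- zrange N) kern t s k * cis (k%:~R * x))); last first.
    by apply: eq_cintegral => s _; rewrite fpartialE.
  have ik k : cintegrable `[0, t]%classic (fun s => kern t s k).
    exact: ccontinuous_integrable.
  rewrite fpartialE cintegral_sum//; last first.
    move=> k; have -> : (fun s => kern t s k * cis (k%:~R * x)) =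
        fun s => cis (k%:~R * x) * kern t s k by apply: funext => s; rewrite mulrC.
    exact: cintegrableZ.
  apply: eq_bigr => k _; rewrite mulrC -cintegralZ//.
  by apply: eq_cintegral => s _; rewrite mulrC.
have lim x : ccvg (fpartial (duh t) x) (I x).
  rewrite IE.
  have lc s : `[0, t]%classic s -> ccvg (fun N => fpartial (kern t s) x N) (fseries (kern t s) x).
    by move=> _; exact: fseries_cvg (sob_le_l1 (kern_sob_le t s)) x.
  have lae : {ae mu, forall s, `[0, t]%classic s ->
      ccvg (fun N => fpartial (kern t s) x N) (fseries (kern t s) x)}.
    by apply: aeW => s; exact: lc.
  have [_ h] := @cdominated _ `[0, t]%classic (fun N s => fpartial (kern t s) x N)
    (fun s => fseries (kern t s) x) (fun=> M) mt (fun N => cfp N x)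
    (cmeas_lim (fun N => cfp N x) lc) lae (integrable_cst_fin M mt ft)
    (fun N => @bfp N x).
  by apply: ccvg_ext h => N; rewrite pE.
have bd N x : tor x -> cmod (fpartial (duh t) x N) <= 2 * (M * fine (mu `[0, t]%classic)).
  by move=> _; rewrite pE; exact: cmod_cintegral_le (bfp N x).
split; last exact: (fcoef_fpartial_lim bd (fun x _ => lim x)).
apply: (@cbounded_lim _ (fun N x => fpartial (duh t) x N)) => [n||x _].
- exact: cintegrable_meas (cintegrable_fpartial _ n).
- exact: bd.
- exact: lim.
Qed.

Lemma phi_L2 : square_integrable phi /\ forall l, fcoef phi l = wcoef 0 l.
Proof.
have [_ _ h0 _] := w_mild.
have z : 0 <= (0 : R) <= S by rewrite lexx ltW.
have [m1 m2 m3] := w_L2 z.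
split; last by move=> l; apply: eq_fcoef => x tx; rewrite h0.
have h0' x : tor x -> w 0 x = phi x by exact: h0.
apply: (@square_integrable_dom _ _ (fun x => complex.Re (w 0 x) ^+ 2 + complex.Im (w 0 x) ^+ 2)) => //.
  split.
    by apply: eq_measurable_fun m1 => x; rewrite inE => /h0' ->.
  by apply: eq_measurable_fun m2 => x; rewrite inE => /h0' ->.
by move=> x /h0' ->; rewrite sqr_cmod.
Qed.

Lemma duhamel_coef t l : 0 <= t <= S ->
  wcoef t l = cis (- (t * l%:~R ^+ 2)) * wcoef 0 l - 'i%C * (eps ^+ 2)%:C * duh t l.
Proof.
move=> ht; have [_ _ _ h] := w_mild.
have [b e] := duhamel_term l ht.
have [sp ep] := phi_L2.
have z : 0 <= (0 : R) <= S by rewrite lexx ltW.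
have hf : sob_le 1 (fun l => cis (- (t * l%:~R ^+ 2)) * fcoef phi l) K.
  by apply: sob_le_mod (wcoef_hle1 z) => k; rewrite cmodM cmod_cis mul1r ep.
have bf := cbounded_fseries (sob_le_l1 hf).
have b2 := cboundedM (cbounded_cst ('i%C * (eps ^+ 2)%:C)) b.
have [m1 m2 _] := w_L2 ht.
pose I x := cintegral `[0, t]%classic
  (fun s => schrodinger (t - s) (fun y => cubic (w s y)) x).
have mF : cmeas tor (fun x => schrodinger t phi x - 'i%C * (eps ^+ 2)%:C * I x).
  apply: cmeasD; first by have [] := bf.
  by apply: cmeasN; have [] := b2.
have ew : wcoef t l = fcoef (fun x => schrodinger t phi x - 'i%C * (eps ^+ 2)%:C * I x) l.
  exact: (fcoef_ae l (conj m1 m2) mF (h t ht)).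
rewrite ew.
rewrite (fcoefB l (cbounded_integrable bf) (cbounded_integrable b2)).
rewrite (fcoefZ _ l (cbounded_integrable b)) e -ep.
by rewrite (fcoef_fseries (sob_le_l1 hf)).
Qed.

(** The twisted coefficients, extended past [0,S] by freezing the nonlinearity so
   that they are differentiable up to the endpoints. *)
Definition profile (t : R) (l : int) : R[i] :=
  wcoef 0 l - 'i%C * (eps ^+ 2)%:C *
   (cintegral `[-1, t]%classic (fun s => cis (l%:~R ^+ 2 * s + 0) * nlcoef (clamp s) l) -
    cintegral `[-1, 0]%classic (fun s => cis (l%:~R ^+ 2 * s + 0) * nlcoef (clamp s) l)).

Let prof_continuous l :
  ccontinuous (fun s => cis (l%:~R ^+ 2 * s + 0) * nlcoef (clamp s) l).
Proof. by apply: ccontinuousM; [exact: ccontinuous_cis|exact: nlcoef_clamp_continuous]. Qed.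

Lemma profileE t l : 0 <= t <= S -> profile t l = twist t (wcoef t) l.
Proof.
move=> ht; have /andP[t0 tS] := ht.
rewrite /twist duhamel_coef// mulrBr mulrA -cisD addrN cis0 mul1r /profile.
congr (_ - _); rewrite mulrCA; congr (_ * _).
rewrite cintegral_itvB//; last by rewrite t0 lerN10.
rewrite -cintegralZ; [|exact: measurable_itv|exact: ccontinuous_integrable].
apply: eq_cintegral => s _; rewrite /kern mulrA -cisD; congr (cis _ * _); ring.
Qed.

Lemma profile_derive t l : 0 <= t <= S ->
  is_cderive (profile^~ l) t (- 'i%C * (eps ^+ 2)%:C * twist t (nlcoef t) l).
Proof.
move=> ht; have t1 : -1 < t by move: ht => /andP[]; lra.
have d := is_cderive_integral t1 (prof_continuous l).
pose F s := cis (l%:~R ^+ 2 * s + 0) * nlcoef (clamp s) l.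
have -> : (profile^~ l) = fun s => wcoef 0 l + - ('i%C * (eps ^+ 2)%:C) *
    (cintegral `[-1, s]%classic F + - cintegral `[-1, 0]%classic F).
  by apply: funext => s; rewrite mulNr.
have -> : - 'i%C * (eps ^+ 2)%:C * twist t (nlcoef t) l =
    0 + - ('i%C * (eps ^+ 2)%:C) * (F t + 0).
  by rewrite /F (clamp_id ht) /twist !addr0 add0r [t * _]mulrC !mulNr.
exact: (is_cderiveD (is_cderive_cst t (wcoef 0 l)) (is_cderiveZ (- ('i%C * (eps ^+ 2)%:C))
  (is_cderiveD d (is_cderive_cst t (- cintegral `[-1, 0]%classic F))))).
Qed.

Lemma profile_nlcoef t l : 0 <= t <= S ->
  ccvg (fun N => tri (phase_ker t) (profile t) (profile t) (profile t) N l) (twist t (nlcoef t) l).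
Proof.
move=> ht; apply: ccvg_ext (ccvgZ (cis (t * l%:~R ^+ 2)) (nlcoef_cvg l ht)) => N.
rewrite -tri_twist; apply: eq_tri => l1 l2 l3 _ _ _ _.
by rewrite mulr1 !profileE.
Qed.

End MildSolution.

(** * Uniform error bound *)

Section Cutoff.
Context {R : realType}.

(** At frequencies up to 1 / (8 tau0) a time step changes the phase of an
   interaction by at most 1/2. *)
Definition cutoff (tau0 : R) : nat := Num.truncn (8 * tau0)^-1.

Lemma cutoff_le (tau0 : R) : 0 < tau0 -> 8 * tau0 * (cutoff tau0)%:R <= 1.
Proof.
move=> t0; have d0 : 0 < 8 * tau0 by rewrite mulr_gt0.
rewrite mulrC -ler_pdivlMr// div1r /cutoff truncn_le// invr_ge0 ltW//.
Qed.

(** Beyond the cutoff the H^1 weight is at most (8 tau0)^(2(m-1)) times the H^m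
   weight. *)
Lemma cutoff_tail (tau0 m K : R) (c : int -> R[i]) : 0 < tau0 -> 1 <= m ->
  0 <= K -> wsum_le m c K ->
  sob_le 1 (fun l => c l - low_freq (cutoff tau0) c l) ((8 * tau0) `^ (m - 1) * K).
Proof.
move=> t0 m1 K0 h; have d0 : 0 < 8 * tau0 by rewrite mulr_gt0.
split; first by rewrite mulr_ge0// powR_ge0.
move=> N; rewrite exprMn; apply: (le_trans _ (ler_wpM2l (sqr_ge0 _) (h N))).
rewrite mulr_sumr; apply: ler_sum => l _; rewrite /low_freq.
have l0 : 0 <= 1 + l%:~R ^+ 2 :> R by rewrite addr_ge0// sqr_ge0.
case: leqP => hl.
  rewrite subrr cmod0 mulr0 expr0n/=; apply: mulr_ge0; first exact: sqr_ge0.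
  by apply: mulr_ge0; [exact: powR_ge0|exact: sqr_ge0].
rewrite subr0 exprMn [leRHS]mulrA ler_wpM2r ?sqr_ge0// expr1 sqr_jap.
have -> : (1 + l%:~R ^+ 2) `^ m = (1 + l%:~R ^+ 2) `^ (m - 1) * (1 + l%:~R ^+ 2) :> R.
  rewrite -[X in _ = _ * X]powRr1// -powRD ?subrK//.
  by rewrite (_ : 1 + _ != 0) ?implybT// gt_eqF// ltr_pwDl// sqr_ge0.
rewrite [leRHS]mulrA ler_peMl//.
have -> : ((8 * tau0) `^ (m - 1)) ^+ 2 = ((8 * tau0) ^+ 2) `^ (m - 1).
  by rewrite !expr2 (powRM _ (ltW d0) (ltW d0)).
rewrite -powRM ?sqr_ge0//.
have e1 : 1 `^ (m - 1) = 1 :> R by rewrite powR1.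
rewrite -[leLHS]e1.
apply: ge0_ler_powR; rewrite ?nnegrE ?mulr_ge0 ?sqr_ge0 ?subr_ge0 ?(ltW t0)//.
have hN : (8 * tau0)^-1 <= `|l%:~R|.
  rewrite -intr_norm ltW// (lt_le_trans (truncnS_gt _))// -/(cutoff tau0).
  by rewrite -natr_absz ler_nat.
have h1 : 1 <= 8 * tau0 * `|l%:~R|.
  by rewrite -ler_pdivrMl// mulr1.
have : 1 <= (8 * tau0 * `|l%:~R|) ^+ 2 by rewrite exprn_ege1.
rewrite exprMn real_normK ?num_real// => /le_trans; apply.
by rewrite ler_wpM2l ?sqr_ge0// lerDr.
Qed.

End Cutoff.

Lemma Linfty_sobolev_ge0 {R : realType} (S s : R) (w : R -> R -> R[i]) :
  0 < S -> (0 <= Linfty_sobolev S s w)%E.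
Proof.
move=> S0; have h := ess_sup_ge lebesgue_measure
  (fun t : R => if t \in `[0, S] then sobolev_norm s (w t) else 0%E).
have zS : 0 <= (0 : R) <= S by rewrite lexx ltW.
have [t [_ _ ht]] := dense_times S0 h zS ltr01.
apply: le_trans ht; case: ifP => // _; exact: sobolev_norm_ge0.
Qed.

Section Main.
Context {R : realType}.
Variables (eps T m K tau tau0 : R) (phi : R -> R[i]) (w : R -> R -> R[i]).
Hypotheses (eps_gt0 : 0 < eps) (T_gt0 : 0 < T) (m_ge2 : 2 <= m) (K_ge0 : 0 <= K).
Hypotheses (tau_gt0 : 0 < tau) (tau0_gt0 : 0 < tau0) (tau_le : tau <= 4 * tau0 ^+ 2).
Let S := T / eps ^+ 2.
Hypothesis w_mild : mild_nls eps S phi w.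
Hypothesis w_bound : (Linfty_sobolev S m w <= K%:E)%E.

Let S_gt0 : 0 < S.
Proof. by rewrite divr_gt0// exprn_gt0. Qed.

Let m_ge1 : 1 <= m.
Proof. by rewrite (le_trans _ m_ge2)// ler1n. Qed.

Let a (n : nat) : int -> R[i] := fcoef (nlri eps tau phi n).
Let X (n : nat) : int -> R[i] := twist (n%:R * tau) (a n).
Let Z (n : nat) : int -> R[i] := twist (n%:R * tau) (scheme_nl tau (a n)).
Let V := profile eps S w.

Let zS : 0 <= (0 : R) <= S.
Proof. by rewrite lexx ltW. Qed.

Let phi_H1 : square_integrable phi /\ sob_le 1 (fcoef phi) K.
Proof.
have [sp ep] := phi_L2 S_gt0 w_mild; split => //.
apply: sob_le_ext (wcoef_hle1 S_gt0 m_ge1 K_ge0 w_mild w_bound zS) => l.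
exact: ep.
Qed.

Lemma nlri_regular n : square_integrable (nlri eps tau phi n) /\ exists D, sob_le 1 (a n) D.
Proof. by have [sp hp] := phi_H1; exact: nlri_H1 sp hp. Qed.

(** The twist is an isometry, so the error of the twisted coefficients is that of
   the coefficients. *)
Lemma coef_error :
  let eta := (8 * tau0) `^ (m - 1) * K in
  let Err := err_const T K * (eps ^+ 2 * tau + eta) * expR (T * lip_const (K + 1)) in
  Err <= 1 -> forall n, n%:R * tau <= S ->
  sob_le 1 (fun l => a n l - wcoef w (n%:R * tau) l) Err.
Proof.
move=> eta Err small n hn.
have e20 : 0 < eps ^+ 2 by rewrite exprn_gt0.
have TS : eps ^+ 2 * S <= T by rewrite /S mulrC divfK// gt_eqF.
have N0s : 16 * tau * (cutoff tau0)%:R ^+ 2 <= 1.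
  have h1 := cutoff_le tau0_gt0.
  have h2 : (8 * tau0 * (cutoff tau0)%:R) ^+ 2 <= 1.
    by rewrite exprn_ile1// !mulr_ge0// ltW.
  have := ler_wpM2r (sqr_ge0 (cutoff tau0)%:R) tau_le.
  by nra.
have pE t l : 0 <= t <= S -> V t l = twist t (wcoef w t) l.
  by move=> ht; exact: (profileE S_gt0 m_ge1 K_ge0 w_mild w_bound l ht).
have hw t : 0 <= t <= S -> wsum_le m (wcoef w t) K.
  by move=> ht; exact: (wcoef_wsum S_gt0 K_ge0 w_mild w_bound ht).
have V2 t : 0 <= t <= S -> sob_le 2 (V t) K.
  move=> ht; apply: (sob_le_ext (fun l => pE t l ht)); apply/sob_le_twist.
  exact: wsum_sob_le K_ge0 m_ge2 (hw t ht).
have Vt t : 0 <= t <= S -> sob_le 1 (fun l => V t l - low_freq (cutoff tau0) (V t) l) eta.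
  move=> ht; apply: sob_le_mod (cutoff_tail tau0_gt0 m_ge1 K_ge0 (hw t ht)) => l.
  rewrite /low_freq pE// /twist.
  by case: ifP => _; rewrite ?subrr ?cmod0// !subr0 cmodM cmod_cis mul1r.
have hn0 : 0 <= n%:R * tau <= S by rewrite hn mulr_ge0// ltW.
have := @scheme_error R T (eps ^+ 2) tau S K eta (cutoff tau0) V
  (fun t => twist t (nlcoef w t)) X Z e20 tau_gt0 TS N0s V2 Vt.
move=> /(_ (fun t ht l => profile_derive S_gt0 m_ge1 K_ge0 w_mild w_bound l ht)).
move=> /(_ (fun t ht l => profile_nlcoef S_gt0 m_ge1 K_ge0 w_mild w_bound l ht)).
have X0 l : X 0%N l = V 0 l.
  rewrite pE// /X mul0r /a; have [_ ep] := phi_L2 S_gt0 w_mild.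
  by rewrite /twist -ep.
have Xs k l : X k.+1 l = X k l - 'i%C * (eps ^+ 2)%:C * tau%:C * Z k l.
  have [sk [D hD]] := nlri_regular k.
  have [_ e] := nlri_step_spec eps tau sk hD.
  rewrite /X {1}/twist /a [nlri eps tau phi k.+1]iterS e mulrA -cisD.
  have -> : k.+1%:R * tau * l%:~R ^+ 2 + - (tau * l%:~R ^+ 2) = k%:R * tau * l%:~R ^+ 2.
    by rewrite -natr1; ring.
  by rewrite /Z /twist; ring.
have Xn k l : ccvg (fun N => tri (scheme_ker tau (k%:R * tau)) (X k) (X k) (X k) N l) (Z k l).
  have [sk [D hD]] := nlri_regular k.
  apply: ccvg_ext (ccvgZ (cis (k%:R * tau * l%:~R ^+ 2)) (scheme_nl_cvg tau l hD)) => N.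
  by rewrite -tri_twist.
move=> /(_ X0 Xs Xn small n hn) H.
pose d l := a n l - wcoef w (n%:R * tau) l.
have Hd : sob_le 1 (twist (n%:R * tau) d) Err.
  apply: sob_le_ext H => l.
  by rewrite (pE _ l hn0) /X /twist /d mulrBr.
exact: (sob_le_twist 1 (n%:R * tau) d Err).1 Hd.
Qed.

Lemma square_integrable_error n : n%:R * tau <= S ->
  square_integrable (fun x => w (n%:R * tau) x - nlri eps tau phi n x) /\
  forall l, fcoef (fun x => w (n%:R * tau) x - nlri eps tau phi n x) l =
    - (a n l - wcoef w (n%:R * tau) l).
Proof.
move=> hn; have hn0 : 0 <= n%:R * tau <= S by rewrite hn mulr_ge0// ltW.
have sw := w_L2 w_mild hn0; have [sn _] := nlri_regular n.
split; first exact: square_integrableB.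
move=> l; rewrite fcoefB; [|exact: square_integrable_integrable..].
by rewrite opprB.
Qed.

End Main.

Theorem theorem3p1 (R : realType) (T m alpha : R) (phi : R -> R[i])
  (w : R -> R -> R -> R[i])
  (T_gt0 : 0 < T) (m_ge2 : 2 <= m) (alpha01 : 0 < alpha < 1)
  (w_sol : forall eps : R, 0 < eps <= 1 ->
     mild_nls eps (T / eps ^+ 2) phi (w eps))
  (w_bound : exists K : R, forall eps : R, 0 < eps <= 1 ->
     (Linfty_sobolev (T / eps ^+ 2) m (w eps) <= K%:E)%E) :
  exists tau_star C : R,
    [/\ 0 < tau_star <= 1, 0 < C &
      forall eps : R, 0 < eps <= 1 ->
      forall tau0 : R, 0 < tau0 <= tau_star ->
      forall tau : R,
        0 < tau <= alpha * pi * tau0 ^+ 2 / (1 + tau0) ^+ 2 ->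
        alpha * pi * tau0 ^+ 2 / (1 + tau0) ^+ 2 < 1 ->
      forall n : nat, n%:R <= T / eps ^+ 2 / tau ->
        (sobolev_norm 1
           (fun x : R => w eps (n%:R * tau)%R x - nlri eps tau phi n x)%R
           <= (C * (eps ^+ 2 * tau + tau0 `^ (m - 1)))%:E)%E /\
        (sobolev_norm 1 (nlri eps tau phi n)
           <= 1%:E + Linfty_sobolev (T / eps ^+ 2) 1 (w eps))%E].
Proof.
have [K0 hK0] := w_bound; pose K := Num.max K0 0.
have K_ge0 : 0 <= K by rewrite le_max lexx orbT.
have hK eps : 0 < eps <= 1 -> (Linfty_sobolev (T / eps ^+ 2) m (w eps) <= K%:E)%E.
  by move=> /hK0 h; apply: (le_trans h); rewrite lee_fin le_max lexx.
pose B := 8 `^ (m - 1) * K.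
have B0 : 0 <= B by rewrite mulr_ge0// powR_ge0.
pose F := err_const T K * expR (T * lip_const (K + 1)).
have F0 : 0 <= F.
  have L0 : 0 <= lip_const K by rewrite /lip_const mulr_ge0// sqr_ge0.
  have T0 := ltW T_gt0.
  have P0 : 0 <= T * (lip_const K ^+ 2 * K) by rewrite !mulr_ge0// sqr_ge0.
  apply: mulr_ge0; last exact: expR_ge0.
  by rewrite /err_const !(addr_ge0, mulr_ge0)// ?exprn_ge0.
pose C := F * (1 + B) + 1.
have C1 : 1 <= C by rewrite /C lerDr mulr_ge0// addr_ge0.
have C0 : 0 < C by exact: lt_le_trans C1.
(* C times the error is at most 5 C tau0, so this threshold keeps it below 1. *)
exists (5 * C)^-1, C; split => //.
  rewrite invr_gt0 mulr_gt0//= invf_le1 ?mulr_gt0//; lra.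
move=> eps eps01 tau0 /andP[tau00 tau0s] tau /andP[tau_gt0 tau_le] _ n hn.
have /andP[eps0 eps1] := eps01; have /andP[al0 al1] := alpha01.
have small0 : 5 * C * tau0 <= 1.
  by rewrite mulrC -ler_pdivlMr ?mulr_gt0// div1r.
have tau01 : tau0 <= 1.
  by rewrite (le_trans _ small0)// ler_peMl ?(ltW tau00)//; lra.
have tau4 : tau <= 4 * tau0 ^+ 2.
  apply: (le_trans tau_le).
  have s0 : 0 <= tau0 ^+ 2 by rewrite sqr_ge0.
  have d1 : 1 <= (1 + tau0) ^+ 2 by rewrite exprn_ege1// lerDl ltW.
  rewrite ler_pdivrMr; last exact: lt_le_trans d1.
  have p4 : alpha * pi <= 4.
    have [/andP[p0 p2] _] := pihalf_02_cos_pihalf R.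
    have := pi_gt0 R; nra.
  apply: (@le_trans _ _ (4 * tau0 ^+ 2)); first by rewrite ler_wpM2r.
  by rewrite ler_peMr// mulr_ge0.
have tn : n%:R * tau <= T / eps ^+ 2 by rewrite -ler_pdivlMr.
have pw0 : 0 <= tau0 `^ (m - 1) by exact: powR_ge0.
have e20 : 0 <= eps ^+ 2 * tau by rewrite mulr_ge0 ?sqr_ge0// ltW.
pose Err := err_const T K * (eps ^+ 2 * tau + (8 * tau0) `^ (m - 1) * K) *
  expR (T * lip_const (K + 1)).
have ErrC : Err <= C * (eps ^+ 2 * tau + tau0 `^ (m - 1)).
  have -> : Err = F * (eps ^+ 2 * tau + B * tau0 `^ (m - 1)).
    by rewrite /Err /F /B powRM ?(ltW tau00)//; ring.
  have h : eps ^+ 2 * tau + B * tau0 `^ (m - 1) <=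
      (1 + B) * (eps ^+ 2 * tau + tau0 `^ (m - 1)).
    have := mulr_ge0 B0 e20; nra.
  apply: (le_trans (ler_wpM2l F0 h)); rewrite mulrA /C mulrDl mul1r lerDl.
  exact: addr_ge0.
have Csmall : C * (eps ^+ 2 * tau + tau0 `^ (m - 1)) <= 1.
  apply: (le_trans _ small0); rewrite -mulrA mulrCA ler_wpM2l ?(ltW C0)//.
  have h1 : eps ^+ 2 * tau <= 4 * tau0.
    have h : eps ^+ 2 * tau <= tau by rewrite ler_piMl ?(ltW tau_gt0)// exprn_ile1// ltW.
    by have := mulr_ge0 (ltW tau00) (_ : 0 <= 1 - tau0); rewrite subr_ge0 => /(_ tau01); nra.
  have h2 : tau0 `^ (m - 1) <= tau0.
    rewrite -[leRHS]powRr1 ?(ltW tau00)//; apply: ger_powR; first by rewrite tau00.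
    by lra.
  lra.
have Err1 := le_trans ErrC Csmall.
have hmild := w_sol eps eps01.
have S0 : 0 < T / eps ^+ 2 by rewrite divr_gt0// exprn_gt0.
have tS : 0 <= n%:R * tau <= T / eps ^+ 2 by rewrite tn mulr_ge0// ltW.
have he := coef_error eps0 T_gt0 m_ge2 K_ge0 tau_gt0 tau00 tau4 hmild (hK eps eps01) Err1 tn.
have [sq ec] := square_integrable_error eps0 T_gt0 m_ge2 K_ge0 tau_gt0 hmild
  (hK eps eps01) tn.
split.
  apply/sobolev_norm1P; first by rewrite mulr_ge0 ?(ltW C0)// addr_ge0.
  split => //; apply: sob_le_le ErrC _.
  by apply: sob_le_ext (sob_leN he) => l; rewrite ec.
have L0 := Linfty_sobolev_ge0 1 (w eps) S0.
case: (Linfty_sobolev (T / eps ^+ 2) 1 (w eps)) (wsum_all_times (s := 1) S0 hmild) L0.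
- move=> r hr r0; rewrite lee_fin in r0.
  have h1 : sob_le 1 (wcoef (w eps) (n%:R * tau)) r.
    by apply: (@wsum_sob_le _ 1 1) => //; apply: hr.
  apply/sobolev_norm1P; first by rewrite addr_ge0.
  have [sn _] := nlri_regular tau eps0 T_gt0 m_ge2 K_ge0 hmild (hK eps eps01) n.
  split => //; apply: sob_le_le (sob_le_ext _ (sob_leD he h1)).
    by rewrite lerD2r.
  by move=> l; rewrite subrK.
- by move=> _ _; rewrite addey// leey.
- by move=> _.
Qed.
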